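(* Let $\mathcal{T}$ be a topologically mixing random group extension of a random countable Markov shift $f$ with the relative BIP property by a countable group $G$. Suppose that $\varphi:\mathcal{E}\rightarrow\mathbb{R}$ is a locally fiber Hölder continuous function satisfying $$\int_{\Omega}\|\varphi(\omega,\cdot)\|_{\infty}\,d\mathbb{P}(\omega)<\infty \quad\text{and}\quad \int_{\Omega}\left|\log\|\mathcal{L}_{\varphi}^{\omega}\mathbf{1}\|_{\infty}\right|d\mathbb{P}(\omega)<\infty .$$ Then: (i) If $G$ is non-amenable, then for $\mathbb{P}$-a.e. $\omega\in \Omega$ one has $$\log {\rm spr}_{\mathcal{H}}(\mathcal{L}_{\tilde{\varphi}}^{\omega})<\Pi_{Gur}^{(r)}(f,\varphi).$$ (ii) If $\Pi_{Gur}^{(r)}(f,\varphi)=\Pi_{Gur}^{(r)}(\mathcal{T},\tilde{\varphi})$, then the group $G$ is amenable.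
   Context: **Random countable Markov shift.** $(\Omega,\mathcal{F},\mathbb{P})$ is a probability space and $\vartheta:\Omega\to\Omega$ an ergodic invertible $\mathbb{P}$-preserving transformation. $l$ is an $\mathbb{N}\cup\{\infty\}$-valued random variable with $l(\omega)>1$; $S(\omega)=\{j\in\mathbb{N}:j<l(\omega)\}$; $A_\omega=(\alpha_{i,j}(\omega))_{i\in S(\omega),j\in S(\vartheta\omega)}$ are matrices with entries in $\{0,1\}$ depending measurably on $\omega$. Put $\mathcal{E}_\omega=\{x=(x_0,x_1,\ldots):x_i\in S(\vartheta^i\omega),\ \alpha_{x_i,x_{i+1}}(\vartheta^i\omega)=1\ \forall i\ge 0\}$, assumed nonempty for a.e. $\omega$; $f_\omega:\mathcal{E}_\omega\to\mathcal{E}_{\vartheta\omega}$ is the left shift, $f=(f_\omega)_{\omega\in\Omega}$, $\mathcal{E}=\{(\omega,x):\omega\in\Omega,x\in\mathcal{E}_\omega\}$, $\Theta(\omega,x)=(\vartheta\omega,f_\omega x)$. **Words, mixing, BIP.** A word $(x_0,\ldots,x_{n-1})\in\mathbb{N}^n$ is $\omega$-admissible if $x_i<l(\vartheta^i\omega)$ for $0\le i\le n-1$ and $\alpha_{x_i,x_{i+1}}(\vartheta^i\omega)=1$ for $0\le i\le n-2$; $\mathcal{W}^n(\omega)$ is the set of such words; $[x_0,\ldots,x_{n-1}]_\omega=\{y\in\mathcal{E}_\omega:y_i=x_i,\ 0\le i\le n-1\}$. For a letter $a$, $\Omega_a=\{\omega:[a]_\omega\ne\emptyset\}$; $\mathcal{W}^1$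 is the set of letters $a$ with $\mathbb{P}(\Omega_a)>0$. For letters $a,b$, $\mathcal{W}^n_{a,b}(\omega)$ is the set of $(x_0,\ldots,x_{n-1})\in\mathcal{W}^n(\omega)$ with $x_0=a$ and $x_{n-1}b$ being $\vartheta^{n-1}\omega$-admissible. $f$ is topologically mixing if for all $a,b\in\mathcal{W}^1$ there is $N_{ab}\in\mathbb{N}$ such that for a.e. $\omega$ and all $n\ge N_{ab}$ with $a\in S(\omega)$, $b\in S(\vartheta^n\omega)$ one has $\mathcal{W}^n_{a,b}(\omega)\neq\emptyset$. $f$ has the relative big images and preimages (BIP) property if $f$ is topologically mixing and there is a family $\{\mathcal{I}_{bip}(\omega):\omega\in\Omega\}$ with $\mathcal{I}_{bip}(\omega)\subset\mathcal{W}^1(\omega)$ such that for a.e. $\omega$ and every $a\in\mathcal{W}^1(\omega)$ there exists $b\in\mathcal{I}_{bip}(\vartheta\omega)$ with $ab\in\mathcal{W}^2(\omega)$ or $c\in\mathcal{I}_{bip}(\vartheta^{-1}\omega)$ with $ca\in\mathcal{W}^2(\vartheta^{-1}\omega)$. **Potentials.** $V_n^\omega(\varphi)=\sup\{|\varphi(\omega,x)-\varphi(\omega,y)|:x,y\in\mathcal{E}_\omega,\ x_i=y_i,\ 0\le i\le n-1\}$. $\varphi$ is locally fiber Hölder continuous if there is a random variable $\kappa:\Omega\to\mathbb{N}$, $\kappa\ge1$, $\int\kappa\,d\mathbb{P}<\infty$, with $V_n^\omega(\varphi)\le\kappa(\omega)2^{-n}$ for a.e. $\omega$ and all $n\ge1$.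 $S_n\varphi=\sum_{i=0}^{n-1}\varphi\circ\Theta^i$. The random Perron–Frobenius operator is $\mathcal{L}_\varphi^\omega\phi(\vartheta\omega,x)=\sum_{y\in\mathcal{E}_\omega,f_\omega y=x}e^{\varphi(\omega,y)}\phi(\omega,y)$. In the integrability conditions $\|\cdot\|_\infty$ is the supremum norm over the fiber. **Random group extension.** Let $\psi:\mathbb{N}^{\mathbb{N}}\to G$ depend only on the coordinate $x_0$, and let $\psi_\omega=\psi|_{\mathcal{E}_\omega}$. The random group extension is $\mathcal{T}=(\mathcal{T}_\omega)$, $\mathcal{T}_\omega:\mathcal{E}_\omega\times G\to\mathcal{E}_{\vartheta\omega}\times G$, $\mathcal{T}_\omega(x,g)=(f_\omega x,g\psi_\omega(x))$. Write $\psi_\omega^n(x)=\psi_\omega(x)\psi_{\vartheta\omega}(f_\omega x)\cdots\psi_{\vartheta^{n-1}\omega}(f_\omega^{n-1}x)$, which depends only on $(x_0,\dots,x_{n-1})$, so $\psi_\omega^n(\alpha)$ makes sense for $\alpha\in\mathcal{W}^n(\omega)$. $\mathcal{T}$ is topologically mixing if for all $a,b\in\mathcal{W}^1$, $g\in G$ there is $N$ such that for a.e. $\omega$ and all $n\ge N$ with $a\in S(\omega)$, $b\in S(\vartheta^n\omega)$, there is $\alpha\in\mathcal{W}^n(\omega)$ with $[\alpha]_\omega\subset[a]_\omega$, $f_\omega^n([\alpha]_\omega)\supset[b]_{\vartheta^n\omega}$ and $\psi^n_\omega(\alpha)=g$. Put $\tilde\varphi(\omega,x,g)=\varphi(\omega,x)$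 on $\mathcal{E}\times G$ and $\mathcal{L}_{\tilde\varphi}^\omega v(\vartheta\omega,x,g)=\sum_{y\in\mathcal{E}_\omega,f_\omega y=x}e^{\varphi(\omega,y)}v(\omega,y,g\psi_\omega(y)^{-1})$; $\mathcal{L}_{\tilde\varphi}^{\omega,n}=\mathcal{L}_{\tilde\varphi}^{\vartheta^{n-1}\omega}\circ\cdots\circ\mathcal{L}_{\tilde\varphi}^{\omega}$. **Relative Gurevič pressure.** For $a\in\mathcal{W}^1$ let $n_a^{(0)}(\omega)=0$, $n_a^{(k+1)}(\omega)=\min\{n>n_a^{(k)}(\omega):\vartheta^n\omega\in\Omega_a\}$. Set $Z_n^\omega(\varphi,a,a)=\sum_{\alpha\in\mathcal{W}^n_{a,a}(\omega)}\exp(\sup_{y\in[\alpha]_\omega}S_n\varphi(\omega,y))$, and let $\tilde Z_n^\omega(\tilde\varphi,a,a)$ be the same sum restricted to those $\alpha$ with $\psi_\omega^n(\alpha)=id$. Then $\Pi_{Gur}^{(r)}(f,\varphi)$ is the value of $\lim_{j\to\infty}\frac{1}{n_a^{(j)}(\omega)}\log Z^\omega_{n_a^{(j)}(\omega)}(\varphi,a,a)$ and $\Pi_{Gur}^{(r)}(\mathcal{T},\tilde\varphi)$ is the same limit with $\tilde Z$; these limits exist, are constant for a.e. $\omega\in\Omega_a$, and do not depend on $a$. **Gibbs measure, spaces, spectral radius.** When $f$ has relative BIP and $\Pi_{Gur}^{(r)}(f,\varphi)<\infty$, there are a unique $\Theta$-invariant fiber Gibbs measure $d\mu(\omega,x)=d\mu_\omega(x)d\mathbb{P}(\omega)$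 and random variables $\lambda,C_\varphi:\Omega\to(0,\infty)$ with $\int\log\lambda_\omega d\mathbb{P}=\Pi_{Gur}^{(r)}(f,\varphi)$, $\int|\log C_\varphi|d\mathbb{P}<\infty$, and $C_\varphi(\omega)^{-1}\le\Lambda_n(\omega)\mu_\omega([x_0,\ldots,x_{n-1}]_\omega)e^{-S_n\varphi(\omega,x)}\le C_\varphi(\omega)$ for a.e. $\omega$, all $x\in\mathcal{E}_\omega$, all $n\ge1$, where $\Lambda_n(\omega)=\prod_{i=0}^{n-1}\lambda_{\vartheta^i\omega}$. $\mathcal{H}_\infty(\omega)$ is the space of functions $v:\mathcal{E}_\omega\times G\to\mathbb{R}$ with $\|v\|_{\mathcal{H}_\infty(\omega)}=(\sum_{g\in G}\|v(\cdot,g)\|_\infty^2)^{1/2}<\infty$, where here $\|\cdot\|_\infty$ is the $L^\infty(\mu_\omega)$-norm. Finally ${\rm spr}_{\mathcal{H}}(\mathcal{L}_{\tilde\varphi}^\omega)=\limsup_{n\to\infty}\|\mathcal{L}_{\tilde\varphi}^{\omega,n}\|^{1/n}$, where the norm is the operator norm from $\mathcal{H}_\infty(\omega)$ to $\mathcal{H}_\infty(\vartheta^n\omega)$. *)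

(* Defs.v *)
From HB Require Import structures.
From mathcomp Require Import all_boot all_order all_algebra.
From mathcomp Require Import all_classical all_reals all_analysis ess_sup_inf.

Set Implicit Arguments.
Unset Strict Implicit.
Unset Printing Implicit Defensive.

Import Order.TTheory GRing.Theory Num.Theory.
Import numFieldNormedType.Exports.

Local Open Scope classical_set_scope.
Local Open Scope ring_scope.

(* The sequence space N^N with the sigma-algebra generated by its coordinates;
   letters are natural numbers starting at 0. *)
Definition coordinate_sets : set (set (nat -> nat)) :=
  [set A | exists i k : nat, A = [set x | x i = k]].

Definition seq_space := g_sigma_algebraType coordinate_sets.
HB.instance Definition _ := Measurable.on seq_space.

Definition shift (x : seq_space) : seq_space := fun i => x i.+1.

(* [None] encodes the value infinity of l, so this is {j | j < l}. *)
Definition letters_below (l : option nat) : set nat :=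
  if l is Some m then [set j | (j < m)%N] else setT.

Definition nat_min (A : set nat) : nat :=
  xget 0%N [set n | A n /\ forall m, A m -> (n <= m)%N].

(* Sum of a family of real numbers over an arbitrary index set, as the sum of
   the positive parts minus the sum of the negative parts. *)
Definition family_sum {R : realType} {T : choiceType} (A : set T) (f : T -> R)
    : \bar R :=
  (\esum_(t in A) ((EFin \o f)^\+ t) - \esum_(t in A) ((EFin \o f)^\- t))%E.

Section base_dynamics.
Context {d : measure_display} {Omega : measurableType d} {R : realType}.
Variable P : probability Omega R.

Definition measure_preserving (theta : Omega -> Omega) : Prop :=
  measurable_fun setT theta /\
  forall A : set Omega, measurable A -> P (theta @^-1` A) = P A.

Definition ergodic (theta : Omega -> Omega) : Prop :=
  forall A : set Omega, measurable A -> theta @^-1` A = A ->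
    P A = 0%E \/ P A = 1%E.

End base_dynamics.

(* alpha w i j is only meaningful for i in S(w) and j in S(theta w). *)
Record random_shift {d : measure_display} {Omega : measurableType d}
    {R : realType} (P : probability Omega R) := RandomShift {
  theta : Omega -> Omega;
  thetaV : Omega -> Omega;
  l : Omega -> option nat;
  alpha : Omega -> nat -> nat -> bool;
  thetaK : cancel theta thetaV;
  thetaVK : cancel thetaV theta;
  theta_mp : measure_preserving P theta;
  measurable_thetaV : measurable_fun setT thetaV;
  theta_ergodic : ergodic P theta;
  measurable_l : forall n : nat, measurable [set w | l w = Some n];
  l_gt1 : forall w, if l w is Some m then (1 < m)%N else true;
  measurable_alpha : forall i j : nat,
    measurable [set w | letters_below (l w) i /\
                        letters_below (l (theta w)) j /\ alpha w i j];
  fiber_neq0 : {ae P, forall w, exists x : seq_space, forall i,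
    letters_below (l (iter i theta w)) (x i) /\
    alpha (iter i theta w) (x i) (x i.+1)}
}.

Section shift_definitions.
Context {d : measure_display} {Omega : measurableType d} {R : realType}.
Context {P : probability Omega R}.
Variable f : random_shift P.

Local Notation X := seq_space.

Definition theta_iter (n : nat) (w : Omega) : Omega := iter n (theta f) w.

Definition letters (w : Omega) : set nat := letters_below (l f w).

Definition fiber (w : Omega) : set X :=
  [set x | forall i, letters (theta_iter i w) (x i) /\
                     alpha f (theta_iter i w) (x i) (x i.+1)].

Definition skew (z : Omega * X) : Omega * X := (theta f z.1, shift z.2).

Definition admissible (w : Omega) (u : seq nat) : Prop :=
  (forall i, (i < size u)%N -> letters (theta_iter i w) (nth 0%N u i)) /\
  (forall i, (i.+1 < size u)%N ->
     alpha f (theta_iter i w) (nth 0%N u i) (nth 0%N u i.+1)).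

Definition words (n : nat) (w : Omega) : set (seq nat) :=
  [set u | size u = n /\ admissible w u].

Definition words_between (n : nat) (a b : nat) (w : Omega) : set (seq nat) :=
  [set u | words n w u /\ ohead u = Some a /\
           admissible (theta_iter n.-1 w) [:: last a u; b]].

Definition cylinder (w : Omega) (u : seq nat) : set X :=
  [set y | fiber w y /\ forall i, (i < size u)%N -> y i = nth 0%N u i].

Definition Omega_ (a : nat) : set Omega := [set w | cylinder w [:: a] !=set0].

(* Omega_ a is a projection, so it need not belong to the sigma-algebra of
   Omega: P (Omega_ a) > 0 is expressed as non-negligibility. *)
Definition essential_letters : set nat :=
  [set a | ~ P.-negligible (Omega_ a)].

Definition topologically_mixing : Prop :=
  forall a b, essential_letters a -> essential_letters b ->
  exists N : nat, {ae P, forall w, forall n, (N <= n)%N ->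
    letters w a -> letters (theta_iter n w) b ->
    words_between n a b w !=set0}.

Definition relative_BIP : Prop :=
  topologically_mixing /\
  exists Ibip : Omega -> set nat,
    (forall w, Ibip w `<=` letters w) /\
    {ae P, forall w, forall a, letters w a ->
      (exists2 b, Ibip (theta f w) b & words 2 w [:: a; b]) \/
      (exists2 c, Ibip (thetaV f w) c & words 2 (thetaV f w) [:: c; a])}.

(* Potentials are functions on the set of pairs (w, x) with x in fiber w;
   their values elsewhere are never used. *)

Definition fiber_norm (w : Omega) (h : X -> \bar R) : \bar R :=
  ereal_sup [set `|h x|%E | x in fiber w].

Definition variation (phi : Omega * X -> R) (n : nat) (w : Omega) : \bar R :=
  ereal_sup [set `|phi (w, z.1) - phi (w, z.2)|%:E | z in
    [set z : X * X | fiber w z.1 /\ fiber w z.2 /\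
                     forall i, (i < n)%N -> z.1 i = z.2 i]].

Definition locally_fiber_Holder (phi : Omega * X -> R) : Prop :=
  exists kappa : Omega -> nat,
    [/\ measurable_fun setT kappa,
        forall w, (1 <= kappa w)%N,
        (\int[P]_w ((kappa w)%:R : R)%:E < +oo)%E &
        {ae P, forall w, forall n, (1 <= n)%N ->
          (variation phi n w <= ((kappa w)%:R * 2^-1 ^+ n)%:E)%E}].

Definition birkhoff_sum (phi : Omega * X -> R) (n : nat) (z : Omega * X) : R :=
  \sum_(i < n) phi (iter i skew z).

(* The function L_phi^w h on the fiber over theta w. *)
Definition RPF (phi : Omega * X -> R) (w : Omega) (h : X -> R) (x : X)
    : \bar R :=
  family_sum [set y | fiber w y /\ shift y = x]
             (fun y => expR (phi (w, y)) * h y).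

Definition partition_sum (phi : Omega * X -> R) (w : Omega)
    (W : set (seq nat)) : \bar R :=
  \esum_(u in W)
    expeR (ereal_sup [set (birkhoff_sum phi (size u) (w, y))%:E
                     | y in cylinder w u]).

(* n_a^(k)(w). *)
Fixpoint return_time (a : nat) (w : Omega) (k : nat) : nat :=
  if k is k'.+1 then
    nat_min [set n | (return_time a w k' < n)%N /\ Omega_ a (theta_iter n w)]
  else 0%N.

(* p is the almost sure exponential growth rate of Z along the return times to
   Omega_ a, for every letter a. *)
Definition growth_rate (Z : nat -> Omega -> nat -> \bar R) (p : \bar R)
    : Prop :=
  forall a, essential_letters a ->
  {ae P, forall w, Omega_ a w ->
    (fun j => ((return_time a w j)%:R^-1)%:E *
              lne (Z (return_time a w j) w a))%E @ \oo --> p}.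

Definition is_pressure (phi : Omega * X -> R) (p : \bar R) : Prop :=
  growth_rate
    (fun n w a => partition_sum phi w (words_between n a a w)) p.

Definition Lambda (lambda : Omega -> R) (n : nat) (w : Omega) : R :=
  \prod_(i < n) lambda (theta_iter i w).

(* mu w is the fiber measure mu_w, viewed as a measure on N^N carried by
   fiber w; p stands for the relative Gurevich pressure of phi. *)
Record fiber_Gibbs (phi : Omega * X -> R) (p : \bar R)
    (mu : R.-pker Omega ~> X) (lambda C : Omega -> R) : Prop := {
  Gibbs_carried : {ae P, forall w, mu w (fiber w) = 1%E};
  Gibbs_invariant : forall B : set (Omega * X), measurable B ->
    (\int[P]_w mu w (xsection (skew @^-1` B) w) =
     \int[P]_w mu w (xsection B w))%E;
  Gibbs_measurable_lambda : measurable_fun setT lambda;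
  Gibbs_lambda_gt0 : forall w, 0 < lambda w;
  Gibbs_measurable_C : measurable_fun setT C;
  Gibbs_C_gt0 : forall w, 0 < C w;
  Gibbs_lambda_integral : (\int[P]_w (ln (lambda w))%:E = p)%E;
  Gibbs_C_integrable : P.-integrable setT (fun w => (ln (C w))%:E);
  Gibbs_bounds : {ae P, forall w, forall x, fiber w x ->
    forall n, (1 <= n)%N ->
    let q := ((Lambda lambda n w)%:E * mu w (cylinder w (mkseq x n)) *
              (expR (- birkhoff_sum phi n (w, x)))%:E)%E in
    ((C w)^-1%:E <= q /\ q <= (C w)%:E)%E}
}.

Section group_extension.
Variables (G : groupType) (psi : X -> G).

Definition depends_on_first_letter : Prop :=
  forall x y : X, x 0%N = y 0%N -> psi x = psi y.

Fixpoint psi_iter (n : nat) (x : X) : G :=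
  if n is n'.+1 then (psi x * psi_iter n' (shift x))%g else 1%g.

(* psi_iter n only sees the first n letters, so the word is extended by 0. *)
Definition psi_word (u : seq nat) : G := psi_iter (size u) (nth 0%N u).

Definition ext_topologically_mixing : Prop :=
  forall a b (g : G), essential_letters a -> essential_letters b ->
  exists N : nat, {ae P, forall w, forall n, (N <= n)%N ->
    letters w a -> letters (theta_iter n w) b ->
    exists u, [/\ words n w u,
                  cylinder w u `<=` cylinder w [:: a],
                  cylinder (theta_iter n w) [:: b]
                    `<=` iter n shift @` cylinder w u &
                  psi_word u = g]}.

Definition is_ext_pressure (phi : Omega * X -> R) (p : \bar R) : Prop :=
  growth_rate
    (fun n w a => partition_sum phi w
       (words_between n a a w `&` [set u | psi_word u = 1%g])) p.

Definition ext_RPF (phi : Omega * X -> R) (w : Omega) (v : X -> G -> R)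
    : X -> G -> R :=
  fun x g => fine (family_sum [set y | fiber w y /\ shift y = x]
    (fun y => expR (phi (w, y)) * v y (g * (psi y)^-1)%g)).

Fixpoint ext_RPF_iter (phi : Omega * X -> R) (n : nat) (w : Omega)
    (v : X -> G -> R) : X -> G -> R :=
  if n is n'.+1 then
    ext_RPF phi (theta_iter n' w) (ext_RPF_iter phi n' w v)
  else v.

Variable mu : R.-pker Omega ~> X.

Definition H_norm (w : Omega) (v : X -> G -> R) : \bar R :=
  sqrte (\esum_(g in [set: G])
    (ess_sup (mu w) (fun x => `|v x g|%:E) ^+ 2)%E).

Definition H_space (w : Omega) : set (X -> G -> R) :=
  [set v | (forall g, measurable_fun (fiber w) (v ^~ g)) /\
           (H_norm w v < +oo)%E].

(* Operator norm from H_space w to H_space (theta^n w). *)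
Definition ext_RPF_norm (phi : Omega * X -> R) (n : nat) (w : Omega)
    : \bar R :=
  ereal_sup [set H_norm (theta_iter n w) (ext_RPF_iter phi n w v) | v in
    [set v | H_space w v /\ (H_norm w v <= 1)%E]].

Definition spr (phi : Omega * X -> R) (w : Omega) : \bar R :=
  limn_esup (fun n => poweR (ext_RPF_norm phi n w) n%:R^-1).

End group_extension.

End shift_definitions.

(* Von Neumann's definition, for a discrete group: a left-invariant finitely
   additive probability on all subsets. *)
Definition amenable (R : realType) (G : groupType) : Prop :=
  exists m : set G -> R,
    [/\ forall A, 0 <= m A,
        m setT = 1,
        forall A B, A `&` B = set0 -> m (A `|` B) = m A + m B &
        forall (g : G) (A : set G), m [set (g * h)%g | h in A] = m A].

(* Main.v *)
Require Import Defs.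
From HB Require Import structures.
From mathcomp Require Import all_boot all_order all_algebra.
From mathcomp Require Import all_classical all_reals all_analysis.
From mathcomp Require Import measurable_realfun ess_sup_inf.
From mathcomp Require Import ring lra.

(** Both assertions follow from one estimate: if G is not amenable then, for
    almost every base point, the iterates of the transfer operator of the
    extension on functions (x, g) |-> u g satisfy, as vectors of l2(G),
      |L^n u (x, .)| <= e^(K + (p - c) n) |u|
    uniformly in x, with some c > 0 and p the pressure of the shift.

    The value L^n u (x, .) is a sum over the histories y of x, that is, the
    points with f^n y = x: the term of y is a translate of a vector carried by
    y, times the weight e^(S_n phi(y)). The triangle inequality bounds the norm
    by L^n 1 (x) |u|, and the Gibbs bounds give L^n 1 <= C Lambda_n, which grows
    at the rate p. The additional factor e^(-cn) comes from a loss in the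
    triangle inequality. Non-amenability of G provides a finite set K of group
    elements and eta > 0 such that every nonnegative v in l2(G) satisfies
    |v + v(. k)| <= (2 - eta) |v| for some k in K (nonamenable_gap; otherwise an
    ultralimit of the densities |v|^2 would be an invariant mean). By mixing of
    the extension, every history of x can be modified at its end into two
    histories which agree on many letters and whose group values differ by k.
    By Hoelder continuity the vectors carried by these two are nearly translates
    of each other by k, so that their sum loses a fixed proportion
    (norm2_pair, letter_gain, slot_gain). This works at times when distortion,
    weights and letters are under control, and such times have positive
    frequency along typical orbits; the losses accumulate to e^(-cn)
    (good_frequency, decay_by_slots, exponential_decay).

    The control along typical orbits rests on the Gibbs measure. It forces the
    fibers to use finitely many letters (letters_bounded), it makes log lambda
    integrable, so that p is a real number (pressure_real), and it shows that
    the transfer operator respects null sets (image_null). The frequencies come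
    from the upper half of the ergodic theorem, through Garsia's argument
    (birkhoff_upper).

    For (i), a function v of norm at most 1 in the space H is dominated almost
    everywhere by a vector u of the unit ball of l2(G), so the estimate bounds
    the operator norms of L^n. For (ii), suppose that G is not amenable and take
    for u the indicator of the identity: L^n u (x, id) bounds the partition
    function of closed words with trivial group value, so the pressure of the
    extension is at most p - c/2. *)

Set Implicit Arguments.
Unset Strict Implicit.
Unset Printing Implicit Defensive.

Import Order.TTheory GRing.Theory Num.Theory.
Import numFieldNormedType.Exports.

Local Open Scope classical_set_scope.
Local Open Scope ring_scope.

Local Notation shift := Defs.shift.
Local Notation skew := Defs.skew.
Local Notation X := seq_space.

(** * Square-summable functions *)

Section l2.
Context {R : realType} {T : choiceType}.
Implicit Types (u v : T -> R) (s c : R).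

(** Extended real values give every family a square norm; [norm2] extracts a
    real number and is meaningful under [l2]. *)
Definition normsq u : \bar R := \esum_(g in [set: T]) ((u g) ^+ 2)%:E.
Definition l2 u : Prop := (normsq u < +oo)%E.
Definition norm2 u : R := Num.sqrt (fine (normsq u)).

Lemma normsq_ge0 u : (0 <= normsq u)%E.
Proof. by apply: esum_ge0 => g _; rewrite lee_fin sqr_ge0. Qed.

Lemma l2_fin u : l2 u -> normsq u \is a fin_num.
Proof. by move=> hu; rewrite ge0_fin_numE ?normsq_ge0. Qed.

Lemma norm2_ge0 u : 0 <= norm2 u.
Proof. exact: sqrtr_ge0. Qed.

Lemma norm2_sqr u : l2 u -> normsq u = (norm2 u ^+ 2)%:E.
Proof.
move=> hu; rewrite /norm2 sqr_sqrtr ?fine_ge0 ?normsq_ge0//.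
by rewrite fineK ?l2_fin.
Qed.

Lemma normsq_le u s : 0 <= s -> (normsq u <= (s ^+ 2)%:E)%E ->
  l2 u /\ norm2 u <= s.
Proof.
move=> s0 h; have hu : l2 u by apply: le_lt_trans h _; rewrite ltry.
split=> //; move: h; rewrite norm2_sqr // lee_fin.
by rewrite ler_sqr ?nnegrE ?norm2_ge0.
Qed.

Lemma le_normsq u v : (forall g, `|u g| <= v g) -> (normsq u <= normsq v)%E.
Proof.
move=> h; apply: le_esum => g _; rewrite lee_fin -[u g ^+ 2]real_normK ?num_real//.
by rewrite ler_sqr ?nnegrE // (le_trans _ (h g)).
Qed.

Lemma le_norm2 u v : (forall g, `|u g| <= v g) -> l2 v ->
  l2 u /\ norm2 u <= norm2 v.
Proof.
move=> h hv; apply: normsq_le (norm2_ge0 _) _.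
by rewrite -norm2_sqr //; exact: le_normsq.
Qed.

Lemma esumZl (A : set T) (f : T -> \bar R) c : 0 <= c ->
  (forall t, (0 <= f t)%E) ->
  (\esum_(t in A) (c%:E * f t) = c%:E * \esum_(t in A) f t)%E.
Proof.
have le c' (f' : T -> \bar R) : 0 <= c' -> (forall t, (0 <= f' t)%E) ->
    (\esum_(t in A) (c'%:E * f' t) <= c'%:E * \esum_(t in A) f' t)%E.
  move=> c0 f0; apply: ge_ereal_sup => _ [X [finX XA]] <-.
  rewrite -ge0_mule_fsumr // lee_wpmul2l ?lee_fin//.
  by apply: ereal_sup_ubound; exists X.
rewrite le_eqVlt => /predU1P[<-|c0] f0.
  by rewrite mul0e; apply: esum1 => t _; rewrite mul0e.
apply/eqP; rewrite eq_le le ?(ltW c0)//=.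
rewrite -lee_pdivlMl// -[leLHS](@eq_esum _ _ _ (fun t => c^-1%:E * (c%:E * f t))%E).
  apply: le; first by rewrite invr_ge0 ltW.
  by move=> t; rewrite mule_ge0// lee_fin ltW.
by move=> t _; rewrite muleA -EFinM mulVf ?mul1e// gt_eqF.
Qed.

Lemma normsqZ c u : normsq (fun g => c * u g) = ((c ^+ 2)%:E * normsq u)%E.
Proof.
rewrite /normsq -esumZl ?sqr_ge0//; last by move=> t; rewrite lee_fin sqr_ge0.
by apply: eq_esum => g _; rewrite exprMn EFinM.
Qed.

Lemma l2Z c u : l2 u -> l2 (fun g => c * u g).
Proof.
move=> hu; rewrite /l2 normsqZ norm2_sqr //; exact: ltry.
Qed.

Lemma norm2Z c u : 0 <= c -> l2 u -> norm2 (fun g => c * u g) = c * norm2 u.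
Proof.
move=> c0 hu; rewrite {1}/norm2 normsqZ norm2_sqr // -EFinM /= -exprMn.
by rewrite sqrtr_sqr ger0_norm // mulr_ge0 ?norm2_ge0.
Qed.

Lemma normsq_lin (a b : R) u v : 0 <= a -> 0 <= b ->
  (\esum_(g in [set: T]) (a * u g ^+ 2 + b * v g ^+ 2)%:E
   = a%:E * normsq u + b%:E * normsq v)%E.
Proof.
move=> a0 b0; rewrite /normsq -!esumZl//; try by move=> t; rewrite lee_fin sqr_ge0.
rewrite -esumD; first by apply: eq_esum => g _; rewrite EFinD !EFinM.
- by move=> g _; rewrite -EFinM lee_fin mulr_ge0// sqr_ge0.
- by move=> g _; rewrite -EFinM lee_fin mulr_ge0// sqr_ge0.
Qed.

(** Minkowski's inequality without a scalar product: with s = |u| + e and r =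
    |v| + e, the pointwise bound (u + v)^2 <= (1 + r/s) u^2 + (1 + s/r) v^2
    sums to at most (s + r)^2, and e tends to 0. The shift by e avoids a
    division by a vanishing norm. *)
Lemma norm2D u v : l2 u -> l2 v ->
  l2 (fun g => u g + v g) /\ norm2 (fun g => u g + v g) <= norm2 u + norm2 v.
Proof.
move=> hu hv.
have key e : 0 < e -> l2 (fun g => u g + v g) /\
    norm2 (fun g => u g + v g) <= (norm2 u + e) + (norm2 v + e).
  move=> e0; set s := norm2 u + e; set r := norm2 v + e.
  have s0 : 0 < s by rewrite ltr_wpDl ?norm2_ge0.
  have r0 : 0 < r by rewrite ltr_wpDl ?norm2_ge0.
  apply: normsq_le; first by rewrite addr_ge0 ?ltW.
  apply: (@le_trans _ _ ((1 + r / s)%:E * normsq u + (1 + s / r)%:E * normsq v)%E).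
    rewrite -normsq_lin ?addr_ge0 ?divr_ge0 ?(ltW s0) ?(ltW r0)//.
    apply: le_esum => g _; rewrite lee_fin -subr_ge0.
    rewrite [leRHS](_ : _ = (r * u g - s * v g) ^+ 2 / (s * r)).
      by rewrite divr_ge0 ?sqr_ge0 // mulr_ge0 ?ltW.
    by field; rewrite !gt_eqF.
  rewrite !norm2_sqr// -!EFinM -EFinD lee_fin.
  apply: (@le_trans _ _ ((1 + r / s) * s ^+ 2 + (1 + s / r) * r ^+ 2)).
    apply: lerD; apply: ler_wpM2l; rewrite ?addr_ge0 ?divr_ge0 ?(ltW s0) ?(ltW r0)//.
    - by rewrite ler_sqr ?nnegrE ?norm2_ge0 ?(ltW s0)// lerDl ltW.
    - by rewrite ler_sqr ?nnegrE ?norm2_ge0 ?(ltW r0)// lerDl ltW.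
  by rewrite le_eqVlt; apply/orP; left; apply/eqP; field; rewrite !gt_eqF.
split; first by case: (key 1).
apply/ler_addgt0Pr => e e0; have [|_ h] := key (e / 2); first by rewrite divr_gt0.
by apply: le_trans h _; lra.
Qed.

Lemma l2_0 : l2 (fun=> 0 : R) /\ norm2 (fun=> 0 : R) <= 0.
Proof.
apply: normsq_le => //; rewrite expr2 mulr0 /normsq esum1//.
by move=> g _; rewrite expr2 mulr0.
Qed.

Lemma norm2_sum (I : Type) (r : seq I) (F : I -> T -> R) (s : I -> R) :
  (forall i, l2 (F i) /\ norm2 (F i) <= s i) ->
  l2 (fun g => \sum_(i <- r) F i g) /\
  norm2 (fun g => \sum_(i <- r) F i g) <= \sum_(i <- r) s i.
Proof.
move=> h; elim: r => [|i r [IH1 IH2]].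
  rewrite big_nil (_ : (fun g => _) = fun=> 0); first exact: l2_0.
  by apply/funext => g; rewrite big_nil.
rewrite big_cons (_ : (fun g => _) = fun g => F i g + \sum_(j <- r) F j g); last first.
  by apply/funext => g; rewrite big_cons.
have [h1 h2] := h i; have [h3 h4] := norm2D h1 IH1; split=> //.
by apply: le_trans h4 _; exact: lerD.
Qed.

Lemma norm2_ge_pt u g : l2 u -> `|u g| <= norm2 u.
Proof.
move=> hu; rewrite -ler_sqr ?nnegrE ?norm2_ge0// real_normK ?num_real//.
rewrite -lee_fin -norm2_sqr//; apply: esum_ge; exists [set g].
  by split=> //; exact: finite_set1.
by rewrite fsbig_set1.
Qed.

Lemma norm2_sqrt_esum u : l2 u ->
  (sqrte (\esum_(g in [set: T]) ((u g) ^+ 2)%:E) = (norm2 u)%:E)%E.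
Proof. by move=> hu; rewrite -/(normsq u) -(fineK (l2_fin hu)). Qed.

Lemma norm2_delta (t : T) :
  l2 (fun g => (g == t)%:R : R) /\ norm2 (fun g => (g == t)%:R : R) <= 1.
Proof.
apply: normsq_le => //; rewrite expr1n /normsq (esumID [set t]); last first.
  by move=> g _; rewrite lee_fin sqr_ge0.
rewrite setTI [X in (_ + X)%E]esum1 ?adde0; last first.
  by move=> g [_ /= /eqP /negbTE ->]; rewrite expr2 mulr0.
by rewrite esum_set1 ?lee_fin ?sqr_ge0// eqxx expr1n.
Qed.

(** Turns almost equality in the triangle inequality into closeness of the two
    vectors. *)
Lemma parallelogram u v : l2 u -> l2 v ->
  normsq (fun g => u g - v g) =
  (2 * (norm2 u ^+ 2 + norm2 v ^+ 2) - norm2 (fun g => u g + v g) ^+ 2)%:E.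
Proof.
move=> hu hv; have [huv _] := norm2D hu hv.
have h : (normsq (fun g => (u g - v g)%R) + normsq (fun g => (u g + v g)%R) =
        2%:E * normsq u + 2%:E * normsq v)%E.
  rewrite -normsq_lin ?ler0n // /normsq -esumD; last 2 first.
  - by move=> g _; rewrite lee_fin sqr_ge0.
  - by move=> g _; rewrite lee_fin sqr_ge0.
  by apply: eq_esum => g _; rewrite -EFinD; congr EFin; ring.
move: h; rewrite (norm2_sqr huv) (norm2_sqr hu) (norm2_sqr hv) -!EFinM -EFinD => h.
have -> : normsq (fun g => u g - v g) = ((2 * norm2 u ^+ 2 + 2 * norm2 v ^+ 2)%:E -
    (norm2 (fun g => u g + v g) ^+ 2)%:E)%E by rewrite -h addeK.
by rewrite -EFinB mulrDr.
Qed.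

End l2.

(** * Non-amenability and right translations *)

Section translation.
Context {R : realType} {G : groupType}.
Implicit Types (u v : G -> R) (h : G).

Definition rtrans h u : G -> R := fun g => u (g * h)%g.

Lemma normsq_rtrans h u : normsq (rtrans h u) = normsq u.
Proof.
rewrite /normsq [RHS](@reindex_esum _ _ _ [set: G] [set: G] (fun g => (g * h)%g))//.
split=> //; first by move=> x y _ _; exact: mulIg.
by move=> x _; exists (x * h^-1)%g => //; rewrite mulgVK.
Qed.

Lemma norm2_rtrans h u : norm2 (rtrans h u) = norm2 u.
Proof. by rewrite /norm2 normsq_rtrans. Qed.

Lemma l2_rtrans h u : l2 u -> l2 (rtrans h u).
Proof. by rewrite /l2 normsq_rtrans. Qed.

End translation.

Section spectral_gap.
Context {R : realType} {G : groupType}.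

(** Right translations have no almost invariant nonnegative vectors, in the
    form in which this enters a triangle inequality: two equal terms, one of
    them translated, lose a fixed proportion. The translation that loses
    depends on the vector. *)
Definition has_gap := exists (K : seq G) (eta : R), 0 < eta /\
  forall u : G -> R, l2 u -> (forall g, 0 <= u g) ->
  exists2 k, k \in K &
    norm2 (fun g => u g + rtrans k u g) <= (2 - eta) * norm2 u.

Lemma ultralimit_exists (U : set_system nat) (x : nat -> R) : UltraFilter U ->
  (forall n, 0 <= x n <= 1) -> exists l : R, x @ U --> l.
Proof.
move=> UU x01.
have cU : (x @ U) `[0, 1]%classic.
  apply: (filterE (F := U)) => n /=.
  by rewrite in_itv /=; exact: x01.
have [l [_ cl]] := @segment_compact R 0 1 (x @ U) _ cU.
exists l => B Bl.
have [//|hc] := in_ultra_setVsetC (x @^-1` B) UU.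
have : (~` B `&` B) !=set0 by apply: cl.
by case=> y [].
Qed.

(** Without a gap there are nonnegative vectors [u n] such that each of the
    first [n] translates nearly realises equality in the triangle inequality
    with [u n], hence nearly coincides with it by the parallelogram law. Then
    A |-> sum of (u n g^-1)^2 over g in A, divided by |u n|^2, are finitely
    additive probabilities that are nearly invariant, and their limit along a
    free ultrafilter is an invariant mean. The inversion of g turns right
    translations into left ones. *)
Lemma nonamenable_gap : countable [set: G] -> ~ amenable R G -> has_gap.
Proof.
move=> /countable_injP[code code_inj] namen; apply: contrapT => nogap; apply: namen.
pose e n : G := xget 1%g [set g | code g = n].
have eP g : e (code g) = g.
  rewrite /e; case: xgetP => [h _ /= hh|/(_ g)/(_ erefl)//].
  by apply: code_inj => //; rewrite inE.
pose K n := [seq e i | i <- iota 0 n].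
have KP g n : (code g < n)%N -> g \in K n.
  by move=> gn; apply/mapP; exists (code g); rewrite ?mem_iota ?eP.
have /choice[u hu] n : exists u : G -> R, [/\ l2 u, forall g, 0 <= u g &
    forall k, k \in K n -> (2 - n.+1%:R^-1) * norm2 u <
      norm2 (fun g => u g + rtrans k u g)].
  apply: contrapT => hn; apply: nogap; exists (K n), n.+1%:R^-1; split=> // u hu u0.
  apply: contrapT => hk; apply: hn; exists u; split=> // k kK.
  by rewrite ltNge; apply/negP => h; apply: hk; exists k.
have u2 n : l2 (u n) by case: (hu n).
have u0 n g : 0 <= u n g by case: (hu n) => _ ->.
(* The translation by 1 makes the strict inequality fail at 0, so [u n] is
   nonzero once 1 belongs to [K n]. *)
have posn n : (code 1%g < n)%N -> 0 < norm2 (u n).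
  move=> n0; have [_ _ /(_ 1%g)] := hu n; rewrite KP// => /(_ isT) h.
  rewrite lt_neqAle norm2_ge0 andbT; apply/negP => /eqP h0.
  have : norm2 (fun g => u n g + rtrans 1%g (u n) g) <= norm2 (u n) + norm2 (u n).
    rewrite -[X in _ <= _ + X](norm2_rtrans 1%g).
    by have [] := norm2D (u2 n) (l2_rtrans 1%g (u2 n)).
  by move: h; rewrite -h0 mulr0 addr0 => /lt_le_trans/[apply]; rewrite ltxx.
pose S n (A : set G) := (\esum_(g in A) ((u n g^-1%g) ^+ 2)%:E)%E.
have S0 n A : (0 <= S n A)%E by apply: esum_ge0 => g _; rewrite lee_fin sqr_ge0.
have ST n : S n setT = (norm2 (u n) ^+ 2)%:E.
  rewrite -norm2_sqr// /normsq.
  rewrite [RHS](@reindex_esum _ _ _ [set: G] [set: G] (fun g => (g^-1)%g))//.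
  split=> //; first by move=> x y _ _; exact: invg_inj.
  by move=> x _; exists (x^-1)%g => //; rewrite invgK.
have SU n A B : A `&` B = set0 -> S n (A `|` B) = (S n A + S n B)%E.
  move=> AB; rewrite /S (esumID A); last by move=> g _; rewrite lee_fin sqr_ge0.
  congr (_ + _)%E; first by rewrite setUK.
  congr (\esum_(g in _) _)%E; rewrite setIUl setICr set0U; apply/seteqP; split.
    by move=> g [].
  move=> g Bg; split=> // Ag; have : (A `&` B) g by [].
  by rewrite AB.
have Sle n A : (S n A <= S n setT)%E.
  rewrite -(setUv A) SU ?setICr// leeDl//.
have Sfin n A : S n A \is a fin_num.
  by rewrite ge0_fin_numE//; apply: le_lt_trans (Sle n A) _; rewrite ST ltry.
pose m n A : R := fine (S n A) / norm2 (u n) ^+ 2.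
have m01 A n : 0 <= m n A <= 1.
  rewrite /m divr_ge0 ?fine_ge0 ?sqr_ge0//=.
  have [->|nz] := eqVneq (norm2 (u n)) 0; first by rewrite expr2 !mulr0 invr0 mulr0.
  rewrite ler_pdivrMr ?exprn_gt0 ?lt_neqAle 1?eq_sym ?nz ?norm2_ge0//.
  by rewrite mul1r -lee_fin fineK// -ST.
have [U [UU Unat]] := @ultraFilterLemma nat \oo _.
have UF : ProperFilter U by case: UU.
have /choice[mean hmean] A := @ultralimit_exists U (m^~ A) UU (m01 A).
have large n0 : U [set n | (n0 <= n)%N] by apply: Unat; exists n0.
have lecvg (x y : nat -> R) l l' : x @ U --> l -> y @ U --> l' ->
    U [set n | x n <= y n] -> l <= l'.
  move=> hx hy hxy; rewrite -subr_ge0.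
  apply: (@closed_cvg _ _ U _ (fun n => y n - x n) [set r | 0 <= r]).
  - exact: closed_ge.
  - by apply: filterS hxy => n /= h; rewrite subr_ge0.
  - exact: cvgB.
have minv h A : mean [set (h * g)%g | g in A] <= mean A.
  apply/ler_addgt0Pr => eps eps0; pose de := eps / 2.
  have de0 : 0 < de by rewrite divr_gt0.
  apply: (@le_trans _ _ ((1 + de) * mean A + de)); last first.
    have : mean A <= 1.
      by apply: (lecvg (m^~ A) (fun=> 1)); [exact: hmean|exact: cvg_cst|
        apply: filterE => n; have /andP[] := m01 A n].
    rewrite /de; nra.
  apply: (lecvg (m^~ [set (h * g)%g | g in A]) (fun n => (1 + de) * m n A + de)).
  - exact: hmean.
  - by apply: cvgD; [apply: cvgMr; exact: hmean|exact: cvg_cst].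
  have [n1 hn1] : exists n1 : nat, (1 + de^-1) * 4 / de <= n1%:R.
    exists (Num.truncn ((1 + de^-1) * 4 / de)).+1; apply/ltW; exact: truncnS_gt.
  apply: filterS (large (maxn n1 (maxn (code 1%g) (code h^-1%g)).+1)) => n /=.
  rewrite !geq_max => /andP[n1n]; rewrite gtn_max => /andP[c1 ch].
  have nu := posn _ c1.
  have [_ _ /(_ _ (KP _ _ ch)) close] := hu n.
  set w := rtrans h^-1%g (u n) in close.
  have w2 : l2 w by exact: l2_rtrans.
  have dist : (normsq (fun g => w g - u n g)%R <=
               (4 / n.+1%:R * norm2 (u n) ^+ 2)%:E)%E.
    have wu : norm2 w = norm2 (u n) by exact: norm2_rtrans.
    rewrite parallelogram// lee_fin wu.
    rewrite (_ : (fun g => w g + u n g) = (fun g => u n g + w g)); last first.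
      by apply/funext => g; rewrite addrC.
    move: close; set X := norm2 (fun g => u n g + w g); set Y := norm2 (u n) => close.
    have i0 : 0 < n.+1%:R^-1 :> R by rewrite invr_gt0.
    have i1 : n.+1%:R^-1 <= 1 :> R by rewrite invf_le1 ?ler1n.
    move: i0 i1 close; set i := n.+1%:R^-1 => i0 i1 close.
    have : ((2 - i) * Y) ^+ 2 <= X ^+ 2.
      have Y2 : 0 <= (2 - i) * Y by apply: mulr_ge0; [lra|exact: norm2_ge0].
      have X0 : 0 <= X := le_trans Y2 (ltW close).
      rewrite -subr_ge0 subr_sqr mulr_ge0//; last exact: addr_ge0.
      by rewrite subr_ge0 ltW.
    nra.
  (* The pointwise bound a^2 <= (1 + de) b^2 + (1 + 1/de) (a - b)^2 compares
     the masses of a set and of its translate. *)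
  have mainE : (S n [set (h * g)%g | g in A] <=
      (1 + de)%:E * S n A + (1 + de^-1)%:E * normsq (fun g => w g - u n g)%R)%E.
    rewrite {1}/S (@reindex_esum _ _ _ A _ (fun g => (h * g)%g)); last first.
      split; [by move=> g Ag; exists g|by move=> x y _ _; exact: mulgI|].
      by move=> x [g Ag <-]; exists g.
    have -> : normsq (fun g => w g - u n g)%R =
        (\esum_(g in [set: G]) ((w g^-1%g - u n g^-1%g) ^+ 2)%:E)%E.
      rewrite /normsq [LHS](@reindex_esum _ _ _ [set: G] [set: G] (fun g => (g^-1)%g))//.
      split=> //; first by move=> x y _ _; exact: invg_inj.
      by move=> x _; exists (x^-1)%g => //; rewrite invgK.
    apply: (@le_trans _ _ ((1 + de)%:E * S n A + (1 + de^-1)%:E *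
        \esum_(g in A) ((w g^-1%g - u n g^-1%g) ^+ 2)%:E)%E); last first.
      rewrite leeD2l// lee_wpmul2l ?lee_fin ?addr_ge0 ?invr_ge0 ?(ltW de0)//.
      rewrite [leLHS]esum_mkcond; apply: le_esum => g _.
      by case: ifPn => // _; rewrite lee_fin sqr_ge0.
    rewrite /S -!esumZl ?addr_ge0 ?invr_ge0 ?(ltW de0)//; last 2 first.
    - by move=> t; rewrite lee_fin sqr_ge0.
    - by move=> t; rewrite lee_fin sqr_ge0.
    rewrite -esumD; last 2 first.
    - by move=> g _; rewrite -EFinM lee_fin mulr_ge0 ?sqr_ge0 ?addr_ge0 ?(ltW de0).
    - by move=> g _; rewrite -EFinM lee_fin mulr_ge0 ?sqr_ge0 ?addr_ge0 ?invr_ge0 ?(ltW de0).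
    apply: le_esum => g _; rewrite -!EFinM -EFinD lee_fin.
    rewrite /w /rtrans invgM; set a := u n _; set b := u n _.
    rewrite -subr_ge0 [leRHS](_ : _ = ((1 + de) * b - a) ^+ 2 / de).
      by rewrite divr_ge0 ?sqr_ge0 ?(ltW de0).
    by field; rewrite gt_eqF.
  have nu2 : 0 < norm2 (u n) ^+ 2 by rewrite exprn_gt0.
  rewrite /m ler_pdivrMr// mulrDl.
  rewrite [X in X + _](_ : _ = (1 + de) * fine (S n A)); last first.
    by rewrite -mulrA divfK// gt_eqF.
  have : (1 + de^-1) * (4 / n.+1%:R) <= de.
    rewrite mulrA ler_pdivrMr ?ltr0n// -ler_pdivrMl// mulrC.
    by apply: le_trans hn1 _; rewrite ler_nat (leq_trans n1n).
  move=> hde; rewrite -lee_fin fineK// (le_trans mainE)// [leRHS]EFinD.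
  rewrite (EFinM (1 + de)) (fineK (Sfin n A)) leeD2l//.
  apply: (@le_trans _ _ ((1 + de^-1)%:E * (4 / n.+1%:R * norm2 (u n) ^+ 2)%:E)%E).
    by rewrite lee_wpmul2l ?lee_fin ?addr_ge0 ?invr_ge0 ?(ltW de0).
  by rewrite -EFinM lee_fin mulrA ler_wpM2r// ltW.
exists mean; split.
- move=> A; apply: (lecvg (fun=> 0) (m^~ A)); [exact: cvg_cst|exact: hmean|].
  by apply: filterE => n; have /andP[] := m01 A n.
- apply/eqP; rewrite eq_le; apply/andP; split.
    apply: (lecvg (m^~ setT) (fun=> 1)); [exact: hmean|exact: cvg_cst|].
    by apply: filterE => n; have /andP[] := m01 setT n.
  apply: (lecvg (fun=> 1) (m^~ setT)); [exact: cvg_cst|exact: hmean|].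
  apply: filterS (large (code 1%g).+1) => n /= hn; rewrite /m ST /= divff//.
  by rewrite gt_eqF// exprn_gt0// posn.
- move=> A B AB.
  have mAB n : m n (A `|` B) = m n A + m n B.
    by rewrite /m SU// fineD// mulrDl.
  have h1 : (fun n => m n (A `|` B)) @ U --> mean (A `|` B) by exact: hmean.
  have h2 : (fun n => m n A + m n B) @ U --> mean A + mean B.
    by apply: cvgD; exact: hmean.
  apply/eqP; rewrite eq_le; apply/andP; split.
    by apply: (lecvg _ _ _ _ h1 h2); apply: filterE => n /=; rewrite mAB.
  by apply: (lecvg _ _ _ _ h2 h1); apply: filterE => n /=; rewrite mAB.
- move=> h A; apply/eqP; rewrite eq_le minv /=.
  have E : [set (h^-1 * g)%g | g in [set (h * g)%g | g in A]] = A.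
    apply/seteqP; split=> [_ [_ [g Ag <-] <-]|x Ax]; first by rewrite mulKg.
    by exists (h * x)%g; [exists x|rewrite mulKg].
  by have := minv h^-1%g [set (h * g)%g | g in A]; rewrite E.
Qed.

End spectral_gap.

(** * Transfer operators along one orbit *)

Definition scons (a : nat) (x : seq_space) : seq_space :=
  fun i => if i is j.+1 then x j else a.

Lemma shift_scons a x : shift (scons a x) = x.
Proof. by apply/funext. Qed.

Lemma scons_shift x : scons (x 0%N) (shift x) = x.
Proof. by apply/funext => -[|i]. Qed.

Lemma iter_shift n (x : seq_space) i : iter n shift x i = x (n + i)%N.
Proof.
elim: n x i => [//|n IH] x i; rewrite iterSr IH addSn -addnS.
by rewrite /shift addnS.
Qed.

Lemma psi_iterD (G : groupType) (psi : seq_space -> G) m n x :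
  psi_iter psi (m + n) x = (psi_iter psi m x * psi_iter psi n (iter m shift x))%g.
Proof.
elim: m x => [|m IH] x; first by rewrite mul1g.
by rewrite addSn /= IH mulgA -iterSr.
Qed.

Lemma psi_iter_eq (G : groupType) (psi : seq_space -> G) n x y :
  depends_on_first_letter psi ->
  (forall i, (i < n)%N -> x i = y i) -> psi_iter psi n x = psi_iter psi n y.
Proof.
move=> hpsi; elim: n x y => [//|n IH] x y xy /=; congr (_ * _)%g.
  by apply: hpsi; exact: xy.
by apply: IH => i ilt; apply: xy.
Qed.

(** The estimates concern a single base point and see only its orbit: at time
    [t], [E t] is the transition rule, [pot t] the potential and [M t] a bound
    for the letters. A finite bound at each time is what the Gibbs property
    provides, and it makes every transfer operator a finite sum. *)
Section orbit.
Context {R : realType} (E : nat -> nat -> nat -> Prop).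
Context (pot : nat -> seq_space -> R) (M : nat -> nat).

Definition fib t : set seq_space :=
  [set x | forall i, E (t + i) (x i) (x i.+1)].

Lemma fib_scons t a x : fib t (scons a x) <-> E t a (x 0%N) /\ fib t.+1 x.
Proof.
split=> [h|[h0 h] [|i]].
- split; first by have := h 0%N; rewrite addn0.
  by move=> i; have := h i.+1; rewrite addnS.
- by rewrite addn0.
- by rewrite addnS; exact: h.
Qed.

Lemma fib_shift t x : fib t x -> fib t.+1 (shift x).
Proof. by rewrite -{1}(scons_shift x) => /fib_scons[]. Qed.

Lemma fib_iter n t x : fib t x -> fib (t + n) (iter n shift x).
Proof.
elim: n => [|n IH] h; first by rewrite addn0.
by rewrite addnS; exact/fib_shift/IH.
Qed.

Definition bsum t n (y : seq_space) : R :=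
  \sum_(i < n) pot (t + i) (iter i shift y).

(** A list, so that sums over histories are finite sums; [mem_branches] says
    which points it contains. *)
Fixpoint branches t n x : seq seq_space :=
  if n is n'.+1 then
    flatten [seq branches t n' (scons a x) |
      a <- iota 0 (M (t + n')) & `[< fib (t + n') (scons a x) >]]
  else [:: x].

(** The [t]-th iterate of the transfer operator of the group extension on the
    function (x, g) |-> u g. For fixed [x] it is a vector of l2 of the group,
    and these vectors are what is estimated below. *)
Fixpoint transfer {G : groupType} (psi : seq_space -> G) (u : G -> R) t x g : R :=
  if t is t'.+1 then
    \sum_(a <- iota 0 (M t') | `[< fib t' (scons a x) >])
      expR (pot t' (scons a x)) *
        transfer psi u t' (scons a x) (g * (psi (scons a x))^-1)%g
  else u g.

(** The [t]-th iterate of the transfer operator of the shift on the constant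
    1. *)
Fixpoint mass t x : R :=
  if t is t'.+1 then
    \sum_(a <- iota 0 (M t') | `[< fib t' (scons a x) >])
      expR (pot t' (scons a x)) * mass t' (scons a x)
  else 1.

Lemma branches_iter t n x y : y \in branches t n x -> iter n shift y = x.
Proof.
elim: n x => [|n IH] x /=; first by rewrite inE => /eqP.
by move=> /flattenP[s /mapP[a _ ->] /IH ->]; rewrite shift_scons.
Qed.

Lemma sum_branchesS t n x (F : seq_space -> R) :
  \sum_(y <- branches t n.+1 x) F y =
  \sum_(a <- iota 0 (M (t + n)) | `[< fib (t + n) (scons a x) >])
    \sum_(y <- branches t n (scons a x)) F y.
Proof. by rewrite /= big_flatten big_map big_filter. Qed.

Lemma bsumS t n y : bsum t n.+1 y = bsum t n y + pot (t + n) (iter n shift y).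
Proof. by rewrite /bsum big_ord_recr. Qed.

Lemma transfer_branches (G : groupType) (psi : seq_space -> G) u t n x g :
  transfer psi u (t + n) x g =
  \sum_(y <- branches t n x)
    expR (bsum t n y) * transfer psi u t y (g * (psi_iter psi n y)^-1)%g.
Proof.
elim: n x g => [|n IH] x g.
  by rewrite addn0 /= big_seq1 /bsum big_ord0 expR0 mul1r invg1 mulg1.
rewrite addnS sum_branchesS /=; apply: eq_bigr => a _.
rewrite IH mulr_sumr; apply: eq_big_seq => y /branches_iter yE.
rewrite mulrA -expRD bsumS addrC yE; congr (_ * transfer psi u t y _).
by rewrite -[(psi y * _)%g]/(psi_iter psi n.+1 y) -addn1 psi_iterD /= yE mulg1 invgM mulgA.
Qed.

Lemma mass_branches t n x :
  mass (t + n) x = \sum_(y <- branches t n x) expR (bsum t n y) * mass t y.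
Proof.
elim: n x => [|n IH] x.
  by rewrite addn0 /= big_seq1 /bsum big_ord0 expR0 mul1r.
rewrite addnS sum_branchesS /=; apply: eq_bigr => a _.
rewrite IH mulr_sumr; apply: eq_big_seq => y /branches_iter yE.
by rewrite mulrA -expRD bsumS addrC yE.
Qed.

Lemma mass_ge0 t x : 0 <= mass t x.
Proof.
elim: t x => [//|t IH] x /=; apply: sumr_ge0 => a _.
by rewrite mulr_ge0 ?expR_ge0.
Qed.

Lemma transfer_ge0 (G : groupType) (psi : seq_space -> G) u t x g :
  (forall g, 0 <= u g) -> 0 <= transfer psi u t x g.
Proof.
move=> u0; elim: t x g => [//|t IH] x g /=; apply: sumr_ge0 => a _.
by rewrite mulr_ge0 ?expR_ge0.
Qed.

Section finite_alphabet.
Context (letter_lt : forall t y, fib t y -> (y 0%N < M t)%N).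

Lemma mem_branches t n x y : fib (t + n) x ->
  (y \in branches t n x) <-> (fib t y /\ iter n shift y = x).
Proof.
elim: n x => [|n IH] x hx; rewrite /=.
  rewrite addn0 in hx; rewrite inE.
  by split=> [/eqP ->|[_ ->]//]; split.
split.
  move=> /flattenP[s /mapP[a]]; rewrite mem_filter => /andP[/asboolP ha _] -> hy.
  have [fy yE] := (IH _ ha).1 hy; split=> //.
  by rewrite yE shift_scons.
move=> [fy yE]; apply/flattenP; have fz := fib_iter n fy.
set z := iter n shift y in fz yE.
have zE : scons (z 0%N) x = z by rewrite -yE scons_shift.
exists (branches t n z); last by apply/(IH _ fz).
apply/mapP; exists (z 0%N); last by rewrite zE.
by rewrite mem_filter mem_iota /= add0n letter_lt// andbT zE; apply/asboolP.
Qed.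

Lemma sum_by_first_letter t n x (F : seq_space -> R) : fib (t + n) x ->
  \sum_(y <- branches t n x) F y =
  \sum_(a <- iota 0 (M t)) \sum_(y <- branches t n x | y 0%N == a) F y.
Proof.
move=> hx; under [RHS]eq_bigr do rewrite big_mkcond.
rewrite exchange_big /=; apply: eq_big_seq => y /(mem_branches _ hx)[fy _].
rewrite -big_mkcond /= (big_rem (y 0%N)) /=; last by rewrite mem_iota /= letter_lt.
rewrite eqxx big1_seq ?addr0// => a /andP[/eqP <-].
by rewrite mem_rem_uniq ?iota_uniq// inE eqxx.
Qed.

End finite_alphabet.

Section distortion.
Context (kap : nat -> R) (kap_ge0 : forall t, 0 <= kap t).
Context (pot_holder : forall t n x y, (0 < n)%N -> fib t x -> fib t y ->
  (forall i, (i < n)%N -> x i = y i) -> pot t x - pot t y <= kap t * 2^-1 ^+ n).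

(** In closed form, this is the sum of [kap (t + i) / 2 ^+ (m - i)] over i <
    m. It is the distortion of Birkhoff sums of length [m] from time [t] on,
    between points with the same first [m] letters. *)
Fixpoint drift t m : R :=
  if m is m'.+1 then (drift t m' + kap (t + m')) / 2 else 0.

Lemma drift_ge0 t m : 0 <= drift t m.
Proof.
by elim: m => [//|m IH] /=; rewrite divr_ge0 ?addr_ge0.
Qed.

(** Each [kap j] is counted with some of the weights 1/2, 1/4, ..., whose sum
    is at most 1. *)
Lemma sum_drift_slot n m : \sum_(t < n) drift t m <= \sum_(j < n + m) kap j.
Proof.
have mono k l : (k <= l)%N -> \sum_(j < k) kap j <= \sum_(j < l) kap j.
  move=> /subnKC <-; rewrite big_split_ord /= lerDl.
  by apply: sumr_ge0 => i _.
elim: m => [|m IH] /=; first by rewrite big1 // sumr_ge0.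
rewrite -mulr_suml big_split /=.
have h1 : \sum_(t < n) kap (t + m) <= \sum_(j < n + m.+1) kap j.
  apply: (@le_trans _ _ (\sum_(j < m + n) kap j)); last by apply: mono; rewrite addnS addnC.
  rewrite big_split_ord /= ler_wpDl ?sumr_ge0//.
  by apply: ler_sum => i _; rewrite addnC.
have h2 : \sum_(j < n + m) kap j <= \sum_(j < n + m.+1) kap j by apply: mono; rewrite addnS.
by rewrite ler_pdivrMr// mulr_natr mulr2n lerD// (le_trans IH).
Qed.

Lemma sum_drift n : \sum_(t < n) drift 0 t <= \sum_(j < n) kap j.
Proof.
elim: n => [|n IH]; first by rewrite !big_ord0.
have hS : \sum_(t < n.+1) drift 0 t = (\sum_(t < n) drift 0 t + \sum_(t < n) kap t) / 2.
  by rewrite big_ord_recl /= add0r -big_split /= mulr_suml; apply: eq_bigr.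
rewrite hS [leRHS]big_ord_recr /= ler_wpDr ?kap_ge0// ler_pdivrMr// mulr_natr mulr2n.
by rewrite lerD.
Qed.

Lemma bsum_distortion t m j x y : (0 < j)%N -> fib t x -> fib t y ->
  (forall i, (i < m + j)%N -> x i = y i) ->
  bsum t m x - bsum t m y <= drift t m * 2^-1 ^+ j.
Proof.
elim: m j => [|m IH] j j0 fx fy xy; first by rewrite /bsum !big_ord0 subrr mul0r.
rewrite !bsumS opprD addrACA /=.
apply: (@le_trans _ _ (drift t m * 2^-1 ^+ j.+1 + kap (t + m) * 2^-1 ^+ j.+1)).
  apply: lerD.
    by apply: IH => // i ilt; apply: xy; rewrite addSn -addnS.
  apply: pot_holder => //; try exact: fib_iter.
  by move=> i ilt; rewrite !iter_shift; apply: xy; rewrite addSnnS ltn_add2l.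
by rewrite exprS le_eqVlt; apply/orP; left; apply/eqP; field.
Qed.

Lemma bsum_distortion0 t m x y : fib t x -> fib t y ->
  (forall i, (i < m)%N -> x i = y i) ->
  bsum t m x - bsum t m y <= drift t m.
Proof.
case: m => [|m] fx fy xy; first by rewrite /bsum !big_ord0 subrr.
rewrite !bsumS opprD addrACA /=.
apply: (@le_trans _ _ (drift t m * 2^-1 ^+ 1 + kap (t + m) * 2^-1 ^+ 1)).
  apply: lerD.
    by apply: bsum_distortion => // i; rewrite addn1; exact: xy.
  apply: pot_holder => //; try exact: fib_iter.
  by move=> [|i] // _; rewrite !iter_shift addn0; exact: xy.
by rewrite expr1 -mulrDl.
Qed.

(** Prepending the same history to [x] and [y] gives pairs which agree on m +
    1, ..., m + t letters; this leaves a factor 2^-m in front of the drift. *)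
Lemma transfer_distortion (G : groupType) (psi : seq_space -> G) u t m x y g :
  depends_on_first_letter psi -> (forall g, 0 <= u g) ->
  (0 < m)%N -> fib t x -> fib t y -> (forall i, (i < m)%N -> x i = y i) ->
  transfer psi u t x g <= expR (drift 0 t * 2^-1 ^+ m) * transfer psi u t y g.
Proof.
move=> hpsi u0; elim: t m x y g => [|t IH] m x y g m0 fx fy xy /=.
  by rewrite mul0r expR0 mul1r.
rewrite mulr_sumr.
have fE a : `[< fib t (scons a x) >] = `[< fib t (scons a y) >].
  apply/asbool_equiv_eq; rewrite !fib_scons (xy 0%N)//.
  by split=> -[].
rewrite (eq_bigl _ _ fE); apply: ler_sum => a; rewrite -fE => /asboolP fax.
have /asboolP fay : `[< fib t (scons a y) >] by rewrite -fE; apply/asboolP.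
have axy i : (i < m.+1)%N -> scons a x i = scons a y i.
  by case: i => // i ilt; exact: xy.
rewrite (hpsi (scons a x) (scons a y))//.
apply: (@le_trans _ _ (expR (pot t (scons a x)) *
    (expR (drift 0 t * 2^-1 ^+ m.+1) *
     transfer psi u t (scons a y) (g * (psi (scons a y))^-1)%g))).
  by rewrite ler_wpM2l ?expR_ge0// IH.
rewrite !mulrA ler_wpM2r ?transfer_ge0// -!expRD ler_expR.
have := pot_holder (ltn0Sn m) fax fay axy.
rewrite exprS; set p := 2^-1 ^+ m; lra.
Qed.

End distortion.
End orbit.

(** * Strict loss in the triangle inequality *)

Section pair.
Context {R : realType} {G : groupType}.

(** The gap of [u] under the translation by [k] is transported to a vector [w]
    that is comparable with the translate up to the factor [expR tau]. The
    common part [e] of the two weights is paired and loses [eta]; as [tau] is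
    small against [eta], half of the loss survives. *)
Lemma norm2_pair (eta tau e e1 e2 beta : R) (k : G) (u w : G -> R) :
  l2 u -> (forall g, 0 <= u g) -> (forall g, 0 <= w g) ->
  (forall g, w g <= expR tau * rtrans k u g) ->
  norm2 u <= expR tau * norm2 w ->
  norm2 (fun g => u g + rtrans k u g) <= (2 - eta) * norm2 u ->
  0 <= e -> e <= e1 -> e <= e2 -> e2 <= beta * e -> 0 <= tau ->
  beta * (expR tau - expR (- tau)) <= eta / 2 ->
  l2 w /\ norm2 (fun g => e1 * u g + e2 * w g) <=
    e1 * norm2 u + e2 * norm2 w - eta / 2 * e * norm2 u.
Proof.
move=> u2 u0 w0 wu nuw gap e0 ee1 ee2 e2b tau0 hbeta.
have ru0 g : 0 <= rtrans k u g by exact: u0.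
have ru2 : l2 (rtrans k u) by exact: l2_rtrans.
have eru2 := l2Z (expR tau) ru2.
have [w2 _] : l2 w /\ norm2 w <= norm2 (fun g => expR tau * rtrans k u g).
  by apply: le_norm2 => // g; rewrite ger0_norm.
split=> //.
have T1 : 1 <= expR tau by rewrite -expR0 ler_expR.
have S2 : l2 (fun g => u g + rtrans k u g) by have [] := norm2D u2 ru2.
pose p1 g := e * (u g + rtrans k u g).
pose p2 g := (e1 - e) * u g.
pose p3 g := (e2 * expR tau - e) * rtrans k u g.
have c1 : 0 <= e1 - e by rewrite subr_ge0.
have c2 : 0 <= e2 * expR tau - e.
  rewrite subr_ge0 (le_trans ee2)// ler_peMr// (le_trans e0)//.
have p12 : l2 p1 by exact: l2Z.
have p22 : l2 p2 by exact: l2Z.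
have p32 : l2 p3 by exact: l2Z.
have [q1 q2] := norm2D p12 p22; have [q3 q4] := norm2D q1 p32.
have bound : norm2 (fun g => e1 * u g + e2 * w g) <=
    (e1 + e2 * expR tau - eta * e) * norm2 u.
  apply: (@le_trans _ _ (norm2 (fun g => p1 g + p2 g + p3 g))).
    have [|//] := @le_norm2 _ _ (fun g => e1 * u g + e2 * w g) _ _ q3 => g.
    have e20 : 0 <= e2 := le_trans e0 ee2.
    rewrite ger0_norm; last by rewrite addr_ge0 ?mulr_ge0// (le_trans e0).
    have := ler_wpM2l e20 (wu g); rewrite /p1 /p2 /p3; lra.
  apply: (le_trans q4); apply: (le_trans (lerD q2 (lexx _))).
  rewrite /p1 /p2 /p3 !norm2Z// norm2_rtrans.
  have := ler_wpM2l e0 gap; lra.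
apply: (le_trans bound).
have nu0 := norm2_ge0 u.
have nw : expR (- tau) * norm2 u <= norm2 w.
  by rewrite expRN mulrC ler_pdivrMr ?expR_gt0// mulrC.
have e20 : 0 <= e2 := le_trans e0 ee2.
have h1 := ler_wpM2l e20 nw.
have T2 : expR (- tau) <= expR tau by rewrite ler_expR; lra.
have h2 : e2 * (expR tau - expR (- tau)) <= eta / 2 * e.
  apply: (@le_trans _ _ (beta * e * (expR tau - expR (- tau)))).
    by rewrite ler_wpM2r// subr_ge0.
  by rewrite mulrAC ler_wpM2r.
have := ler_wpM2r nu0 h2; lra.
Qed.

End pair.

Section contraction.
Context {R : realType} {G : groupType} (psi : seq_space -> G).
Context (hpsi : depends_on_first_letter psi).
Context (E : nat -> nat -> nat -> Prop) (pot : nat -> seq_space -> R).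
Context (M : nat -> nat).
Context (letter_lt : forall t y, fib E t y -> (y 0%N < M t)%N).
Context (kap : nat -> R) (kap_ge0 : forall t, 0 <= kap t).
Context (pot_holder : forall t n x y, (0 < n)%N -> fib E t x -> fib E t y ->
  (forall i, (i < n)%N -> x i = y i) -> pot t x - pot t y <= kap t * 2^-1 ^+ n).
Context (u : G -> R) (u2 : l2 u) (u0 : forall g, 0 <= u g).

Local Notation fib := (fib E).
Local Notation branches := (branches E M).
Local Notation bsum := (bsum pot).
Local Notation mass := (mass E pot M).
Local Notation V := (transfer E pot M psi u).
Local Notation drift := (drift kap).

(** The term of the history [y] in the value of the transfer operator at [iter
    n shift y], without its weight. *)
Definition pushed t n y : G -> R := rtrans (psi_iter psi n y)^-1%g (V t y).

Lemma transfer_l2 t x : l2 (V t x) /\ norm2 (V t x) <= mass t x * norm2 u.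
Proof.
elim: t x => [|t IH] x; first by rewrite /= mul1r.
pose r := [seq a <- iota 0 (M t) | `[< fib t (scons a x) >]].
have VE : V t.+1 x = fun g => \sum_(a <- r)
    expR (pot t (scons a x)) * rtrans (psi (scons a x))^-1%g (V t (scons a x)) g.
  by apply/funext => g; rewrite big_filter.
have mE : mass t.+1 x * norm2 u =
    \sum_(a <- r) expR (pot t (scons a x)) * mass t (scons a x) * norm2 u.
  by rewrite big_filter -mulr_suml.
rewrite VE mE.
apply: norm2_sum => a; have [h1 h2] := IH (scons a x).
have h3 := l2_rtrans (psi (scons a x))^-1%g h1.
split; first exact: l2Z.
by rewrite norm2Z ?expR_ge0// norm2_rtrans -mulrA ler_wpM2l ?expR_ge0.
Qed.

Lemma pushed_l2 t n y : l2 (pushed t n y).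
Proof. by apply: l2_rtrans; have [] := transfer_l2 t y. Qed.

Lemma norm2_pushed t n y : norm2 (pushed t n y) = norm2 (V t y).
Proof. exact: norm2_rtrans. Qed.

Lemma pushed_ge0 t n y g : 0 <= pushed t n y g.
Proof. by rewrite /pushed /rtrans transfer_ge0. Qed.

Lemma norm2_pushed_sum t n (s : seq seq_space) (P : pred seq_space) :
  l2 (fun g => \sum_(y <- s | P y) expR (bsum t n y) * pushed t n y g) /\
  norm2 (fun g => \sum_(y <- s | P y) expR (bsum t n y) * pushed t n y g) <=
  \sum_(y <- s | P y) expR (bsum t n y) * norm2 (V t y).
Proof.
rewrite -[leRHS]big_filter (_ : (fun g => _) = fun g =>
  \sum_(y <- [seq y <- s | P y]) expR (bsum t n y) * pushed t n y g); last first.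
  by apply/funext => g; rewrite big_filter.
apply: norm2_sum => y; split; first exact: l2Z (pushed_l2 _ _ _).
by rewrite norm2Z ?expR_ge0 ?norm2_pushed//; exact: pushed_l2.
Qed.

Lemma transfer_pushed t n x :
  V (t + n) x = fun g => \sum_(y <- branches t n x) expR (bsum t n y) * pushed t n y g.
Proof. by apply/funext => g; rewrite transfer_branches. Qed.

Lemma norm2_transfer_le t n x :
  norm2 (V (t + n) x) <= \sum_(y <- branches t n x) expR (bsum t n y) * norm2 (V t y).
Proof.
by rewrite transfer_pushed; have [] := norm2_pushed_sum t n (branches t n x) xpredT.
Qed.

Lemma norm2_distortion t m x y : (0 < m)%N -> fib t x -> fib t y ->
  (forall i, (i < m)%N -> x i = y i) ->
  norm2 (V t x) <= expR (drift 0 t * 2^-1 ^+ m) * norm2 (V t y).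
Proof.
move=> m0 fx fy xy; have [vy2 _] := transfer_l2 t y.
rewrite -norm2Z ?expR_ge0//.
have [|//] := @le_norm2 _ _ (V t x) _ _ (l2Z (expR (drift 0 t * 2^-1 ^+ m)) vy2) => g.
by rewrite ger0_norm ?transfer_ge0//; exact: transfer_distortion.
Qed.

(** The histories [y1] and [y2] agree on [m] letters, which makes the vectors
    that they carry nearly equal up to the translation by [k]; so their pair
    loses by [norm2_pair]. All histories with first letter [a] carry vectors
    of comparable norm, hence this loss is a fixed proportion [rho] of the
    whole sum over them. *)
Lemma letter_gain (eta beta e rho tot : R) t n x a m y1 y2 k :
  fib (t + n) x -> y1 \in branches t n x -> y2 \in branches t n x ->
  y1 != y2 -> y1 0%N = a -> y2 0%N = a ->
  (0 < m)%N -> (forall i, (i < m)%N -> y1 i = y2 i) ->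
  psi_iter psi n y2 = (psi_iter psi n y1 * k^-1)%g ->
  norm2 (fun g => pushed t n y1 g + rtrans k (pushed t n y1) g)
    <= (2 - eta) * norm2 (pushed t n y1) ->
  0 <= e -> e <= expR (bsum t n y1) -> e <= expR (bsum t n y2) ->
  expR (bsum t n y2) <= beta * e ->
  beta * (expR (drift 0 t * 2^-1 ^+ m) - expR (- (drift 0 t * 2^-1 ^+ m))) <= eta / 2 ->
  \sum_(y <- branches t n x) expR (bsum t n y) <= tot -> 0 <= rho ->
  rho * tot * expR (drift 0 t) <= eta / 2 * e ->
  norm2 (fun g => \sum_(y <- branches t n x | y 0%N == a) expR (bsum t n y) * pushed t n y g)
  <= (1 - rho) * \sum_(y <- branches t n x | y 0%N == a) expR (bsum t n y) * norm2 (V t y).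
Proof.
move=> fx y1P y2P y12 y1a y2a m0 yy hk gap e0 ee1 ee2 e2b hb htot rho0 hrho.
have [fy1 _] := (mem_branches letter_lt y1 fx).1 y1P.
have [fy2 _] := (mem_branches letter_lt y2 fx).1 y2P.
set tau := drift 0 t * 2^-1 ^+ m in hb.
have tau0 : 0 <= tau by rewrite mulr_ge0 ?drift_ge0// exprn_ge0 ?invr_ge0.
have y2rem : y2 \in rem y1 (branches t n x) by rewrite rem_mem// eq_sym.
pose rest := rem y2 (rem y1 (branches t n x)).
have split (F : seq_space -> R) : \sum_(y <- branches t n x | y 0%N == a) F y =
    (F y1 + F y2) + \sum_(y <- rest | y 0%N == a) F y.
  by rewrite (big_rem y1)//= (big_rem y2 y2rem)/= y1a y2a eqxx addrA.
have [r2 r_le] := norm2_pushed_sum t n rest (fun y => y 0%N == a).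
have w_le g : pushed t n y2 g <= expR tau * rtrans k (pushed t n y1) g.
  rewrite /pushed /rtrans hk invgM invgK mulgA.
  by apply: transfer_distortion => // i ilt; exact/esym/yy.
have w_ge : norm2 (pushed t n y1) <= expR tau * norm2 (pushed t n y2).
  by rewrite !norm2_pushed; exact: norm2_distortion.
have [w2 pair] := norm2_pair (pushed_l2 _ _ _) (@pushed_ge0 _ _ _)
  (@pushed_ge0 _ _ _) w_le w_ge gap e0 ee1 ee2 e2b tau0 hb.
rewrite (_ : (fun g => _) = fun g => (expR (bsum t n y1) * pushed t n y1 g +
    expR (bsum t n y2) * pushed t n y2 g) +
    \sum_(y <- rest | y 0%N == a) expR (bsum t n y) * pushed t n y g); last first.
  by apply/funext => g; rewrite split.
have pp2 : l2 (fun g => expR (bsum t n y1) * pushed t n y1 g +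
    expR (bsum t n y2) * pushed t n y2 g).
  by have [] := norm2D (l2Z (expR (bsum t n y1)) (pushed_l2 t n y1)) (l2Z (expR (bsum t n y2)) w2).
have [_ h] := norm2D pp2 r2; apply: (le_trans h).
have tot_le : \sum_(y <- branches t n x | y 0%N == a) expR (bsum t n y) * norm2 (V t y) <=
    tot * (expR (drift 0 t) * norm2 (V t y1)).
  apply: (@le_trans _ _ (\sum_(y <- branches t n x | y 0%N == a)
      expR (bsum t n y) * (expR (drift 0 t) * norm2 (V t y1)))).
    rewrite big_seq_cond [leRHS]big_seq_cond.
    apply: ler_sum => y /andP[/(mem_branches letter_lt _ fx)[fy _] /eqP ya].
    rewrite ler_wpM2l ?expR_ge0//.
    apply: (le_trans (@norm2_distortion t 1 y y1 _ fy fy1 _)) => //.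
      by move=> [|//] _; rewrite ya.
    rewrite ler_wpM2r ?norm2_ge0// ler_expR expr1.
    by rewrite ler_piMr ?drift_ge0// invf_le1// ler1n.
  rewrite -mulr_suml ler_wpM2r ?mulr_ge0 ?expR_ge0 ?norm2_ge0//.
  apply: le_trans htot; rewrite [leLHS]big_mkcond; apply: ler_sum => y _.
  by case: ifP => // _; rewrite expR_ge0.
have h3 := ler_wpM2l rho0 tot_le.
have h4 := ler_wpM2r (norm2_ge0 (V t y1)) hrho.
rewrite mulrBl mul1r {1}split.
move: pair r_le; rewrite !norm2_pushed => pair r_le.
set S := \sum_(y <- rest | _) _ in r_le *.
apply: (le_trans (lerD pair r_le)).
rewrite -addrA [_ + S]addrC addrA lerB// ?addrA//.
rewrite !mulrA in h3 *; lra.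
Qed.

End contraction.

(** * Exponential decay along one orbit *)

Section splice.
Context (E : nat -> nat -> nat -> Prop).

Definition splice m (y z : seq_space) : seq_space :=
  fun i => if (i < m)%N then y i else z (i - m)%N.

Lemma fib_splice t m y z : fib E t y -> fib E (t + m) z -> z 0%N = y m ->
  fib E t (splice m y z).
Proof.
move=> fy fz zy i; rewrite /splice; case: (ltngtP i.+1 m) => [im|im|im].
- exact: fy.
- by rewrite subSn//; have := fz (i - m)%N; rewrite -addnA subnKC.
- by rewrite -im subnn zy -im.
Qed.

Lemma iter_shift_splice m n y z : iter (m + n) shift (splice m y z) = iter n shift z.
Proof.
apply/funext => i; rewrite !iter_shift /splice.
by rewrite -addnA ltnNge leq_addr /= addKn.
Qed.

Lemma iter_shift_splice0 m y z : iter m shift (splice m y z) = z.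
Proof. by rewrite -{1}(addn0 m) iter_shift_splice. Qed.

End splice.

Section decay.
Context {R : realType} {G : groupType} (psi : seq_space -> G).
Context (hpsi : depends_on_first_letter psi).
Context (E : nat -> nat -> nat -> Prop) (pot : nat -> seq_space -> R).
Context (M : nat -> nat).
Context (letter_lt : forall t y, fib E t y -> (y 0%N < M t)%N).
Context (kap F ell : nat -> R).
Context (kap_ge0 : forall t, 0 <= kap t) (F_ge0 : forall t, 0 <= F t).
Context (ell_ge0 : forall t, 0 <= ell t).
Context (pot_holder : forall t n x y, (0 < n)%N -> fib E t x -> fib E t y ->
  (forall i, (i < n)%N -> x i = y i) -> pot t x - pot t y <= kap t * 2^-1 ^+ n).
Context (pot_bound : forall t y, fib E t y -> `|pot t y| <= F t).
Context (step_mass : forall t x, fib E t.+1 x ->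
  \sum_(a <- iota 0 (M t) | `[< fib E t (scons a x) >])
    expR (pot t (scons a x)) <= expR (ell t)).

Local Notation fib := (fib E).
Local Notation branches := (branches E M).
Local Notation bsum := (bsum pot).
Local Notation mass := (mass E pot M).
Local Notation V := (transfer E pot M psi).
Local Notation drift := (drift kap).

Lemma bsum_bound t n y : fib t y -> `|bsum t n y| <= \sum_(j < n) F (t + j).
Proof.
move=> fy; rewrite /bsum; apply: le_trans (ler_norm_sum _ _ _) _.
by apply: ler_sum => i _; apply: pot_bound; exact: fib_iter.
Qed.

Lemma bsum_split t m n y :
  bsum t (m + n) y = bsum t m y + bsum (t + m) n (iter m shift y).
Proof.
rewrite /bsum big_split_ord /=; congr (_ + _); apply: eq_bigr => i _.
by rewrite addnA (addnC m i) iterD.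
Qed.

Lemma branches_mass t n x : fib (t + n) x ->
  \sum_(y <- branches t n x) expR (bsum t n y) <= expR (\sum_(j < n) ell (t + j)).
Proof.
elim: n x => [|n IH] x fx.
  by rewrite /= big_seq1 /bsum !big_ord0.
rewrite sum_branchesS big_ord_recr /= expRD.
apply: (@le_trans _ _ (\sum_(a <- iota 0 (M (t + n)) | `[< fib (t + n) (scons a x) >])
   expR (pot (t + n) (scons a x)) * expR (\sum_(j < n) ell (t + j)))).
  apply: ler_sum => a /asboolP fa.
  rewrite mulrC -ler_pdivrMr ?expR_gt0//; apply: le_trans (IH _ fa).
  rewrite mulr_suml le_eqVlt; apply/orP; left; apply/eqP; apply: eq_big_seq => y yP.
  by rewrite bsumS (branches_iter yP) expRD mulfK// gt_eqF ?expR_gt0.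
rewrite -mulr_suml mulrC ler_wpM2l ?expR_ge0//; apply: step_mass.
by rewrite addnS in fx.
Qed.

Context (mix : forall (Mb : nat) (K : seq G), exists N1 : nat,
  forall t c k x, k \in K -> (c < Mb)%N -> (x 0%N < Mb)%N ->
  (exists2 z, fib t z & z 0%N = c) -> fib (t + N1) x ->
  exists z, [/\ fib t z, z 0%N = c, iter N1 shift z = x & psi_iter psi N1 z = k]).

(** At a good time [t], distortion and weights are bounded on the following [m
    + N1] steps, and the letters at the two ends of the connecting words,
    which have length [N1], are below [Mb]. *)
Definition good (Mb m N1 : nat) (B B2 : R) (t : nat) : Prop :=
  [/\ drift 0 t <= B, drift t m <= B,
     \sum_(j < N1) F (t + m + j) <= B,
     (forall y, fib (t + m) y -> (y 0%N < Mb)%N) /\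
     (forall y, fib (t + (m + N1)) y -> (y 0%N < Mb)%N) &
     \sum_(j < m + N1) (F (t + j) + ell (t + j)) <= B2].

(** Given one history [y] of [x] with first letter [a], mixing provides two
    others: both follow [y] for [m] letters and then reach [x] along
    connecting words with the group values 1 and k^-1, where [k] is a
    translation that moves the vector carried by the first one. So
    [letter_gain] applies for every first letter. *)
Lemma slot_gain (K : seq G) (eta : R) (Mb N1 m : nat) (B B2 rho : R) :
  0 < eta ->
  (forall v : G -> R, l2 v -> (forall g, 0 <= v g) ->
    exists2 k, k \in K & norm2 (fun g => v g + rtrans k v g) <= (2 - eta) * norm2 v) ->
  (forall t c k x, k \in (1%g :: [seq h^-1%g | h <- K]) -> (c < Mb)%N -> (x 0%N < Mb)%N ->
    (exists2 z, fib t z & z 0%N = c) -> fib (t + N1) x ->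
    exists z, [/\ fib t z, z 0%N = c, iter N1 shift z = x & psi_iter psi N1 z = k]) ->
  (0 < m)%N ->
  expR (3 * B) * (expR (B * 2^-1 ^+ m) - expR (- (B * 2^-1 ^+ m))) <= eta / 2 ->
  0 <= rho -> rho * expR B2 * expR B <= eta / 2 * expR (- B2) ->
  forall (u : G -> R) t x, l2 u -> (forall g, 0 <= u g) ->
  good Mb m N1 B B2 t -> fib (t + (m + N1)) x ->
  norm2 (V u (t + (m + N1)) x) <=
  (1 - rho) * \sum_(y <- branches t (m + N1) x) expR (bsum t (m + N1) y) * norm2 (V u t y).
Proof.
move=> eta0 gap mixK m0 hm rho0 hrho u t x u2 u0 [g1 g2 g3 [g4 g4'] g5] fx.
set n := (m + N1)%N in fx g4' g5 *.
have V2 s y : l2 (V u s y) by have [] := transfer_l2 psi E pot M u2 s y.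
rewrite transfer_pushed (_ : (fun g => _) = fun g => \sum_(a <- iota 0 (M t))
   \sum_(y <- branches t n x | y 0%N == a) expR (bsum t n y) * pushed psi E pot M u t n y g); last first.
  by apply/funext => g; rewrite (sum_by_first_letter letter_lt).
rewrite (sum_by_first_letter letter_lt)// mulr_sumr.
set L := fun a g => \sum_(y <- branches t n x | y 0%N == a)
  expR (bsum t n y) * pushed psi E pot M u t n y g.
set S := fun a => \sum_(y <- branches t n x | y 0%N == a)
  expR (bsum t n y) * norm2 (V u t y).
suff key a : l2 (L a) /\ norm2 (L a) <= (1 - rho) * S a.
  by have [] := norm2_sum (iota 0 (M t)) key.
split; first by have [] := norm2_pushed_sum psi E pot M u2 t n (branches t n x) (fun y => y 0%N == a).
have [[y yP /eqP ya]|none] := pselect (exists2 y, y \in branches t n x & y 0%N == a); last first.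
  have e0 (F' : seq_space -> R) : \sum_(y <- branches t n x | y 0%N == a) F' y = 0.
    by rewrite big1_seq// => y /andP[ya yP]; case: none; exists y.
  rewrite /S e0 mulr0 (_ : L a = fun=> 0); last by apply/funext => g; rewrite /L e0.
  by have [] := @l2_0 R G.
have [fy yx] := (mem_branches letter_lt y fx).1 yP.
have fym := fib_iter m fy.
have cMb : (y m < Mb)%N by have := g4 _ fym; rewrite iter_shift addn0.
have bMb : (x 0%N < Mb)%N by apply: g4'.
have fx' : fib (t + m + N1) x by rewrite -addnA.
have ex_c : exists2 z, fib (t + m) z & z 0%N = y m.
  by exists (iter m shift y); rewrite // iter_shift addn0.
have [z1 [fz1 z10 z1x z1k]] := mixK _ _ 1%g _ (mem_head _ _) cMb bMb ex_c fx'.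
pose y1 := splice m y z1.
have spliceP z : fib (t + m) z -> z 0%N = y m -> iter N1 shift z = x ->
    [/\ fib t (splice m y z), splice m y z \in branches t n x &
       splice m y z 0%N = a].
  move=> fz z0 zx; have fg := fib_splice fy fz z0; split=> //.
    by apply/(mem_branches letter_lt _ fx); split; rewrite // /n iter_shift_splice.
  by rewrite /splice m0.
have agree z i : (i < m)%N -> splice m y z i = y i by rewrite /splice => ->.
have psiE z : psi_iter psi n (splice m y z) = (psi_iter psi m y * psi_iter psi N1 z)%g.
  rewrite /n psi_iterD iter_shift_splice0; congr (_ * _)%g.
  by apply: psi_iter_eq => // i; exact: agree.
have [fy1 y1P y1a] := spliceP _ fz1 z10 z1x.
have [k kK hk] := gap (pushed psi E pot M u t n y1) (pushed_l2 _ _ _ _ u2 _ _ _)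
  (fun g => pushed_ge0 _ _ _ _ u0 _ _ _ g).
have kinv : k^-1%g \in (1%g :: [seq h^-1%g | h <- K]).
  by rewrite inE map_f ?orbT.
have [z2 [fz2 z20 z2x z2k]] := mixK _ _ _ _ kinv cMb bMb ex_c fx'.
have [fy2 y2P y2a] := spliceP _ fz2 z20 z2x.
pose y2 := splice m y z2.
have bdiff y' y'' : fib t y' -> fib t y'' -> (forall i, (i < m)%N -> y' i = y'' i) ->
    bsum t n y' - bsum t n y'' <= 3 * B.
  move=> f' f'' e; rewrite !bsum_split opprD addrACA.
  have h1 := le_trans (bsum_distortion0 pot_holder f' f'' e) g2.
  have := bsum_bound N1 (fib_iter m f'); have := bsum_bound N1 (fib_iter m f'').
  rewrite !ler_norml => /andP[h2 h3] /andP[h4 h5]; lra.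
have sumF : \sum_(j < n) F (t + j) <= B2.
  by apply: le_trans g5; apply: ler_sum => j _; rewrite lerDl.
have sumell : \sum_(j < n) ell (t + j) <= B2.
  by apply: le_trans g5; apply: ler_sum => j _; rewrite lerDr.
have blow y' : fib t y' -> - B2 <= bsum t n y'.
  by move=> f'; have := bsum_bound n f'; rewrite ler_norml => /andP[h _]; lra.
have B0 : 0 <= B := le_trans (drift_ge0 kap_ge0 _ _) g1.
have agree12 i : (i < m)%N -> y1 i = y2 i by move=> im; rewrite /y1 /y2 !agree.
have agree21 i : (i < m)%N -> y2 i = y1 i by move=> im; rewrite agree12.
pose e := Num.min (expR (bsum t n y1)) (expR (bsum t n y2)).
have eB : expR (- B2) <= e by rewrite /e le_min !ler_expR !blow.
have tau_le : drift 0 t * 2^-1 ^+ m <= B * 2^-1 ^+ m.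
  by rewrite ler_wpM2r// exprn_ge0 ?invr_ge0.
have mass_tot := le_trans (branches_mass fx) (_ : _ <= expR B2).
have {}mass_tot : \sum_(y <- branches t n x) expR (bsum t n y) <= expR B2.
  by apply: mass_tot; rewrite ler_expR.
have gain_e : rho * expR B2 * expR (drift 0 t) <= eta / 2 * e.
  apply: (@le_trans _ _ (rho * expR B2 * expR B)).
    by rewrite ler_wpM2l ?ler_expR// mulr_ge0 ?expR_ge0.
  by apply: (le_trans hrho); rewrite ler_wpM2l// divr_ge0 ?ltW.
have beta_le : expR (3 * B) * (expR (drift 0 t * 2^-1 ^+ m) -
    expR (- (drift 0 t * 2^-1 ^+ m))) <= eta / 2.
  apply: le_trans hm; rewrite ler_wpM2l ?expR_ge0//.
  by rewrite lerB ?ler_expR// lerN2.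
have ratio : expR (bsum t n y2) <= expR (3 * B) * e.
  rewrite /e minEle; case: ifP => _; rewrite -expRD ler_expR.
    by have := bdiff y2 y1 fy2 fy1 agree21; lra.
  by lra.
have hk12 : psi_iter psi n y2 = (psi_iter psi n y1 * k^-1)%g.
  by rewrite !psiE z1k z2k mulg1.
have e0 : 0 <= e by rewrite (le_trans _ eB)// expR_ge0.
have e1 : e <= expR (bsum t n y1) by rewrite /e ge_min lexx.
have e2 : e <= expR (bsum t n y2) by rewrite /e ge_min lexx orbT.
have [y12|y12] := eqVneq y1 y2; last first.
  exact: (@letter_gain _ _ _ hpsi _ _ _ letter_lt _ kap_ge0 pot_holder _ u2 u0
    eta (expR (3 * B)) e rho (expR B2) t n x a m y1 y2 k).
(* equal words force k = 1, which has no gap unless the vector vanishes *)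
have k1 : k = 1%g.
  by move: hk12; rewrite -y12 -[LHS]mulg1 => /mulgI /esym /eqP; rewrite invg_eq1 => /eqP.
have pn0 : norm2 (V u t y1) = 0.
  apply/eqP; rewrite eq_le norm2_ge0 andbT -(norm2_pushed psi E pot M u t n y1).
  move: hk; set p := pushed _ _ _ _ _ _ _ _ => hk.
  have pE : (fun g => p g + rtrans k p g) = fun g => 2 * p g.
    by apply/funext => g; rewrite k1 /rtrans mulg1 mulr_natl mulr2n.
  move: hk; rewrite pE norm2Z//; last exact: pushed_l2.
  by rewrite mulrBl lerBrDr gerDl pmulr_rle0.
have all0 y' : y' \in branches t n x -> y' 0%N = a -> norm2 (V u t y') = 0.
  move=> y'P y'a; have [f' _] := (mem_branches letter_lt _ fx).1 y'P.
  apply/eqP; rewrite eq_le norm2_ge0 andbT.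
  have := @norm2_distortion _ _ _ hpsi _ _ M _ pot_holder _ u2 u0 t 1 y' y1 isT f' fy1 _.
  rewrite pn0 mulr0; apply=> -[|//] _; by rewrite y'a -y1a.
have S0 : S a = 0.
  by rewrite /S big1_seq// => y' /andP[/eqP y'a y'P]; rewrite all0// mulr0.
rewrite S0 mulr0 -S0.
by have [] := norm2_pushed_sum psi E pot M u2 t n (branches t n x) (fun y => y 0%N == a).
Qed.

Definition large (Mb j : nat) : bool :=
  `[< exists2 y, fib j y & (Mb <= y 0%N)%N >].

Lemma sum_shift_le (g : nat -> R) s k : (forall j, 0 <= g j) ->
  \sum_(t < k) g (t + s)%N <= \sum_(j < k + s) g j.
Proof.
move=> g0; rewrite (addnC k s) big_split_ord /= ler_wpDl ?sumr_ge0//.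
by apply: ler_sum => i _; rewrite addnC.
Qed.

Lemma sum_window_le (g : nat -> R) (A c : R) s w k : (forall j, 0 <= g j) ->
  (forall n, \sum_(j < n) g j <= A * n%:R + c) -> 0 <= A ->
  \sum_(t < k) \sum_(j < w) g (t + s + j)%N <=
  w%:R * (A * k%:R + (A * (s + w)%:R + c)).
Proof.
move=> g0 hg A0; rewrite exchange_big /=.
apply: (@le_trans _ _ (\sum_(j < w) (A * k%:R + (A * (s + w)%:R + c)))); last first.
  by rewrite sumr_const card_ord mulr_natl.
apply: ler_sum => j _; under eq_bigr do rewrite -addnA.
apply: (le_trans (sum_shift_le _ _ g0)); apply: (le_trans (hg _)).
rewrite addrA lerD2r -mulrDr -natrD ler_wpM2l// ler_nat.
by rewrite leq_add2l leq_add2l ltnW.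
Qed.

(** Each of the six conditions fails with frequency at most 1/10, by Markov's
    inequality for averages along the orbit; this leaves good times of
    frequency 2/5. *)
Lemma good_frequency (A c cM : R) (Mb m N1 : nat) (B B2 : R) :
  0 <= A -> (forall n, \sum_(j < n) (kap j + F j + ell j) <= A * n%:R + c) ->
  (forall n, \sum_(j < n) ((large Mb j)%:R : R) <= 10^-1 * n%:R + cM) ->
  0 < B -> 0 < B2 -> 10 * A <= B -> 10 * (N1%:R * A) <= B ->
  10 * ((m + N1)%:R * A) <= B2 ->
  exists c1, forall k,
    2 / 5 * k%:R - c1 <= \sum_(t < k) ((`[< good Mb m N1 B B2 t >] : nat)%:R : R).
Proof.
move=> A0 havg hlarge B0 B20 AB NAB nAB2.
have sub_avg (g : nat -> R) : (forall j, 0 <= g j) ->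
    (forall j, g j <= kap j + F j + ell j) ->
    forall n, \sum_(j < n) g j <= A * n%:R + c.
  by move=> g0 gle n; apply: le_trans (havg n); apply: ler_sum => j _.
have kavg := sub_avg kap kap_ge0 (fun j => _); have {}kavg n : \sum_(j < n) kap j <= A * n%:R + c.
  by apply: kavg => j; have := F_ge0 j; have := ell_ge0 j; lra.
have Favg n : \sum_(j < n) F j <= A * n%:R + c.
  by apply: sub_avg => // j; have := kap_ge0 j; have := ell_ge0 j; lra.
have FEavg n : \sum_(j < n) (F j + ell j) <= A * n%:R + c.
  apply: (sub_avg (fun j => F j + ell j)) => j; first by rewrite addr_ge0.
  by have := kap_ge0 j; lra.
pose bad t : R := drift 0 t / B + drift t m / B +
  (\sum_(j < N1) F (t + m + j)%N) / B + (large Mb (t + m))%:R +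
  (large Mb (t + (m + N1)))%:R +
  (\sum_(j < m + N1) (F (t + 0 + j)%N + ell (t + 0 + j)%N)) / B2.
have sF0 (g : nat -> R) w s : (forall j, 0 <= g j) -> 0 <= \sum_(j < w) g (s + j)%N.
  by move=> g0; apply: sumr_ge0.
have FE0 j : 0 <= F j + ell j by rewrite addr_ge0.
have key t : 1 <= ((`[< good Mb m N1 B B2 t >] : nat)%:R : R) + bad t.
  have b1 : 0 <= drift 0 t / B by rewrite divr_ge0 ?drift_ge0// ltW.
  have b2 : 0 <= drift t m / B by rewrite divr_ge0 ?drift_ge0// ltW.
  have b3 : 0 <= (\sum_(j < N1) F (t + m + j)%N) / B.
    by apply: divr_ge0; [exact: sF0|exact: ltW].
  have b6 : 0 <= (\sum_(j < m + N1) (F (t + 0 + j)%N + ell (t + 0 + j)%N)) / B2.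
    by apply: divr_ge0; [exact: (sF0 (fun j => F j + ell j))|exact: ltW].
  have b4 : 0 <= (large Mb (t + m))%:R :> R by rewrite ler0n.
  have b5 : 0 <= (large Mb (t + (m + N1)))%:R :> R by rewrite ler0n.
  case: asboolP => [_|ngood]; first by rewrite /bad mulr1n; lra.
  rewrite mulr0n add0r leNgt; apply/negP => lt1; apply: ngood; split.
  - have : drift 0 t / B < 1 by move: lt1; rewrite /bad; lra.
    by rewrite ltr_pdivrMr// mul1r => /ltW.
  - have : drift t m / B < 1 by move: lt1; rewrite /bad; lra.
    by rewrite ltr_pdivrMr// mul1r => /ltW.
  - have : (\sum_(j < N1) F (t + m + j)%N) / B < 1 by move: lt1; rewrite /bad; lra.
    by rewrite ltr_pdivrMr// mul1r => /ltW.
  - split=> y fy; rewrite ltnNge; apply/negP => hy.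
      have h : large Mb (t + m) by apply/asboolP; exists y.
      by move: lt1; rewrite /bad h mulr1n; lra.
    have h : large Mb (t + (m + N1)) by apply/asboolP; exists y.
    by move: lt1; rewrite /bad h mulr1n; lra.
  - have : (\sum_(j < m + N1) (F (t + 0 + j)%N + ell (t + 0 + j)%N)) / B2 < 1.
      by move: lt1; rewrite /bad; lra.
    by rewrite ltr_pdivrMr// mul1r addn0 => /ltW.
pose C1 := c / B; pose C2 := (A * m%:R + c) / B.
pose C3 := N1%:R * (A * (m + N1)%:R + c) / B.
pose C4 := 10^-1 * m%:R + cM; pose C5 := 10^-1 * (m + N1)%:R + cM.
pose C6 := (m + N1)%:R * (A * (0 + (m + N1))%:R + c) / B2.
exists (C1 + C2 + C3 + C4 + C5 + C6) => k.
have k0 : 0 <= k%:R :> R by rewrite ler0n.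
have t1 : \sum_(t < k) drift 0 t / B <= 10^-1 * k%:R + C1.
  rewrite -mulr_suml ler_pdivrMr// mulrDl divfK ?gt_eqF//.
  apply: le_trans (sum_drift kap_ge0 k) _; apply: le_trans (kavg k) _.
  by rewrite lerD2r; have := ler_wpM2r k0 AB; lra.
have t2 : \sum_(t < k) drift t m / B <= 10^-1 * k%:R + C2.
  rewrite -mulr_suml ler_pdivrMr// mulrDl divfK ?gt_eqF//.
  apply: le_trans (sum_drift_slot kap_ge0 k m) _; apply: le_trans (kavg _) _.
  by rewrite natrD; have := ler_wpM2r k0 AB; lra.
have t3 : \sum_(t < k) (\sum_(j < N1) F (t + m + j)%N) / B <= 10^-1 * k%:R + C3.
  rewrite -mulr_suml ler_pdivrMr// mulrDl divfK ?gt_eqF//.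
  apply: le_trans (sum_window_le m N1 k F_ge0 Favg A0) _.
  by have := ler_wpM2r k0 NAB; lra.
have t4 : \sum_(t < k) ((large Mb (t + m))%:R : R) <= 10^-1 * k%:R + C4.
  apply: le_trans (sum_shift_le m k (fun j => ler0n R (large Mb j))) _.
  by apply: le_trans (hlarge _) _; rewrite natrD /C4; lra.
have t5 : \sum_(t < k) ((large Mb (t + (m + N1)))%:R : R) <= 10^-1 * k%:R + C5.
  apply: le_trans (sum_shift_le (m + N1) k (fun j => ler0n R (large Mb j))) _.
  by apply: le_trans (hlarge _) _; rewrite [(k + _)%:R]natrD /C5; lra.
have t6 : \sum_(t < k) (\sum_(j < m + N1) (F (t + 0 + j)%N + ell (t + 0 + j)%N)) / B2
    <= 10^-1 * k%:R + C6.
  rewrite -mulr_suml ler_pdivrMr// mulrDl divfK ?gt_eqF//.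
  apply: le_trans (sum_window_le 0 (m + N1) k FE0 FEavg A0) _.
  by have := ler_wpM2r k0 nAB2; lra.
have : k%:R <= \sum_(t < k) (((`[< good Mb m N1 B B2 t >] : nat)%:R : R) + bad t).
  apply: (@le_trans _ _ (\sum_(t < k) 1)); first by rewrite sumr_const card_ord.
  by apply: ler_sum => t _.
rewrite /bad !big_split /= => hk; lra.
Qed.

(** Slots of [n] steps that start at good times may overlap. Distributing the
    factor [1 - rho] evenly over the [n] steps of a slot settles this: in the
    induction on [k], the last slot is used as a whole if it starts at a good
    time, and otherwise a single step is made without loss. *)
Lemma decay_by_slots (n : nat) (rho : R) (good' : nat -> bool) (u : G -> R) :
  (0 < n)%N -> l2 u -> 0 <= rho -> rho < 1 ->
  (forall t x, good' t -> fib (t + n) x ->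
    norm2 (V u (t + n) x) <=
    (1 - rho) * \sum_(y <- branches t n x) expR (bsum t n y) * norm2 (V u t y)) ->
  forall k x, fib k x -> norm2 (V u k x) <=
    expR (ln (1 - rho) / n%:R * \sum_(t < k.+1 - n) ((good' t : nat)%:R : R)) *
    (mass k x * norm2 u).
Proof.
move=> n0 u2 rho0 rho1 slot; set c := ln (1 - rho) / n%:R.
pose cnt j : R := \sum_(t < j) ((good' t : nat)%:R : R).
have c0 : c <= 0 by rewrite /c pmulr_lle0 ?invr_gt0 ?ltr0n// ln_le0// gerBl.
have cn : expR (c * n%:R) = 1 - rho.
  by rewrite /c divfK ?pnatr_eq0 -?lt0n// lnK// posrE subr_gt0.
have cnt_step t l : cnt (t + l)%N <= cnt t + l%:R.
  rewrite /cnt big_split_ord /= lerD2l.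
  apply: (@le_trans _ _ (\sum_(i < l) 1)); last by rewrite sumr_const card_ord.
  by apply: ler_sum => i _; rewrite lern1 leq_b1.
have mu0 k x : 0 <= mass k x * norm2 u by rewrite mulr_ge0 ?mass_ge0 ?norm2_ge0.
have propagate j t x (q : R) : fib (t + j) x ->
    (forall y, fib t y -> norm2 (V u t y) <= q * (mass t y * norm2 u)) ->
    \sum_(y <- branches t j x) expR (bsum t j y) * norm2 (V u t y) <=
    q * (mass (t + j) x * norm2 u).
  move=> fx hy; rewrite mass_branches mulr_suml mulr_sumr.
  rewrite big_seq_cond [leRHS]big_seq_cond; apply: ler_sum => y.
  rewrite andbT => /(mem_branches letter_lt _ fx)[fy _].
  apply: le_trans (ler_wpM2l (expR_ge0 _) (hy _ fy)) _.
  by rewrite le_eqVlt; apply/orP; left; apply/eqP; ring.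
elim/ltn_ind => k IH x fx; rewrite -/(cnt _).
have [kn|nk] := ltnP k n.
  rewrite (_ : k.+1 - n = 0)%N; last by apply/eqP; rewrite subn_eq0.
  rewrite /cnt big_ord0 mulr0 expR0 mul1r.
  by have [] := transfer_l2 psi E pot M u2 k x.
pose t := (k - n)%N.
have kE : k = (t + n)%N by rewrite /t subnK.
have -> : (k.+1 - n = t.+1)%N by rewrite kE -addSn addnK.
have tk : (t < k)%N by rewrite kE -[X in (X < _)%N]addn0 ltn_add2l.
have cntS : cnt t.+1 = cnt t + ((good' t : nat)%:R : R) by rewrite /cnt big_ord_recr.
have [gt|ngt] := boolP (good' t).
  have := slot t x gt; rewrite -kE => /(_ fx) h; apply: (le_trans h).
  have fx' : fib (t + n) x by rewrite -kE.
  have := propagate n t x _ fx' (fun y fy => IH t tk y fy); rewrite -/(cnt _) -kE => h2.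
  have r0 : 0 <= 1 - rho by rewrite subr_ge0 ltW.
  apply: le_trans (ler_wpM2l r0 h2) _.
  rewrite -{1}cn [leLHS]mulrA -expRD ler_wpM2r// ler_expR -mulrDr ler_wnM2l//.
  have := cnt_step (t.+1 - n)%N n; have [le|gtn] := leqP n t.+1.
    by rewrite subnK// addrC.
  move=> _; rewrite (eqP (ltnW gtn : (t.+1 - n == 0)%N)) [cnt 0]big_ord0 addr0.
  apply: le_trans (_ : _ <= t.+1%:R) _; last by rewrite ler_nat ltnW.
  by have := cnt_step 0%N t.+1; rewrite add0n [cnt 0]big_ord0 add0r.
rewrite cntS (negbTE ngt) addr0.
have [k' k'E] : exists k', k = k'.+1 by exists k.-1; rewrite prednK// (leq_trans _ nk).
have fx' : fib (k' + 1) x by rewrite addn1 -k'E.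
have := norm2_transfer_le psi E pot M u2 k' 1 x; rewrite addn1 -k'E => h; apply: (le_trans h).
have k'k : (k' < k)%N by rewrite k'E.
have := propagate 1%N k' x _ fx' (fun y fy => IH k' k'k y fy).
by rewrite -/(cnt _) addn1 -k'E (_ : k - n = t)%N.
Qed.

Context (avg_cost : exists A c : R, [/\ 0 <= A, 0 <= c &
  forall n, \sum_(j < n) (kap j + F j + ell j) <= A * n%:R + c]).
Context (rare_large : forall eps : R, 0 < eps -> exists (Mb : nat) (c : R),
  forall n, \sum_(j < n) ((large Mb j)%:R : R) <= eps * n%:R + c).
Context (gap : @has_gap R G).

Lemma small_tau (a b eps : R) : 0 < a -> 0 <= b -> 0 < eps -> exists2 m,
  (0 < m)%N & a * (expR (b * 2^-1 ^+ m) - expR (- (b * 2^-1 ^+ m))) <= eps.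
Proof.
move=> a0 b0 eps0.
have half0 : (fun m : nat => b * 2^-1 ^+ m) @ \oo --> (0 : R).
  rewrite -[X in _ --> X](mulr0 b); apply: cvgMr; apply: cvg_expr.
  by rewrite ger0_norm ?invr_ge0// invf_lt1// ltr1n.
have expcvg (f : R ^nat) : f @ \oo --> (0 : R) -> (fun m => expR (f m)) @ \oo --> (1 : R).
  move=> f0; rewrite -expR0; apply: continuous_cvg => //.
  exact: continuous_expR.
have : (fun m : nat => a * (expR (b * 2^-1 ^+ m) - expR (- (b * 2^-1 ^+ m)))) @ \oo --> (0 : R).
  rewrite -(mulr0 a) -(subrr 1); apply: cvgMr; apply: cvgB; apply: expcvg => //.
  by rewrite -oppr0; exact: cvgN.
move=> /cvgrPdist_le /(_ _ eps0) [m0 _ hm]; exists (maxn m0 1); first by rewrite leq_max orbT.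
have := hm (maxn m0 1) (leq_maxl _ _); rewrite sub0r normrN; apply: le_trans.
exact: ler_norm.
Qed.

(** The constants are chosen in this order: [Mb] such that larger letters are
    rare, [N1] by mixing, [B] from the averages along the orbit, [m] such that
    the distortion [B * 2^-1 ^+ m] is negligible against the gap, and finally
    [B2] and the proportion [rho]. *)
Theorem exponential_decay : exists c c1 : R, 0 < c /\
  forall u : G -> R, l2 u -> (forall g, 0 <= u g) -> forall k x, fib k x ->
    norm2 (V u k x) <= expR (c1 - c * k%:R) * (mass k x * norm2 u).
Proof.
have [K [eta [eta0 hgap]]] := gap.
have [A [c [A0 c0 havg]]] := avg_cost.
have [|Mb [cM hlarge]] := rare_large (eps := 10^-1); first by rewrite invr_gt0.
have [N1 hmix] := mix Mb (1%g :: [seq h^-1%g | h <- K]).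
pose B := 10 * ((N1.+1)%:R * A) + 1.
have N0 : 0 <= N1%:R :> R by rewrite ler0n.
have NA0 : 0 <= N1%:R * A by rewrite mulr_ge0.
have B0 : 0 < B by rewrite /B -natr1 mulrDl mul1r; lra.
have [|m m0 hm] := small_tau (a := expR (3 * B)) (b := B) (eps := eta / 2) (expR_gt0 _) (ltW B0).
  by rewrite divr_gt0.
pose B2 := 10 * ((m + N1)%:R * A) + 1.
have mNA0 : 0 <= (m + N1)%:R * A by rewrite mulr_ge0 ?ler0n.
have B20 : 0 < B2 by rewrite /B2; lra.
pose rho := Num.min (1 / 2) (eta / 2 * expR (- B2) / (expR B2 * expR B)).
have rho0 : 0 < rho.
  by rewrite /rho lt_min divr_gt0//= divr_gt0 ?mulr_gt0 ?expR_gt0 ?divr_gt0.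
have rho1 : rho < 1 by rewrite /rho gt_min; apply/orP; left; lra.
have hrho : rho * expR B2 * expR B <= eta / 2 * expR (- B2).
  by rewrite -mulrA -ler_pdivlMr ?mulr_gt0 ?expR_gt0// /rho ge_min lexx orbT.
have [c1 hfreq] : exists c1, forall k,
    2 / 5 * k%:R - c1 <= \sum_(t < k) ((`[< good Mb m N1 B B2 t >] : nat)%:R : R).
  apply: (good_frequency (A := A) (c := c) (cM := cM)) => //.
  - by rewrite /B -natr1 mulrDl mul1r; lra.
  - by rewrite /B -natr1 mulrDl mul1r; lra.
  - by rewrite /B2; lra.
pose n := (m + N1)%N.
have n0 : (0 < n)%N by rewrite /n addn_gt0 m0.
pose r := - (ln (1 - rho) / n%:R).
have r0 : 0 < r.
  by rewrite /r -mulNr divr_gt0 ?ltr0n// oppr_gt0 ln_lt0// subr_gt0 rho1 gtrBl.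
exists (r * (2 / 5)), (r * (2 / 5 * n%:R + c1)); split; first by rewrite mulr_gt0// divr_gt0.
move=> u u2 u0 k x fx.
have := decay_by_slots (n := n) (rho := rho)
  (good' := fun t => `[< good Mb m N1 B B2 t >]) n0 u2 (ltW rho0) rho1 _ fx.
move=> /(_ (fun t y gt fy => slot_gain eta0 hgap hmix m0 hm (ltW rho0) hrho u2 u0
   (asboolW gt) fy)) h.
apply: (le_trans h); rewrite ler_wpM2r ?mulr_ge0 ?mass_ge0 ?norm2_ge0// ler_expR.
have := hfreq (k.+1 - n)%N; set S := \sum_(t < _) _ => hS.
rewrite (_ : ln (1 - rho) / n%:R = - r); last by rewrite opprK.
have kn : k%:R - n%:R <= (k.+1 - n)%:R :> R.
  rewrite lerBlDr -natrD ler_nat; apply: (@leq_trans (k.+1)) => //.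
  by rewrite addnC -leq_subLR.
have : 2 / 5 * (k%:R - n%:R) - c1 <= S by lra.
move=> /(ler_wpM2l (ltW r0)); lra.
Qed.

End decay.

(** * Ergodic upper bounds *)

Section birkhoff.
Context {d : measure_display} {Omega : measurableType d} {R : realType}.
Context (P : probability Omega R) (T : Omega -> Omega).
Context (mp : measure_preserving P T) (erg : ergodic P T).

Lemma ae_comp (Q : Omega -> Prop) :
  {ae P, forall w, Q w} -> {ae P, forall w, Q (T w)}.
Proof.
have [mT PT] := mp; move=> [N [mN N0 sub]]; exists (T @^-1` N); split.
- by rewrite -[X in measurable X]setTI; exact: mT.
- by rewrite PT.
- by move=> w /= h; apply: sub.
Qed.

Lemma ae_orbit (Q : Omega -> Prop) :
  {ae P, forall w, Q w} -> {ae P, forall w, forall n, Q (iter n T w)}.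
Proof.
move=> hQ; apply/ae_foralln; elim=> [//|n IH].
by have := ae_comp IH; apply: filterS => w; rewrite iterSr.
Qed.

Lemma ge0_integral_comp (h : Omega -> \bar R) : measurable_fun setT h ->
  (forall w, (0 <= h w)%E) -> (\int[P]_w h (T w) = \int[P]_w h w)%E.
Proof.
have [mT PT] := mp; move=> mh h0.
have := @ge0_integral_pushforward _ _ _ _ _ _ mT P setT h measurableT mh (fun w _ => h0 w).
rewrite preimage_setT => <-; apply: eq_measure_integral => A mA _.
exact: PT.
Qed.

Lemma measurable_comp_mp d' (U : measurableType d') (h : Omega -> U) :
  measurable_fun setT h -> measurable_fun setT (h \o T).
Proof. by move=> mh; apply: measurableT_comp => //; case: mp. Qed.

Lemma integral_comp (h : Omega -> \bar R) : measurable_fun setT h ->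
  (\int[P]_w h (T w) = \int[P]_w h w)%E.
Proof.
move=> mh; rewrite [LHS]integralE [RHS]integralE.
congr (_ - _)%E.
  rewrite -(ge0_integral_comp (measurable_funepos mh) (fun w => funepos_ge0 h w)).
  by apply: eq_integral => w _; rewrite !funeposE.
rewrite -(ge0_integral_comp (measurable_funeneg mh) (fun w => funeneg_ge0 h w)).
by apply: eq_integral => w _; rewrite !funenegE.
Qed.

Lemma integrable_comp (h : Omega -> \bar R) :
  P.-integrable setT h -> P.-integrable setT (h \o T).
Proof.
move=> /integrableP[mh hoo]; apply/integrableP; split; first exact: measurable_comp_mp.
rewrite (ge0_integral_comp (h := fun w => `|h w|%E)) //.
exact: measurableT_comp.
Qed.

Definition orbit_sum (g : Omega -> R) n w : R := \sum_(i < n) g (iter i T w).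

(** The largest of the orbit sums of lengths 0, ..., n. *)
Fixpoint max_sum (g : Omega -> R) n w : R :=
  if n is n'.+1 then Num.max (g w + max_sum g n' (T w)) 0 else 0.

Section garsia.
Context (g : Omega -> R) (ig : P.-integrable setT (EFin \o g)).

Let mg : measurable_fun setT g.
Proof. by apply/measurable_EFinP; exact: measurable_int ig. Qed.

Lemma max_sum_ge0 n w : 0 <= max_sum g n w.
Proof. by case: n => [//|n] /=; rewrite le_max lexx orbT. Qed.

Lemma max_sumS n w : max_sum g n w <= max_sum g n.+1 w.
Proof.
elim: n w => [|n IH] w; first exact: max_sum_ge0.
rewrite [leRHS]/= ge_max; apply/andP; split; last by rewrite le_max lexx orbT.
by rewrite le_max lerD2l IH.
Qed.

Lemma max_sum_mono n m w : (n <= m)%N -> max_sum g n w <= max_sum g m w.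
Proof. by move=> /subnK <-; elim: (m - n)%N => [//|k IH]; apply: le_trans IH (max_sumS _ _). Qed.

Lemma orbit_sum_le_max n w : orbit_sum g n w <= max_sum g n w.
Proof.
elim: n w => [|n IH] w; first by rewrite /orbit_sum big_ord0.
rewrite /orbit_sum big_ord_recl /= le_max lerD2l; apply/orP; left.
apply: le_trans (IH (T w)); rewrite le_eqVlt; apply/orP; left; apply/eqP.
by apply: eq_bigr => i _; rewrite -iterSr.
Qed.

Lemma measurable_max_sum n : measurable_fun setT (max_sum g n).
Proof.
elim: n => [|n IH]; first exact: measurable_cst.
apply: measurable_maxr => //; apply: measurable_funD => //.
exact: measurable_comp_mp.
Qed.

Lemma integrable_max_sum n : P.-integrable setT (EFin \o max_sum g n).
Proof.
elim: n => [|n IH]; first exact: (finite_measure_integrable_cst P 0).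
apply: (@le_integrable _ _ _ _ _ measurableT _ ((EFin \o g) \+ (EFin \o (max_sum g n \o T)))%E) => //.
- by apply/measurable_EFinP; exact: measurable_max_sum.
- move=> w _ /=; rewrite lee_fin; case: (lerP (g w + max_sum g n (T w)) 0) => h.
    by rewrite normr0.
  by [].
- by apply: integrableD => //; exact: (integrable_comp IH).
Qed.

(** The differences [max_sum g n.+1 w - max_sum g n (T w)] have nonnegative
    integrals by invariance, are dominated by [`|g|], and are eventually equal
    to [g w] where [max_sum] diverges. If it diverged almost everywhere, the
    integral of [g] would be nonnegative; as the set of divergence is
    invariant, it is null by ergodicity. *)
Lemma garsia : (\int[P]_w (g w)%:E < 0)%E ->
  {ae P, forall w, exists c, forall n, orbit_sum g n w <= c}.
Proof.
move=> gneg; pose A := [set w | forall k : nat, exists n, k%:R < max_sum g n w].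
have mA : measurable A.
  rewrite (_ : A = \bigcap_k \bigcup_n (max_sum g n @^-1` `]k%:R, +oo[)).
    apply: bigcap_measurable => // k _; apply: bigcup_measurable => n _.
    by rewrite -[X in measurable X]setTI; apply: measurable_max_sum => //; exact: measurable_itv.
  apply/seteqP; split=> w.
    by move=> h k _; have [n hn] := h k; exists n => //=; rewrite in_itv /= hn.
  by move=> h k; have [n _] := h k I; rewrite /= in_itv /= andbT; exists n.
have invA : T @^-1` A = A.
  apply/seteqP; split=> w h k /=.
    have [n hn] := h (Num.truncn (k%:R + `|g w|)).+1; exists n.+1 => /=.
    rewrite lt_max; apply/orP; left.
    have := truncnS_gt (k%:R + `|g w|); have := ler_norm (- g w); rewrite normrN; lra.
  have [n hn] := h (Num.truncn (k%:R + `|g w|)).+1.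
  have tk := truncnS_gt (k%:R + `|g w|); have gk := ler_norm (g w).
  case: n hn => [|n] /=; first by rewrite ltNge ler0n.
  rewrite lt_max => /orP[hn|]; last by rewrite ltNge ler0n.
  by exists n; lra.
have [PA0|PA1] := erg mA invA.
  exists A; split=> // w /= hw; apply: contrapT => /existsNP[k hk]; apply: hw.
  exists k%:R => n; apply: le_trans (orbit_sum_le_max n w) _.
  by rewrite leNgt; apply/negP => h; apply: hk; exists n.
exfalso.
pose h n w := max_sum g n.+1 w - max_sum g n (T w).
have ih n : P.-integrable setT (EFin \o h n).
  have := integrableB measurableT (integrable_max_sum n.+1) (integrable_comp (integrable_max_sum n)).
  by apply: eq_integrable => // w _ /=; rewrite -EFinB.
have h_ge0 n : (0 <= \int[P]_w (h n w)%:E)%E.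
  have -> : (\int[P]_w (h n w)%:E =
      \int[P]_w (max_sum g n.+1 w)%:E - \int[P]_w (max_sum g n (T w))%:E)%E.
    rewrite -integralB//; first exact: integrable_max_sum n.+1.
    exact: (integrable_comp (integrable_max_sum n)).
  rewrite (integral_comp (h := EFin \o max_sum g n)); last first.
    by apply/measurable_EFinP; exact: measurable_max_sum.
  rewrite sube_ge0; last by apply/orP; left; exact: integrable_fin_num (integrable_max_sum n).
  apply: le_integral => //; [exact: integrable_max_sum|exact: integrable_max_sum n.+1|].
  by move=> w _; rewrite lee_fin max_sumS.
have hE n w : h n w = if 0 <= g w + max_sum g n (T w) then g w else - max_sum g n (T w).
  rewrite /h [max_sum g n.+1 w]/=; case: (leP 0 (g w + max_sum g n (T w))) => hh.
    by rewrite addrK.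
  by rewrite sub0r.
have [_ _ cvgh] : [/\ P.-integrable setT (EFin \o g),
    (\int[P]_w `|(h n w)%:E - (g w)%:E| @[n --> \oo] --> 0)%E &
    (\int[P]_w (h n w)%:E @[n --> \oo] --> \int[P]_w (g w)%:E)%E].
  apply: (@dominated_convergence _ _ _ P setT measurableT (fun n w => (h n w)%:E)
    (EFin \o g) (fun w => `|(g w)%:E|%E)) => //.
  - by move=> n; exact: measurable_int (ih n).
  - exact: measurable_int ig.
  - exists (~` A); split; first exact: measurableC.
      by have := probability_setC P mA; rewrite PA1 subee.
    move=> w /= hw Aw; apply: hw => _.
    have Aw' : A (T w) by have : (T @^-1` A) w by rewrite invA.
    have [n0 hn0] := Aw' (Num.truncn `|g w|).+1.
    have : (fun n => (h n w)%:E) @ \oo --> (g w)%:E.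
      apply: cvg_near_cst; exists n0 => // n /= n0n; rewrite hE.
      have := truncnS_gt `|g w|; have := max_sum_mono (T w) n0n.
      have := ler_norm (- g w); rewrite normrN => h1 h2 h3.
      by rewrite ifT//; lra.
    by [].
  - exact: integrable_abse.
  - apply: aeW => w n _; rewrite /= lee_fin hE; case: (leP 0 (g w + max_sum g n (T w))) => // hlt.
    rewrite normrN ger0_norm ?max_sum_ge0//.
    have := ler_norm (- g w); rewrite normrN; lra.
have : (0 <= \int[P]_w (g w)%:E)%E.
  by apply: (cvge_ge (FF := _) _ cvgh) => //; apply: nearW.
by rewrite leNgt gneg.
Qed.

End garsia.

(** [garsia] for [g - a]: the upper half of Birkhoff's theorem, as a linear
    bound with a constant that depends on [w]. *)
Lemma birkhoff_upper (g : Omega -> R) (a : R) :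
  P.-integrable setT (EFin \o g) -> (\int[P]_w (g w)%:E < a%:E)%E ->
  {ae P, forall w, exists c, forall n, orbit_sum g n w <= a * n%:R + c}.
Proof.
move=> ig ga; have ia : P.-integrable setT (EFin \o (fun=> a)).
  exact: (finite_measure_integrable_cst P a).
have ia' : P.-integrable setT (EFin \o (fun w => g w - a)).
  have := integrableB measurableT ig ia.
  by apply: eq_integrable => // w _ /=; rewrite -EFinB.
have neg : (\int[P]_w (g w - a)%:E < 0)%E.
  rewrite (_ : \int[P]_w (g w - a)%:E = \int[P]_w (g w)%:E - a%:E)%E.
    by rewrite suber_lt0.
  under eq_integral do rewrite EFinB.
  rewrite integralB//= integral_cst//= [P setT]probability_setT mule1//.
have := garsia ia' neg.
apply: filterS => w [c hc]; exists c => n; have := hc n.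
by rewrite /orbit_sum sumrB sumr_const card_ord mulr_natr lerBlDr addrC.
Qed.

End birkhoff.

(** * Null sets and cylinders of the sequence space *)

Section sequence_space.

Lemma measurable_coord i k : measurable [set x : X | x i = k].
Proof. by apply: sub_sigma_algebra; exists i, k. Qed.

Lemma measurable_coord_pred i (p : nat -> Prop) : measurable [set x : X | p (x i)].
Proof.
rewrite (_ : [set x : X | p (x i)] = \bigcup_(k in p) [set x : X | x i = k]).
  by apply: bigcup_measurable => k _; exact: measurable_coord.
by apply/seteqP; split=> [x px|x [k pk /= ->]//]; exists (x i).
Qed.

Definition cyl (u : seq nat) : set X :=
  [set x | forall i, (i < size u)%N -> x i = nth 0%N u i].

Lemma measurable_cyl u : measurable (cyl u).
Proof.
rewrite (_ : cyl u = \bigcap_i [set x : X | (i < size u)%N -> x i = nth 0%N u i]).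
  apply: bigcap_measurable => // i _.
  exact: (@measurable_coord_pred i (fun k => (i < size u)%N -> k = nth 0%N u i)).
by apply/seteqP; split=> [x h i _|x h i]; exact: h.
Qed.

Definition clopen n (W : set (seq nat)) : set X := [set x | W (mkseq x n)].

Lemma cyl_mkseq n (x : X) u : size u = n -> cyl u x <-> mkseq x n = u.
Proof.
move=> <-; split=> [h|<- i]; last by rewrite size_mkseq => ilt; rewrite nth_mkseq.
apply: (@eq_from_nth _ 0%N); first by rewrite size_mkseq.
by move=> i; rewrite size_mkseq => ilt; rewrite nth_mkseq// h.
Qed.

(** Writes [clopen n W] as a disjoint union of cylinders over the natural
    numbers, the codes of words, so that countable additivity applies. *)
Definition nth_cyl n (W : set (seq nat)) (k : nat) : set X :=
  if choice.pickle_inv k is Some u then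
    (if `[< size u = n /\ W u >] then cyl u else set0) else set0.

Lemma nth_cylE n W : clopen n W = \bigcup_k nth_cyl n W k.
Proof.
apply/seteqP; split=> [x Wx|x [k _]].
  exists (choice.pickle (mkseq x n)) => //; rewrite /nth_cyl choice.pickleK_inv.
  by rewrite asboolT ?size_mkseq//; apply/(cyl_mkseq _ (size_mkseq _ _)).
rewrite /nth_cyl; case: choice.pickle_inv => [u|//]; case: asboolP => [[su Wu]|//].
by move/(cyl_mkseq _ su) => xu; rewrite /clopen /= xu.
Qed.

Lemma measurable_nth_cyl n W k : measurable (nth_cyl n W k).
Proof.
rewrite /nth_cyl; case: choice.pickle_inv => [u|]; last exact: measurable0.
by case: asbool; [exact: measurable_cyl|exact: measurable0].
Qed.

Lemma trivIset_nth_cyl n W : trivIset setT (nth_cyl n W).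
Proof.
apply/trivIsetP => i j _ _ ij; apply/seteqP; split=> [x []|//].
rewrite /nth_cyl.
case Ei: (choice.pickle_inv i) => [u|//]; case: asboolP => [[su Wu] xu|//].
case Ej: (choice.pickle_inv j) => [v|//]; case: asboolP => [[sv Wv] xv|//].
move/(cyl_mkseq _ su) : xu => xu; move/(cyl_mkseq _ sv) : xv => xv.
move: ij; have := @choice.pickle_invK (seq nat) i; rewrite Ei /= => <-.
by have := @choice.pickle_invK (seq nat) j; rewrite Ej /= => <-; rewrite -xu -xv eqxx.
Qed.

Lemma measurable_clopen n W : measurable (clopen n W).
Proof. by rewrite nth_cylE; apply: bigcupT_measurable => k; exact: measurable_nth_cyl. Qed.

Lemma clopenS n W : clopen n W = clopen n.+1 [set u | W (take n u)].
Proof.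
apply/seteqP; split=> x; rewrite /clopen /= /mkseq -map_take take_iota minnC;
  by rewrite (minn_idPr _) ?leqnSn// || rewrite (minn_idPl _) ?leqnSn.
Qed.

Lemma clopen_widen n m W : (n <= m)%N -> exists W', clopen n W = clopen m W'.
Proof.
move=> /subnKC <-; elim: (m - n)%N => [|k [W' ->]]; first by exists W; rewrite addn0.
by rewrite addnS clopenS; eexists.
Qed.

End sequence_space.

Section approximation.
Context {R : realType} (nu : {measure set X -> \bar R}).
Context (nu_fin : (nu setT < +oo)%E).

Definition approximable : set (set X) := [set B | measurable B /\
  forall e : R, 0 < e -> exists n W,
    (nu ((B `\` clopen n W) `|` (clopen n W `\` B)) <= e%:E)%E].

Lemma symdiff_measurable n W B : measurable B ->
  measurable ((B `\` clopen n W) `|` (clopen n W `\` B)).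
Proof.
by move=> mB; apply: measurableU; apply: measurableD => //; exact: measurable_clopen.
Qed.

Lemma approximable_sigma : sigma_algebra setT approximable.
Proof.
split.
- split; first exact: measurable0.
  move=> e e0; exists 0%N, set0; rewrite (_ : _ `|` _ = set0) ?measure0 ?lee_fin ?ltW//.
  by rewrite (_ : clopen 0 set0 = set0)// set0D set0U.
- move=> B [mB hB]; split; first exact: measurableD.
  move=> e e0; have [n [W h]] := hB e e0; exists n, (~` W).
  apply: le_trans h; rewrite le_eqVlt; apply/orP; left; apply/eqP; congr (nu _).
  rewrite setTD (_ : clopen n (~` W) = ~` clopen n W)//.
  by rewrite !setDE !setCK setUC setIC [X in _ `|` X]setIC.
- move=> B hB; have mB i : measurable (B i) by case: (hB i).
  have mU : measurable (\bigcup_i B i) by exact: bigcupT_measurable.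
  split=> // e e0.
  pose D N := (\bigcup_i B i) `\` \bigcup_(i < N) B i.
  have mD N : measurable (D N).
    by apply: measurableD => //; apply: bigcup_measurable.
  have cD : nu \o D @ \oo --> nu (\bigcap_N D N).
    apply: nonincreasing_cvg_mu => //.
    - by apply: le_lt_trans nu_fin; apply: le_measure; rewrite ?inE.
    - exact: bigcapT_measurable.
    - move=> m n mn; apply/subsetPset; apply: setDS => x [i /= im Bx].
      by exists i => //=; exact: leq_trans im mn.
  have D0 : \bigcap_N D N = set0.
    apply/seteqP; split=> // x h; have [[i _ Bx] _] := h 0%N I.
    by have [_] := h i.+1 I; apply; exists i => //=.
  rewrite D0 measure0 in cD.
  have e2 : 0 < e / 2 by rewrite divr_gt0.
  have [N hN] : exists N, (nu (D N) <= (e / 2)%:E)%E.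
    have e2' : (0 < (e / 2)%:E)%E by rewrite lte_fin.
    have : \forall N \near \oo, (nu (D N) < (e / 2)%:E)%E.
      apply: (cD [set z | z < (e / 2)%:E]%E); apply: open_nbhs_nbhs.
      by split; [exact: open_ereal_lt_ereal|exact: e2'].
    by move=> [N _ h]; exists N; apply/ltW/h => /=.
  have eN : 0 < e / 2 / N.+1%:R by rewrite divr_gt0.
  have /choice[nW hnW] i : exists nW : nat * set (seq nat), 
     (nu ((B i `\` clopen nW.1 nW.2) `|` (clopen nW.1 nW.2 `\` B i)) <= (e / 2 / N.+1%:R)%:E)%E.
    by have [_ /(_ _ eN)[n [W h]]] := hB i; exists (n, W).
  pose m := \max_(i < N) (nW i).1.
  have /choice[W' hW'] i : exists W', (i < N)%N -> clopen (nW i).1 (nW i).2 = clopen m W'.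
    have [iN|] := ltnP i N; last by exists set0.
    have [|W' h] := @clopen_widen (nW i).1 m (nW i).2; last by exists W'.
    exact: (leq_bigmax (Ordinal iN)).
  exists m, (\bigcup_(i < N) W' i).
  pose S i := (B i `\` clopen m (W' i)) `|` (clopen m (W' i) `\` B i).
  have mS i : measurable (S i) by exact: symdiff_measurable.
  apply: (@le_trans _ _ (nu (D N `|` \bigcup_(i < N) S i))).
    apply: le_measure; rewrite ?inE; first exact: symdiff_measurable.
      by apply: measurableU => //; apply: bigcup_measurable.
    move=> x [[[i _ Bx] nW']|[[i /= iN Wx] nB]].
      have [[j /= jN Bjx]|nj] := pselect ((\bigcup_(i < N) B i) x).
        right; exists j => //; left; split=> // Wx; apply: nW'.
        by exists j.
      by left; split=> //; exists i.
    right; exists i => //; right; split=> // Bx; apply: nB; exists i => //.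
  apply: le_trans (measureU2 _ _ _) _ => //; first by apply: bigcup_measurable.
  rewrite (splitr e) EFinD leeD//.
  apply: (@le_trans _ _ (\sum_(i < N) nu (S i))%E).
    apply: content_subadditive => //; first by apply: bigcup_measurable.
    by rewrite bigcup_mkord.
  apply: (@le_trans _ _ (\sum_(i < N) (e / 2 / N.+1%:R)%:E)%E).
    by apply: lee_sum => i _; rewrite /S -hW'//.
  rewrite sumEFin lee_fin sumr_const card_ord -[leLHS]mulr_natr.
  by rewrite mulrAC ler_pdivrMr// ler_wpM2l ?(ltW e2)// ler_nat.
Qed.

(** The sets that can be approximated in measure through finitely many
    coordinates form a sigma-algebra that contains the coordinate sets. *)
Lemma approximation B : measurable B -> approximable B.
Proof.
apply: smallest_sub; first exact: approximable_sigma.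
move=> _ [i [k ->]]; split; first exact: measurable_coord.
move=> e e0; exists i.+1, [set u | nth 0%N u i = k].
rewrite (_ : clopen _ _ = [set x : X | x i = k]).
  by rewrite setDv setU0 measure0 lee_fin ltW.
by apply/seteqP; split=> x; rewrite /clopen /= nth_mkseq.
Qed.

End approximation.

Section cylinder_domination.
Context {R : realType} (nu1 nu2 : {measure set X -> \bar R}) (K : R).
Context (fin1 : (nu1 setT < +oo)%E) (fin2 : (nu2 setT < +oo)%E) (K0 : 0 <= K).
Context (dom : forall u, (2 <= size u)%N -> (nu1 (cyl u) <= K%:E * nu2 (cyl u))%E).

Lemma clopen_domination n W : (nu1 (clopen n W) <= K%:E * nu2 (clopen n W))%E.
Proof.
have [W' ->] := @clopen_widen n n.+2 W (leqW (leqnSn n)).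
rewrite nth_cylE !measure_semi_bigcup//; try exact: measurable_nth_cyl;
  try exact: trivIset_nth_cyl;
  try by apply: bigcupT_measurable => k; exact: measurable_nth_cyl.
rewrite -nneseriesZl//; apply: lee_nneseries => // k _.
rewrite /nth_cyl; case: choice.pickle_inv => [u|]; last by rewrite !measure0 mule0.
case: asboolP => [[su _]|_]; last by rewrite !measure0 mule0.
by apply: dom; rewrite su.
Qed.

(** Domination on cylinders extends to null sets: up to a set that is small
    for [nu1 + nu2], a [nu2]-null set depends on finitely many coordinates,
    and is then a countable disjoint union of cylinders. *)
Lemma null_domination B : measurable B -> nu2 B = 0%E -> nu1 B = 0%E.
Proof.
move=> mB B0; apply/eqP; rewrite eq_le measure_ge0 andbT.
apply/lee_addgt0Pr => e e0; rewrite add0e.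
have K1 : 0 < K + 1 by rewrite ltr_wpDl.
have nufin : (measure_add nu1 nu2 setT < +oo)%E.
  by rewrite measure_addE lte_add_pinfty.
have [_ /(_ (e / (K + 1)))[|n [W h]]] := @approximation R (measure_add nu1 nu2) nufin B mB.
  by rewrite divr_gt0.
move: h; set D := _ `|` _ => h.
have {}h : (nu1 D + nu2 D <= (e / (K + 1))%:E)%E by rewrite -(measure_addE nu1 nu2).
have mD : measurable D by exact: symdiff_measurable.
have mA := measurable_clopen n W.
apply: (@le_trans _ _ (nu1 D + nu1 (clopen n W))%E).
  apply: le_trans (measureU2 nu1 mD mA); apply: le_measure; rewrite ?inE//.
    exact: measurableU.
  by move=> x Bx; have [|] := pselect (clopen n W x); [right|left; left].
apply: (@le_trans _ _ (nu1 D + K%:E * nu2 D)%E).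
  rewrite leeD2l//; apply: le_trans (clopen_domination n W) _.
  rewrite lee_wpmul2l ?lee_fin//.
  apply: (@le_trans _ _ (nu2 (D `|` B))).
    apply: le_measure; rewrite ?inE//; first exact: measurableU.
    by move=> x Ax; have [|] := pselect (B x); [right|left; right].
  by apply: le_trans (measureU2 nu2 mD mB) _; rewrite [X in (_ + X)%E]B0 adde0.
have fD1 : nu1 D \is a fin_num.
  by rewrite ge0_fin_numE//; apply: le_lt_trans fin1; apply: le_measure; rewrite ?inE.
have fD2 : nu2 D \is a fin_num.
  by rewrite ge0_fin_numE//; apply: le_lt_trans fin2; apply: le_measure; rewrite ?inE.
have ha : 0 <= fine (nu1 D) by rewrite fine_ge0.
have hb : 0 <= fine (nu2 D) by rewrite fine_ge0.
move: h.
rewrite -(fineK fD1) -(fineK fD2) -!EFinM -!EFinD !lee_fin.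
rewrite ler_pdivlMr// => h; have := mulr_ge0 ha K0; lra.
Qed.

End cylinder_domination.

Lemma measurable_scons a : measurable_fun setT (scons a : X -> X).
Proof.
apply: (@measurability _ _ X X setT (scons a) coordinate_sets) => //.
move=> _ [_ [i [k ->]] <-]; rewrite setTI; case: i => [|i]; last exact: (measurable_coord i k).
exact: (@measurable_coord_pred 0 (fun=> a = k)).
Qed.

Section branch_measure.
Context {R : realType} (m : {measure set X -> \bar R}) (a : nat) (D : set X).
Context (mD : measurable D).

(** The image under [scons a] of the restriction of [m] to [D]. *)
Definition branch_measure (mD' : measurable D) (A : set X) : \bar R :=
  m (D `&` scons a @^-1` A).

Let mpre A : measurable A -> measurable (D `&` scons a @^-1` A).
Proof.
move=> mA; apply: measurableI => //.
by rewrite -[X in measurable X]setTI; exact: measurable_scons.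
Qed.

Let branch0 : branch_measure mD set0 = 0%E.
Proof. by rewrite /branch_measure preimage_set0 setI0 measure0. Qed.

Let branch_ge0 A : (0 <= branch_measure mD A)%E.
Proof. exact: measure_ge0. Qed.

Let branch_sigma_additive : semi_sigma_additive (branch_measure mD).
Proof.
move=> F mF tF mUF; rewrite /branch_measure preimage_bigcup setI_bigcupr.
apply: measure_semi_sigma_additive.
- by move=> n; exact: mpre.
- apply/trivIsetP => /= i j _ _ ij; rewrite setIACA -preimage_setI.
  by move/trivIsetP : tF => /(_ _ _ _ _ ij) ->//; rewrite preimage_set0 setI0.
- by rewrite -setI_bigcupr -preimage_bigcup; exact: mpre.
Qed.

HB.instance Definition _ := isMeasure.Build _ _ _
  (branch_measure mD) branch0 branch_ge0 branch_sigma_additive.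

End branch_measure.

Section letter_measures.
Context {R : realType} (nu : {measure set X -> \bar R}).

Lemma sum_letters_measure n (s : seq nat) (A : set X) : uniq s -> measurable A ->
  (\sum_(a <- s) nu (A `&` [set z | z n = a]) <= nu A)%E.
Proof.
elim: s A => [|a s IH] A; first by rewrite big_nil.
move=> /= /andP[nas us] mA; rewrite big_cons.
have mAa : measurable (A `&` [set z | z n = a]).
  by apply: measurableI => //; exact: measurable_coord.
have mAa' : measurable (A `\` [set z | z n = a]).
  by apply: measurableD => //; exact: measurable_coord.
have -> : nu A = (nu (A `&` [set z | z n = a]) + nu (A `\` [set z | z n = a]))%E.
  rewrite -measureU//; first by rewrite setUIDK.
  by apply/seteqP; split=> // x [[_ h] [_]].
rewrite leeD2l//; apply: le_trans (IH _ us mAa').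
rewrite big_seq [leRHS]big_seq le_eqVlt; apply/orP; left; apply/eqP.
apply: eq_bigr => b bs; congr (nu _); apply/seteqP; split=> x [].
  move=> Ax xb; split=> //; split=> // xa; move: nas; rewrite -xa xb bs//.
by move=> [Ax _] xb.
Qed.

Lemma sum_branches_measure E (M : nat -> nat) n x (A : set X) : measurable A ->
  (\sum_(y <- branches E M 0 n x) nu (A `&` cyl (mkseq y n)) <= nu A)%E.
Proof.
elim: n x A => [|n IH] x A mA.
  rewrite /= big_seq1; apply: le_measure; rewrite ?inE//.
  by apply: measurableI => //; exact: measurable_cyl.
rewrite /= big_flatten big_map /=.
set s := [seq _ <- _ | _].
have us : uniq s by rewrite filter_uniq// iota_uniq.
apply: le_trans (sum_letters_measure n us mA); apply: lee_sum => a _.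
have mAa : measurable (A `&` [set z | z n = a]).
  by apply: measurableI => //; exact: measurable_coord.
apply: le_trans (IH (scons a x) _ mAa).
rewrite big_seq [leRHS]big_seq le_eqVlt; apply/orP; left; apply/eqP.
apply: eq_bigr => y /branches_iter yE; congr (nu _).
have yn : y n = a by have := iter_shift n y 0; rewrite yE addn0.
apply/seteqP; split=> z [].
  move=> Az h; split; first split=> //.
    by have := h n; rewrite size_mkseq nth_mkseq//= yn; apply.
  move=> i; rewrite size_mkseq => ilt; have := h i; rewrite size_mkseq !nth_mkseq//.
    by apply; exact: ltnW.
  exact: ltnW.
move=> [Az zn] h; split=> // i; rewrite size_mkseq ltnS leq_eqVlt => /orP[/eqP ->|ilt].
  by rewrite nth_mkseq// yn.
by have := h i; rewrite size_mkseq => /(_ ilt) ->; rewrite !nth_mkseq// ltnS ltnW.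
Qed.

End letter_measures.

(** * The Gibbs bounds at one base point *)

Section shift_orbit.
Context {d : measure_display} {Omega : measurableType d} {R : realType}.
Context {P : probability Omega R} (f : random_shift P).

Definition transition w t a b : Prop :=
  letters f (theta_iter f t w) a /\ alpha f (theta_iter f t w) a b.

Definition potential (phi : Omega * X -> R) w t (y : X) : R :=
  phi (theta_iter f t w, y).

Lemma theta_iterD m n w : theta_iter f m (theta_iter f n w) = theta_iter f (n + m) w.
Proof. by rewrite /theta_iter addnC iterD. Qed.

Lemma fib_transition w t : fib (transition w) t = fiber f (theta_iter f t w).
Proof.
by apply/seteqP; split=> x h i; have := h i; rewrite /transition theta_iterD.
Qed.

Lemma iter_skew i w x : iter i (skew f) (w, x) = (theta_iter f i w, iter i shift x).
Proof. by elim: i => [//|i IH]; rewrite iterS IH. Qed.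

Lemma birkhoff_bsum phi t n w x :
  birkhoff_sum f phi n (theta_iter f t w, x) = bsum (potential phi w) t n x.
Proof. by apply: eq_bigr => i _; rewrite iter_skew theta_iterD. Qed.

Lemma measurable_fiber w : measurable (fiber f w).
Proof.
rewrite (_ : fiber f w = \bigcap_i \bigcup_k ([set x : X | x i = k] `&`
   [set x : X | letters f (theta_iter f i w) k /\
                alpha f (theta_iter f i w) k (x i.+1)])).
  apply: bigcapT_measurable => i; apply: bigcupT_measurable => k.
  apply: measurableI; first exact: measurable_coord.
  exact: (@measurable_coord_pred i.+1 (fun b => letters f (theta_iter f i w) k /\
                alpha f (theta_iter f i w) k b)).
apply/seteqP; split=> x h i.
  by move=> _; exists (x i) => //; split=> //; exact: h.
by have [k _ [/= -> ]] := h i I.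
Qed.

Lemma fiber_scons a x w :
  fiber f w (scons a x) <-> transition w 0 a (x 0%N) /\ fiber f (theta f w) x.
Proof.
by have := fib_scons (transition w) 0 a x; rewrite !fib_transition.
Qed.

Section gibbs_point.
Context (phi : Omega * X -> R) (mu : R.-pker Omega ~> X) (lambda C : Omega -> R).
Context (lambda_gt0 : forall w, 0 < lambda w) (C_gt0 : forall w, 0 < C w).

Definition gibbs_at w : Prop := mu w (fiber f w) = 1%E /\
  forall x, fiber f w x -> forall n, (1 <= n)%N ->
    let q := ((Lambda f lambda n w)%:E * mu w (cylinder f w (mkseq x n)) *
              (expR (- birkhoff_sum f phi n (w, x)))%:E)%E in
    ((C w)^-1%:E <= q /\ q <= (C w)%:E)%E.

Definition pmass w (B : set X) : R := fine (mu w B).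

Lemma pmassE w B : measurable B -> mu w B = (pmass w B)%:E.
Proof.
move=> mB; rewrite /pmass fineK// ge0_fin_numE//.
apply: (@le_lt_trans _ _ (mu w setT)); last by rewrite prob_kernel ltry.
by apply: le_measure; rewrite ?inE.
Qed.

Lemma Lambda_gt0 n w : 0 < Lambda f lambda n w.
Proof. by apply: prodr_gt0. Qed.

Lemma LambdaS n w : Lambda f lambda n.+1 w = lambda w * Lambda f lambda n (theta f w).
Proof.
rewrite /Lambda big_ord_recl; congr (_ * _); apply: eq_bigr => i _.
by rewrite /theta_iter -iterSr.
Qed.

Lemma mu_carried w B : gibbs_at w -> measurable B -> mu w (fiber f w `&` B) = mu w B.
Proof.
move=> [car _] mB; have mF := measurable_fiber w.
have N0 : mu w (~` fiber f w) = 0%E.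
  have h : (mu w (fiber f w `|` ~` fiber f w) = mu w (fiber f w) + mu w (~` fiber f w))%E.
    by apply: measureU => //; [exact: measurableC|rewrite setICr].
  move: h; rewrite setUv prob_kernel car pmassE; last exact: measurableC.
  by rewrite -EFinD => -[] /eqP; rewrite addrC -subr_eq subrr => /eqP <-.
apply/eqP; rewrite eq_le; apply/andP; split.
  by apply: le_measure; rewrite ?inE//; exact: measurableI.
apply: (@le_trans _ _ (mu w ((fiber f w `&` B) `|` ~` fiber f w))).
  apply: le_measure; rewrite ?inE//.
    by apply: measurableU; [exact: measurableI|exact: measurableC].
  by move=> x Bx; have [|] := pselect (fiber f w x); [left|right].
apply: le_trans (measureU2 _ _ _) _; [exact: measurableI|exact: measurableC|].
by rewrite [X in (_ + X)%E]N0 adde0.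
Qed.

Lemma gibbs_real w x n : gibbs_at w -> fiber f w x -> (0 < n)%N ->
  expR (birkhoff_sum f phi n (w, x)) <=
    C w * Lambda f lambda n w * pmass w (cyl (mkseq x n)) /\
  Lambda f lambda n w * pmass w (cyl (mkseq x n)) <=
    C w * expR (birkhoff_sum f phi n (w, x)).
Proof.
move=> g fx n0; have [_ /(_ x fx n n0) /=] := g.
have mc := measurable_cyl (mkseq x n).
rewrite [mu w (cylinder _ _ _)](_ : _ = (pmass w (cyl (mkseq x n)))%:E); last first.
  by rewrite -pmassE// -(mu_carried g mc).
rewrite -!EFinM !lee_fin expRN; set S := expR _; set m := pmass _ _.
have S0 : 0 < S := expR_gt0 _.
rewrite ler_pdivlMr// ler_pdivrMr// => -[h1 h2]; split=> //.
by rewrite -mulrA -ler_pdivrMl// mulrC.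
Qed.

(** The Gibbs bounds compare the weights of the histories of [x] with the
    measures of their cylinders, which are disjoint. The constant is the one
    at the starting point of the orbit. *)
Lemma mass_le_Lambda w M n x : gibbs_at w -> fiber f (theta_iter f n w) x ->
  (forall t y, fib (transition w) t y -> (y 0%N < M t)%N) ->
  (0 < n)%N -> mass (transition w) (potential phi w) M n x <= C w * Lambda f lambda n w.
Proof.
move=> g fx hM n0; have := mass_branches (transition w) (potential phi w) M 0 n x.
rewrite add0n => ->.
have fx' : fib (transition w) (0 + n) x by rewrite fib_transition.
apply: (@le_trans _ _ (\sum_(y <- branches (transition w) M 0 n x)
   C w * Lambda f lambda n w * pmass w (cyl (mkseq y n)))).
  rewrite big_seq [leRHS]big_seq; apply: ler_sum => y.
  move=> /(mem_branches hM _ fx')[fy _]; rewrite mulr1.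
  rewrite fib_transition in fy.
  by have [h _] := gibbs_real g fy n0; rewrite -(birkhoff_bsum phi 0 n w y).
rewrite -mulr_sumr ler_piMr ?mulr_ge0 ?(ltW (Lambda_gt0 _ _)) ?(ltW (C_gt0 _))//.
have := @sum_branches_measure R (mu w) (transition w) M n x setT measurableT.
rewrite prob_kernel (eq_bigr (fun y => (pmass w (cyl (mkseq y n)))%:E)); last first.
  by move=> y _; rewrite setTI pmassE//; exact: measurable_cyl.
by rewrite sumEFin lee_fin.
Qed.

Section bounded_potential.
Context (F : R) (w : Omega) (g : gibbs_at w).
Context (phi_le : forall x, fiber f w x -> `|phi (w, x)| <= F).

Lemma letter_lower x : fiber f w x ->
  expR (- F) <= C w * lambda w * pmass w [set z | z 0%N = x 0%N].
Proof.
move=> fx; have [h _] := gibbs_real g fx (ltn0Sn 0).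
have E1 : cyl (mkseq x 1) = [set z | z 0%N = x 0%N].
  by apply/seteqP; split=> z h'; [exact: (h' 0%N isT)|move=> [|i] //= _; exact: h'].
move: h; rewrite E1 /Lambda /birkhoff_sum !big_ord1 /=; apply: le_trans.
rewrite ler_expR; have := phi_le fx; rewrite ler_norml => /andP[]//.
Qed.

(** The letters that occur in the fiber have [mu w]-measure bounded below, and
    these measures sum to at most 1: the Gibbs property makes the effective
    alphabets finite. *)
Lemma letters_count (s : seq nat) : uniq s ->
  (forall a, a \in s -> exists2 x, fiber f w x & x 0%N = a) ->
  (size s)%:R <= C w * lambda w * expR F.
Proof.
move=> us hs.
have h1 : \sum_(a <- s) pmass w [set z | z 0%N = a] <= 1.
  have := @sum_letters_measure R (mu w) 0 s setT us measurableT.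
  rewrite prob_kernel (eq_bigr (fun a => (pmass w [set z | z 0%N = a])%:E)); last first.
    by move=> a _; rewrite setTI pmassE//; exact: measurable_coord.
  by rewrite sumEFin lee_fin.
have Cl0 : 0 < C w * lambda w by rewrite mulr_gt0.
have : \sum_(a <- s) expR (- F) <= C w * lambda w.
  apply: (@le_trans _ _ (\sum_(a <- s) C w * lambda w * pmass w [set z | z 0%N = a])).
    rewrite big_seq [leRHS]big_seq; apply: ler_sum => a /hs[x fx <-].
    exact: letter_lower.
  by rewrite -mulr_sumr ler_piMr// ltW.
rewrite big_const_seq count_predT iter_addr_0 expRN -[_ *+ _]mulr_natl.
by rewrite ler_pdivrMr ?expR_gt0.
Qed.

Lemma letters_bounded : exists M, forall x, fiber f w x -> (x 0%N < M)%N.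
Proof.
apply: contrapT => hM.
have unb M : exists2 x, fiber f w x & (M <= x 0%N)%N.
  apply: contrapT => h; apply: hM; exists M => x fx; rewrite ltnNge.
  by apply/negP => hx; apply: h; exists x.
have build n : exists s : seq nat, [/\ uniq s, size s = n &
    forall a, a \in s -> exists2 x, fiber f w x & x 0%N = a].
  elim: n => [|n [s [us sn hs]]]; first by exists [::].
  have [x fx hx] := unb (\max_(a <- s) a).+1.
  exists (x 0%N :: s); split; rewrite /= ?sn//.
    rewrite us andbT; apply/negP => xs; move: hx; rewrite ltnNge => /negP; apply.
    by rewrite (big_rem (x 0%N))//= leq_maxl.
  by move=> a; rewrite inE => /orP[/eqP ->|/hs//]; exists x.
have [s [us sn hs]] := build (Num.truncn (C w * lambda w * expR F)).+1.
have := letters_count us hs; rewrite sn leNgt.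
by rewrite truncnS_gt.
Qed.

Lemma birkhoff_scons n a x : birkhoff_sum f phi n.+1 (w, scons a x) =
  phi (w, scons a x) + birkhoff_sum f phi n (theta f w, x).
Proof.
rewrite /birkhoff_sum big_ord_recl; congr (_ + _); apply: eq_bigr => i _.
by rewrite lift0 iterSr /Defs.skew /= shift_scons.
Qed.

(** Prepending [a] maps cylinders to cylinders, and the Gibbs bounds at [w]
    and at [theta f w] compare their measures up to a constant, so
    [null_domination] applies. Hence almost everywhere bounds pass through the
    transfer operator. *)
Lemma image_null a B : gibbs_at (theta f w) ->
  measurable B -> mu w B = 0%E ->
  mu (theta f w) [set x | fiber f w (scons a x) /\ B (scons a x)] = 0%E.
Proof.
move=> g' mB B0.
have mpre A : measurable A -> measurable (scons a @^-1` A).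
  by move=> mA; rewrite -[X in measurable X]setTI; exact: measurable_scons _ measurableT _ mA.
have mD := mpre _ (measurable_fiber w).
pose nu1 := branch_measure (mu (theta f w)) a mD.
suff : nu1 B = 0%E by [].
have le1 A : measurable A -> (nu1 A <= mu (theta f w) (scons a @^-1` A))%E.
  move=> mA; apply: le_measure; rewrite ?inE; [|exact: mpre|by move=> x []].
  by apply: measurableI => //; exact: mpre.
pose K := C (theta f w) * expR F * (C w * lambda w).
have K0 : 0 <= K.
  by rewrite /K !mulr_ge0 ?expR_ge0 ?(ltW (C_gt0 _)) ?(ltW (lambda_gt0 _)).
apply: (@null_domination R nu1 (mu w) K) => //.
- apply: le_lt_trans (le1 _ measurableT) _; rewrite preimage_setT.
  by rewrite [X in (X < _)%E]prob_kernel ltry.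
- by rewrite [X in (X < _)%E]prob_kernel ltry.
move=> u su; have mc := measurable_cyl u.
have [[x [fx xu]]|none] := pselect (exists x, fiber f w (scons a x) /\ cyl u (scons a x)); last first.
  rewrite [X in (X <= _)%E](_ : _ = 0%E); first by rewrite mule_ge0 ?lee_fin.
  rewrite /nu1 /= /branch_measure (_ : _ `&` _ = set0) ?measure0//.
  by apply/seteqP; split=> // y [hy uy]; apply: none; exists y.
have [_ fx'] := (fiber_scons a x w).1 fx.
pose n := (size u).-1.
have un : size u = n.+1 by rewrite /n prednK// ltnW.
have n0 : (0 < n)%N by rewrite -ltnS -un.
have ux : u = mkseq (scons a x) n.+1 by apply/esym/(cyl_mkseq _ un).
apply: le_trans (le1 _ mc) _.
apply: (@le_trans _ _ (mu (theta f w) (cyl (mkseq x n)))).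
  apply: le_measure; rewrite ?inE; [exact: mpre|exact: measurable_cyl|].
  move=> y /= uy i; rewrite size_mkseq => ilt; rewrite nth_mkseq//.
  by rewrite -[y i]/(scons a y i.+1) uy ?un// ux nth_mkseq.
rewrite !pmassE//; last exact: measurable_cyl.
rewrite -EFinM lee_fin.
have [_ up] := gibbs_real g' fx' n0.
have [low _] := gibbs_real g fx (ltn0Sn n).
move: low up; rewrite -ux birkhoff_scons LambdaS expRD.
set S := expR (birkhoff_sum _ _ _ _); set L := Lambda _ _ _ _ => low up.
have L0 : 0 < L := Lambda_gt0 _ _.
have C'0 := C_gt0 (theta f w).
have S0 : 0 < S := expR_gt0 _.
have eF : expR (- F) <= expR (phi (w, scons a x)).
  by rewrite ler_expR; have := phi_le fx; rewrite ler_norml => /andP[].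
have SF : S <= expR F * (C w * (lambda w * L) * pmass w (cyl u)).
  rewrite -ler_pdivrMl ?expR_gt0// -expRN; apply: le_trans low.
  by rewrite ler_wpM2r// ltW.
rewrite -(ler_pM2l L0); apply: (le_trans up).
apply: le_trans (ler_wpM2l (ltW C'0) SF) _.
by rewrite le_eqVlt; apply/orP; left; apply/eqP; rewrite /K; ring.
Qed.

End bounded_potential.
End gibbs_point.
End shift_orbit.

(** * Almost sure bounds and finiteness of the pressure *)

Lemma sum_le_esum {R : realType} (T : choiceType) (s : seq T) (A : set T) (h : T -> \bar R) :
  uniq s -> (forall t, t \in s -> A t) -> (\sum_(t <- s) h t <= \esum_(t in A) h t)%E.
Proof.
move=> us sA; apply: esum_ge; exists [set` s]; first by split=> //; exact: finite_seq.
by rewrite fsbig_seq.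
Qed.

Lemma family_sum_ge0 {R : realType} (T : choiceType) (A : set T) (h : T -> R) :
  (forall t, 0 <= h t) -> family_sum A h = (\esum_(t in A) (h t)%:E)%E.
Proof.
move=> h0; rewrite /family_sum [X in (_ - X)%E]esum1; last first.
  move=> t _; rewrite funenegE; apply/max_idPr.
  by rewrite /= lee_fin oppr_le0.
rewrite sube0; apply: eq_esum => t _; rewrite funeposE; apply/max_idPl.
by rewrite lee_fin.
Qed.

Lemma le_expR_lne {R : realType} (x : \bar R) : (0 <= x)%E ->
  lne x \is a fin_num -> (x <= (expR `|fine (lne x)|)%:E)%E.
Proof.
case: x => [r| |]//; rewrite lee_fin le_eqVlt => /predU1P[<-|r0] _.
  by rewrite lee_fin expR_ge0.
by rewrite lne_EFin// lee_fin -{1}(lnK r0) ler_expR ler_norm.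
Qed.

Lemma ae_forall_countable {d} {T : measurableType d} {R : realType} (P : {measure set T -> \bar R})
    (I : Type) (Q : I -> T -> Prop) : countable [set: I] ->
  (forall i, {ae P, forall w, Q i w}) -> {ae P, forall w, forall i, Q i w}.
Proof.
move=> /countable_injP[c cinj] h.
have : {ae P, forall w, forall n i, c i = n -> Q i w}.
  apply/ae_foralln => n; have [[i <-]|none] := pselect (exists i, c i = n).
    apply: filterS (h i) => w hw j /cinj ->//; by rewrite inE.
  by apply: aeW => w i ci; case: none; exists i.
by apply: filterS => w hw i; exact: hw erefl.
Qed.

Lemma ae_and {d} {T : measurableType d} {R : realType} (P : probability T R)
    (Q1 Q2 : T -> Prop) : {ae P, forall w, Q1 w} -> {ae P, forall w, Q2 w} ->
  {ae P, forall w, Q1 w /\ Q2 w}.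
Proof. by move=> h1 h2; apply: filterS2 h1 h2 => w. Qed.

Section integrability.
Context {d : measure_display} {T : measurableType d} {R : realType}.
Context (P : probability T R).

Definition absfine (h : T -> \bar R) w : R := `|fine (h w)|.

Lemma integrable_absfine h : P.-integrable setT h ->
  P.-integrable setT (EFin \o absfine h).
Proof.
move=> ih; apply: (le_integrable measurableT _ _ ih).
  apply/measurable_EFinP; apply: measurableT_comp => //.
  by apply: measurableT_comp => //; exact: measurable_int ih.
move=> w _ /=; rewrite /absfine.
by case: (h w) => [r| |] //=; rewrite ?normr_id ?normr0 ?lexx ?leey.
Qed.

Lemma ae_le_integrable (h g : T -> R) : measurable_fun setT h ->
  P.-integrable setT (EFin \o g) -> {ae P, forall w, `|h w| <= g w} ->
  P.-integrable setT (EFin \o h).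
Proof.
move=> mh ig hg; apply/integrableP; split; first exact/measurable_EFinP.
have mg : measurable_fun setT g by apply/measurable_EFinP; exact: measurable_int ig.
have iag := integrable_abse ig; move/integrableP : iag => [mag]; apply: le_lt_trans.
apply: ae_ge0_le_integral => //.
- by apply/measurable_EFinP; exact: measurableT_comp.
- by apply: measurableT_comp.
apply: filterS hg => w hw _ /=; rewrite lee_fin normr_id; apply: le_trans hw _.
exact: ler_norm.
Qed.

End integrability.

Section ae_facts.
Context {d : measure_display} {Omega : measurableType d} {R : realType}.
Context {P : probability Omega R} (f : random_shift P).
Context (phi : Omega * X -> R) (p : \bar R).
Context (mu : R.-pker Omega ~> X) (lambda C : Omega -> R).
Context (hmu : fiber_Gibbs f phi p mu lambda C).
Context (hint : P.-integrable setT
      (fun w => fiber_norm f w (fun x => (phi (w, x))%:E))).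
Context (hlog : P.-integrable setT
      (fun w => lne (fiber_norm f (theta f w) (RPF f phi w (fun=> 1))))).

Local Notation Fn := (absfine (fun w => fiber_norm f w (fun x => (phi (w, x))%:E))).
Local Notation ell := (absfine (fun w => lne (fiber_norm f (theta f w) (RPF f phi w (fun=> 1))))).

Lemma ae_fiber_neq0 : {ae P, forall w, exists x, fiber f w x}.
Proof. exact: fiber_neq0. Qed.

Lemma ae_gibbs_at : {ae P, forall w, gibbs_at f phi mu lambda C w}.
Proof.
have h1 := Gibbs_carried hmu; have h2 := Gibbs_bounds hmu.
by apply: filterS2 h1 h2 => w a b; split.
Qed.

Lemma ae_phi_le : {ae P, forall w, forall x, fiber f w x -> `|phi (w, x)| <= Fn w}.
Proof.
have := integrable_ae measurableT hint; apply: filterS => w /(_ I) hfin x fx.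
rewrite /absfine -lee_fin.
apply: (@le_trans _ _ (fiber_norm f w (fun x => (phi (w, x))%:E))).
  by apply: ereal_sup_ubound; exists x.
by rewrite -{1}(fineK hfin) lee_fin ler_norm.
Qed.

Lemma ae_step_mass : {ae P, forall w, forall x (s : seq nat), uniq s ->
  (forall a, a \in s -> fiber f w (scons a x)) -> fiber f (theta f w) x ->
  \sum_(a <- s) expR (phi (w, scons a x)) <= expR (ell w)}.
Proof.
have := integrable_ae measurableT hlog; apply: filterS => w /(_ I) hfin x s us hs fx.
set N := fiber_norm _ _ _ in hfin.
pose r1 := RPF f phi w (fun=> 1) x.
have hN1 : (`|r1| <= N)%E by apply: ereal_sup_ubound; exists x.
have hN : (r1 <= N)%E := le_trans (lee_abs _) hN1.
have N0 : (0 <= N)%E := le_trans (abse_ge0 _) hN1.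
have NE : (N <= (expR (ell w))%:E)%E by exact: le_expR_lne.
rewrite -lee_fin -sumEFin; apply: le_trans NE; apply: le_trans hN.
rewrite /r1 /RPF.
rewrite family_sum_ge0; last by move=> y; rewrite mulr1 expR_ge0.
rewrite (_ : \sum_(a <- s) (expR (phi (w, scons a x)))%:E =
    \sum_(y <- [seq scons a x | a <- s]) (expR (phi (w, y)) * 1)%:E)%E; last first.
  by rewrite big_map; apply: eq_bigr => a _; rewrite mulr1.
apply: sum_le_esum.
  by rewrite map_inj_uniq// => a b /(congr1 (fun y : X => y 0%N)).
by move=> y /mapP[a /hs fa ->]; split; rewrite ?shift_scons.
Qed.

Lemma ae_essential : {ae P, forall w, forall a, Omega_ f a w -> essential_letters f a}.
Proof.
apply/ae_foralln => a; have [ha|ha] := pselect (essential_letters f a).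
  by apply: aeW.
have : P.-negligible (Omega_ f a) by exact: contrapT.
by apply: negligibleS => w /= h; apply: contrapT => h'; apply: h.
Qed.

(** The global invariance of [mu] passes to the fibers because [theta] is
    invertible: testing it on the products of image sets [theta E] with a set
    of sequences compares two densities on every [E]. *)
Lemma ae_invariant : {ae P, forall w, forall b,
  mu (theta f w) [set z | z 0%N = b] = mu w [set z | z 1%N = b]}.
Proof.
apply/ae_foralln => b.
have [mT PT] := theta_mp f.
have mb0 := measurable_coord 0 b; have mb1 := measurable_coord 1 b.
have m0 : measurable_fun setT (fun w => mu w [set z : X | z 0%N = b]) by exact: measurable_kernel.
have m1 : measurable_fun setT (fun w => mu w [set z : X | z 1%N = b]) by exact: measurable_kernel.
have le1 w B : measurable B -> (mu w B <= 1)%E.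
  by move=> mB; rewrite -(@prob_kernel _ _ _ _ _ mu w); apply: le_measure; rewrite ?inE.
have i0 : P.-integrable setT (fun w => mu (theta f w) [set z : X | z 0%N = b]).
  apply: (le_integrable measurableT _ _ (finite_measure_integrable_cst P 1 measurableT)).
    exact: (measurable_comp_mp (theta_mp f) m0).
  by move=> w _ /=; rewrite gee0_abs// normr1 le1.
have := integral_ae_eq measurableT i0 m1.
move=> /(_ _)/wrap[].
  move=> E _ mE.
  have mE' : measurable (thetaV f @^-1` E).
    by rewrite -[X in measurable X]setTI; exact: (measurable_thetaV f).
  have := Gibbs_invariant hmu (measurableX mE' mb0).
  rewrite (_ : skew f @^-1` _ = E `*` [set z : X | z 1%N = b]); last first.
    apply/seteqP; split=> -[w z] /=; rewrite ?thetaK//.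
  have sec (A : set Omega) (V : set X) w :
      mu w (xsection (A `*` V) w) = ((fun w => mu w V) \_ A) w.
    rewrite patchE; case: ifPn => wA; first by rewrite in_xsectionX.
    by rewrite notin_xsectionX// measure0.
  rewrite (eq_integral _ _ (fun w _ => sec E _ w)).
  rewrite [in RHS](eq_integral _ _ (fun w _ => sec (thetaV f @^-1` E) _ w)).
  rewrite -integral_mkcond => ->.
  rewrite -(ge0_integral_comp (theta_mp f)); last 2 first.
  - by apply/(measurable_restrictT _ mE'); exact: measurable_funS m0.
  - by move=> w; rewrite patchE; case: ifP.
  rewrite integral_mkcond; apply: eq_integral => w _; rewrite !patchE.
  rewrite (_ : (theta f w \in _) = (w \in E))//.
  by apply/idP/idP; rewrite !inE /= thetaK.
by apply: filterS => w /(_ I).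
Qed.

Let lambda_gt0 w : 0 < lambda w := Gibbs_lambda_gt0 hmu w.
Let C_gt0 w : 0 < C w := Gibbs_C_gt0 hmu w.

Lemma ae_lambda_ge : {ae P, forall w, - ln (C w) - Fn w <= ln (lambda w)}.
Proof.
apply: filterS3 ae_fiber_neq0 ae_gibbs_at ae_phi_le => w [x fx] g hphi.
have h := letter_lower C_gt0 g hphi fx.
have m1 : pmass mu w [set z | z 0%N = x 0%N] <= 1.
  rewrite -lee_fin -pmassE; last exact: measurable_coord.
  rewrite -(@prob_kernel _ _ _ _ _ mu w); apply: le_measure; rewrite ?inE//.
  exact: measurable_coord.
have : expR (- Fn w) <= C w * lambda w.
  by apply: le_trans h _; rewrite ler_piMr// ltW// mulr_gt0.
rewrite -ler_ln ?posrE ?expR_gt0 ?mulr_gt0// expRK lnM ?posrE//; lra.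
Qed.

(** By [ae_invariant], the points with second letter [b] have the measure of
    the points with first letter [b] over [theta f w]. The Gibbs bounds for
    words of lengths 2 and 1 turn this into an upper bound of [lambda w] by
    the norm of the transfer operator on 1. *)
Lemma ae_lambda_le : {ae P, forall w,
  ln (lambda w) <= ln (C w) + ln (C (theta f w)) + ell w}.
Proof.
have mp := theta_mp f.
have H1 := ae_and ae_gibbs_at (ae_comp mp ae_gibbs_at).
have H2 := ae_and (ae_comp mp ae_fiber_neq0) (ae_and ae_invariant ae_step_mass).
have H3 := ae_phi_le.
apply: filterS3 H1 H2 H3 => w [g g'] [[x fx] [inv step]] hphi.
have [M hM] := letters_bounded lambda_gt0 C_gt0 g hphi.
pose b := x 0%N; pose s := [seq a <- iota 0 M | `[< fiber f w (scons a x) >]].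
have us : uniq s by rewrite filter_uniq// iota_uniq.
have hs a : a \in s -> fiber f w (scons a x).
  by rewrite mem_filter => /andP[/asboolP].
pose m' := pmass mu (theta f w) [set z | z 0%N = b].
have mcyl (a : nat) := measurable_cyl [:: a; b].
have cover : (mu w [set z | z 1%N = b] <= \sum_(a <- s) mu w (cyl [:: a; b]))%E.
  rewrite -(mu_carried g (measurable_coord 1 b)).
  apply: (@le_trans _ _ (mu w (\big[setU/set0]_(a <- s) cyl [:: a; b]))).
    apply: le_measure; rewrite ?inE.
    - by apply: measurableI; [exact: measurable_fiber|exact: measurable_coord].
    - by apply: bigsetU_measurable.
    move=> z [fz zb]; rewrite -bigcup_seq; exists (z 0%N) => /=; last first.
      by move=> [|[|i]].
    have fs : fiber f w (scons (z 0%N) x).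
      apply/fiber_scons; split=> //.
      have h := (fiber_scons f (z 0%N) (shift z) w).1.
      rewrite scons_shift in h; have [t _] := h fz.
      by have zb' : z 1%N = x 0%N := zb; rewrite -zb'.
    by rewrite mem_filter mem_iota /= hM// andbT; apply/asboolP.
  elim: (s) => [|a r IH]; first by rewrite !big_nil measure0.
  rewrite !big_cons; apply: le_trans (measureU2 _ _ _) _ => //.
    by apply: bigsetU_measurable.
  exact: leeD2l.
have cover' : m' <= \sum_(a <- s) pmass mu w (cyl [:: a; b]).
  rewrite -lee_fin -sumEFin -pmassE ?inv; last exact: measurable_coord.
  apply: le_trans cover _; rewrite le_eqVlt; apply/orP; left; apply/eqP.
  by apply: eq_bigr => a _; rewrite pmassE.
have low : expR (phi (theta f w, x)) <= C (theta f w) * lambda (theta f w) * m'.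
  have [h _] := gibbs_real C_gt0 g' fx (ltn0Sn 0).
  move: h; rewrite /Lambda /birkhoff_sum !big_ord1 /= (_ : cyl _ = [set z | z 0%N = b])//.
  apply/seteqP; split=> z h'; [exact: (h' 0%N isT)|move=> [|i] //= _; exact: h'].
have up a : a \in s -> lambda w * lambda (theta f w) * pmass mu w (cyl [:: a; b]) <=
    C w * (expR (phi (w, scons a x)) * expR (phi (theta f w, x))).
  move=> /hs fa; have [_ h] := gibbs_real C_gt0 g fa (ltn0Sn 1).
  move: h; rewrite LambdaS birkhoff_scons expRD.
  by rewrite /Lambda /birkhoff_sum !big_ord1.
have m'0 : 0 < C (theta f w) * lambda (theta f w) * m'.
  exact: lt_le_trans (expR_gt0 _) low.
have key : lambda w * lambda (theta f w) * m' <=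
    C w * expR (ell w) * (C (theta f w) * lambda (theta f w) * m').
  apply: (@le_trans _ _ (\sum_(a <- s) lambda w * lambda (theta f w) * pmass mu w (cyl [:: a; b]))).
    by rewrite -mulr_sumr ler_wpM2l// mulr_ge0 ?ltW.
  apply: (@le_trans _ _ (\sum_(a <- s) C w * (expR (phi (w, scons a x)) * expR (phi (theta f w, x))))).
    by rewrite big_seq [leRHS]big_seq; apply: ler_sum.
  rewrite -mulr_sumr -mulr_suml -mulrA ler_wpM2l ?(ltW (C_gt0 _))//.
  apply: ler_pM; [|exact: expR_ge0|exact: step|exact: low].
  by apply: sumr_ge0 => a _; exact: expR_ge0.
have : lambda w <= C w * C (theta f w) * expR (ell w).
  have l'm' : 0 < lambda (theta f w) * m' by rewrite -(pmulr_rgt0 _ (C_gt0 (theta f w))) mulrA.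
  rewrite -(ler_pM2r l'm'); move: key; rewrite !mulrA => key; apply: le_trans key _.
  by rewrite le_eqVlt; apply/orP; left; apply/eqP; ring.
have CC : 0 < C w * C (theta f w) by rewrite mulr_gt0.
rewrite -ler_ln ?posrE ?mulr_gt0 ?expR_gt0//.
by rewrite lnM ?posrE ?expR_gt0// lnM ?posrE// expRK.
Qed.

Let lC w : R := ln (C w).
Let il : P.-integrable setT (EFin \o lC) := Gibbs_C_integrable hmu.

Lemma integrable_norm (h : Omega -> R) : P.-integrable setT (EFin \o h) ->
  P.-integrable setT (EFin \o (fun w => `|h w|)).
Proof. by move=> /integrable_abse; apply: eq_integrable. Qed.

Lemma integrable_add (h g : Omega -> R) : P.-integrable setT (EFin \o h) ->
  P.-integrable setT (EFin \o g) -> P.-integrable setT (EFin \o (fun w => h w + g w)).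
Proof.
by move=> ih ig; have := integrableD measurableT ih ig; apply: eq_integrable.
Qed.

Lemma integrable_ln_lambda : P.-integrable setT (EFin \o (fun w => ln (lambda w))).
Proof.
have iC := integrable_norm il.
have iC' := integrable_comp (theta_mp f) iC.
have iF := integrable_absfine hint.
have iE := integrable_absfine hlog.
have iAll := integrable_add (integrable_add iC iC') (integrable_add iF iE).
apply: (ae_le_integrable _ iAll).
  by apply: measurableT_comp => //; exact: Gibbs_measurable_lambda hmu.
apply: filterS2 ae_lambda_ge ae_lambda_le => w h1 h2.
have F0 : 0 <= Fn w by exact: normr_ge0.
have E0 : 0 <= ell w by exact: normr_ge0.
have := ler_norm (lC w); have := ler_norm (- lC w); rewrite normrN.
have := ler_norm (lC (theta f w)).
have := normr_ge0 (lC (theta f w)); have := normr_ge0 (lC w).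
by rewrite ler_norml /lC /=; move=> *; apply/andP; split; lra.
Qed.

Lemma pressure_real : exists r : R, p = r%:E.
Proof.
rewrite -(Gibbs_lambda_integral hmu); exists (fine (\int[P]_w (ln (lambda w))%:E)).
by rewrite fineK//; exact: integrable_fin_num integrable_ln_lambda.
Qed.

End ae_facts.

(** * Visits and letters of typical orbits *)

Section birkhoff_consequences.
Context {d : measure_display} {Omega : measurableType d} {R : realType}.
Context (P : probability Omega R) (T : Omega -> Omega).
Context (mp : measure_preserving P T) (erg : ergodic P T).

Lemma birkhoff_upper_all (g : Omega -> R) (r : R) :
  P.-integrable setT (EFin \o g) -> (\int[P]_w (g w)%:E <= r%:E)%E ->
  {ae P, forall w, forall k : nat, exists c, forall n,
    orbit_sum T g n w <= (r + k.+1%:R^-1) * n%:R + c}.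
Proof.
move=> ig gr; apply/ae_foralln => k; apply: birkhoff_upper => //.
by apply: le_lt_trans gr _; rewrite lte_fin ltrDl invr_gt0.
Qed.

Lemma orbit_sumN (g : Omega -> R) n w :
  orbit_sum T (fun w => - g w) n w = - orbit_sum T g n w.
Proof. by rewrite /orbit_sum sumrN. Qed.

(** The value [g] at time [n] is the difference of two consecutive orbit sums,
    and these lie between linear functions of nearly equal slopes. *)
Lemma sublinear (g : Omega -> R) : P.-integrable setT (EFin \o g) ->
  {ae P, forall w, forall k : nat, exists c, forall n,
    g (iter n T w) <= k.+1%:R^-1 * n%:R + c}.
Proof.
move=> ig; pose r := fine (\int[P]_w (g w)%:E).
have rE : (\int[P]_w (g w)%:E = r%:E)%E.
  by rewrite /r fineK//; exact: integrable_fin_num ig.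
have igN : P.-integrable setT (EFin \o (fun w => - g w)).
  by have := integrableN ig; apply: eq_integrable.
have rNE : (\int[P]_w (- g w)%:E <= (- r)%:E)%E.
  rewrite EFinN -rE -integralN ?le_eqVlt ?eqxx//.
  exact: integrable_add_def.
have h1 : (\int[P]_w (g w)%:E <= r%:E)%E by rewrite rE.
apply: filterS2 (birkhoff_upper_all ig h1) (birkhoff_upper_all igN rNE) => w a1 a2 k.
have [c1 hc1] := a1 (k.+1).*2.-1; have [c2 hc2] := a2 (k.+1).*2.-1.
exists (r + k.+1%:R^-1 + c1 + c2) => n.
have := hc1 n.+1; have := hc2 n; rewrite orbit_sumN /orbit_sum big_ord_recr /=.
rewrite -doubleS -muln2 natrM invfM -[n.+1%:R]natr1.
set S := \sum_(i < n) _; set e := k.+1%:R^-1.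
have e0 : 0 <= e by rewrite invr_ge0.
have n0 : 0 <= n%:R :> R by [].
move=> u1 u2.
have : e * n%:R = (e * 2^-1) * n%:R + (e * 2^-1) * n%:R by field.
lra.
Qed.

Lemma average_bound (g : Omega -> R) : P.-integrable setT (EFin \o g) ->
  {ae P, forall w, exists A c : R, [/\ 0 <= A, 0 <= c &
    forall n, orbit_sum T g n w <= A * n%:R + c]}.
Proof.
move=> ig; pose r := fine (\int[P]_w (g w)%:E).
have rE : (\int[P]_w (g w)%:E <= r%:E)%E.
  by rewrite /r fineK//; exact: integrable_fin_num ig.
apply: filterS (birkhoff_upper_all ig rE) => w /(_ 0%N)[c hc].
exists (Num.max 0 (r + 1^-1)), (Num.max 0 c); split; rewrite ?le_max ?lexx// => n.
by apply: le_trans (hc n) _; rewrite lerD// ?ler_wpM2r// le_max lexx orbT.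
Qed.

Lemma frequency_small (D : nat -> set Omega) : (forall n, measurable (D n)) ->
  (forall m n, (m <= n)%N -> D n `<=` D m) -> P.-negligible (\bigcap_n D n) ->
  {ae P, forall w, forall k : nat, exists (M : nat) (c : R), forall n,
    orbit_sum T (\1_(D M) : Omega -> R) n w <= k.+1%:R^-1 * n%:R + c}.
Proof.
move=> mD dD D0; have mI : measurable (\bigcap_n D n) by exact: bigcapT_measurable.
have cD : P \o D @ \oo --> P (\bigcap_n D n).
  apply: nonincreasing_cvg_mu => //.
  - by apply: (@le_lt_trans _ _ 1%E); [exact: probability_le1|rewrite ltry].
  - by move=> m n mn; apply/subsetPset; exact: dD.
have PD0 : P (\bigcap_n D n) = 0%E by exact: measure_negligible.
rewrite PD0 in cD.
apply/ae_foralln => k; have e0 : 0 < k.+1%:R^-1 :> R by rewrite invr_gt0.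
have [M hM] : exists M, (P (D M) < (k.+1%:R^-1)%:E)%E.
  have : \forall N \near \oo, (P (D N) < (k.+1%:R^-1)%:E)%E.
    apply: (cD [set z | z < (k.+1%:R^-1)%:E]%E); apply: open_nbhs_nbhs.
    by split; [exact: open_ereal_lt_ereal|rewrite /= lte_fin].
  by move=> [N _ h]; exists N; apply: h => /=.
have i1 : P.-integrable setT (EFin \o (\1_(D M) : Omega -> R)) by exact: integrable_indic.
have := birkhoff_upper mp erg (g := (\1_(D M) : Omega -> R)) (a := k.+1%:R^-1) i1.
rewrite integral_indic// setIT => /(_ hM); apply: filterS => w [c hc].
by exists M, c.
Qed.

(** If the visits stopped, the orbit sums of the indicator of [D] would be
    bounded, whereas they grow linearly by [birkhoff_upper] for the opposite
    of the indicator. *)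
Lemma frequent_visits (D : set Omega) : measurable D -> P D != 0%E ->
  {ae P, forall w, forall j : nat, exists2 n, (j < n)%N & D (iter n T w)}.
Proof.
move=> mD D0; pose q := fine (P D).
have qE : P D = q%:E by rewrite /q fineK// fin_num_measure.
have q0 : 0 < q by rewrite -lte_fin -qE lt_neqAle eq_sym D0 measure_ge0.
have i1 : P.-integrable setT (EFin \o (\1_D : Omega -> R)) by exact: integrable_indic.
have i2 : P.-integrable setT (EFin \o (fun w => - (\1_D w : R))).
  by have := integrableN i1; apply: eq_integrable.
have neg : (\int[P]_w (- (\1_D w : R))%:E < (- (q / 2))%:E)%E.
  rewrite (_ : \int[P]_w (- (\1_D w : R))%:E = (- q)%:E)%E.
    by rewrite lte_fin ltrN2; lra.
  transitivity (- \int[P]_w (\1_D w)%:E)%E.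
    by rewrite -integralN//; exact: integrable_add_def.
  by rewrite integral_indic// setIT EFinN; congr (- _)%E; exact: qE.
have := birkhoff_upper mp erg i2 neg; apply: filterS => w [c hc] j.
apply: contrapT => none.
have small n : orbit_sum T (\1_D : Omega -> R) n w <= j.+1%:R.
  apply: (@le_trans _ _ (\sum_(i < n) ((i < j.+1)%N : nat)%:R)).
    apply: ler_sum => i _; have [ij|ji] := ltnP i j.+1.
      by rewrite indicE lern1 leq_b1.
    rewrite indicE memNset//= => Di; apply: none.
    by exists i.
  rewrite -natr_sum ler_nat.
  elim: n => [|n IH]; first by rewrite big_ord0.
  rewrite big_ord_recr /=; have [nj|jn] := ltnP n j.+1; last by rewrite addn0.
  apply: leq_trans nj; rewrite addn1 ltnS.
  apply: (@leq_trans (\sum_(i < n) 1)); last by rewrite sum1_card card_ord.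
  by apply: leq_sum => i _; exact: leq_b1.
pose n := (Num.truncn ((j.+1%:R + c) / (q / 2))).+1.
have nE : (j.+1%:R + c) / (q / 2) < n%:R by exact: truncnS_gt.
have := hc n; rewrite orbit_sumN; have := small n.
move: nE; rewrite ltr_pdivrMr ?divr_gt0//; set S := orbit_sum _ _ _ _; nra.
Qed.

End birkhoff_consequences.

Section ae_facts.
Context {d : measure_display} {Omega : measurableType d} {R : realType}.
Context {P : probability Omega R} (f : random_shift P).
Context (phi : Omega * X -> R) (p : \bar R).
Context (mu : R.-pker Omega ~> X) (lambda C : Omega -> R).
Context (hmu : fiber_Gibbs f phi p mu lambda C).
Context (hint : P.-integrable setT
      (fun w => fiber_norm f w (fun x => (phi (w, x))%:E))).

Let lambda_gt0 w : 0 < lambda w := Gibbs_lambda_gt0 hmu w.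
Let C_gt0 w : 0 < C w := Gibbs_C_gt0 hmu w.

(** A measurable replacement for [Omega_ f a], which is a projection; the two
    agree at base points where the Gibbs bounds hold and the potential is
    bounded. *)
Definition charged a : set Omega := [set w | (0 < mu w [set z : X | z 0%N = a])%E].

Lemma measurable_charged a : measurable (charged a).
Proof.
have := measurable_kernel mu _ (measurable_coord 0 a) => mk.
rewrite (_ : charged a = setT `&` (fun w => mu w [set z : X | z 0%N = a]) @^-1` `]0%E, +oo[%classic).
  by apply: mk => //; exact: emeasurable_itv.
by rewrite setTI; apply/seteqP; split=> w; rewrite /charged /= in_itv /= andbT.
Qed.

Lemma charged_fiber w a : gibbs_at f phi mu lambda C w -> charged a w ->
  exists2 x, fiber f w x & x 0%N = a.
Proof.
move=> g; rewrite /charged /= -(mu_carried g (measurable_coord 0 a)) => h.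
apply: contrapT => none; move: h; rewrite (_ : _ `&` _ = set0) ?measure0 ?ltxx//.
by apply/seteqP; split=> // x [fx xa]; apply: none; exists x.
Qed.

Lemma fiber_charged w x F : gibbs_at f phi mu lambda C w -> 
  (forall x, fiber f w x -> `|phi (w, x)| <= F) -> fiber f w x -> charged (x 0%N) w.
Proof.
move=> g hphi fx; have h := letter_lower C_gt0 g hphi fx.
have := lt_le_trans (expR_gt0 (- F)) h; rewrite pmulr_rgt0 ?mulr_gt0// => h'.
by rewrite /charged /= pmassE ?lte_fin//; exact: measurable_coord.
Qed.

Definition tail M : set Omega := \bigcup_(a in [set a | (M <= a)%N]) charged a.

(** As almost all alphabets are finite, the sets [tail M] decrease to a null
    set; so large letters have small frequency along typical orbits. *)
Lemma ae_rare_tail : {ae P, forall w, forall k : nat, exists (M : nat) (c : R), forall n,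
    orbit_sum (theta f) (\1_(tail M) : Omega -> R) n w <= k.+1%:R^-1 * n%:R + c}.
Proof.
apply: (frequency_small (theta_mp f) (@theta_ergodic _ _ _ _ f) (D := tail)).
- by move=> n; apply: bigcup_measurable => a _; exact: measurable_charged.
- by move=> m n mn w [a /= na ha]; exists a => //=; exact: leq_trans na.
apply: (_ : {ae P, forall w, ~ (\bigcap_n tail n) w} -> _).
  by apply: negligibleS => w /= h; apply.
apply: filterS2 (ae_gibbs_at hmu) (ae_phi_le hint) => w g hphi h.
have [M hM] := letters_bounded lambda_gt0 C_gt0 g hphi.
have [a /= Ma ha] := h M I; have [x fx xa] := charged_fiber g ha.
by have := hM x fx; rewrite xa ltnNge Ma.
Qed.

Lemma Omega_fiber a w : Omega_ f a w <-> exists2 x, fiber f w x & x 0%N = a.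
Proof.
split=> [[x [fx h]]|[x fx xa]]; first by exists x => //; exact: (h 0%N isT).
by exists x; split=> // -[|i] //= _.
Qed.

Lemma ae_return a : essential_letters f a ->
  {ae P, forall w, forall j : nat, exists2 n, (j < n)%N & Omega_ f a (theta_iter f n w)}.
Proof.
move=> ea; have D0 : P (charged a) != 0%E.
  apply/eqP => D0; apply: ea.
  have hn : P.-negligible (charged a) by apply/negligibleP => //; exact: measurable_charged.
  have hg := ae_and (ae_gibbs_at hmu) (ae_phi_le hint).
  have := negligibleU hn hg; apply: negligibleS => w /Omega_fiber[x fx xa].
  have [[g hphi]|h] := pselect (gibbs_at f phi mu lambda C w /\
     (forall x, fiber f w x -> `|phi (w, x)| <= absfine (fun w => fiber_norm f w (fun x => (phi (w, x))%:E)) w)).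
    by left; rewrite -xa; exact: (fiber_charged g hphi fx).
  by right.
have hv := frequent_visits (theta_mp f) (@theta_ergodic _ _ _ _ f) (measurable_charged a) D0.
apply: filterS2 hv (ae_orbit (theta_mp f) (ae_gibbs_at hmu)) => w hw g j.
have [n jn hn] := hw j; exists n => //; apply/Omega_fiber.
exact: charged_fiber (g n) hn.
Qed.

End ae_facts.

(** * Almost sure exponential decay *)

Lemma drift_sublinear {R : realType} (kap : nat -> R) (e c : R) : 0 <= e ->
  (forall n, kap n <= e * n%:R + c) -> 0 <= c ->
  forall n, drift kap 0 n <= e * n%:R + c.
Proof.
move=> e0 hk c0; elim=> [|n IH]; first by rewrite /= mulr0 add0r.
rewrite /= add0n -[n.+1%:R]natr1; have := hk n; lra.
Qed.

Section orbits.
Context {d : measure_display} {Omega : measurableType d} {R : realType}.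
Context {P : probability Omega R} (f : random_shift P).
Context (G : groupType) (psi : X -> G) (phi : Omega * X -> R).
Context (hG : countable [set: G]) (hpsi : depends_on_first_letter psi).
Context (hmix : ext_topologically_mixing f psi).
Context (hphi : locally_fiber_Holder f phi).
Context (hint : P.-integrable setT
      (fun w => fiber_norm f w (fun x => (phi (w, x))%:E))).
Context (hlog : P.-integrable setT
      (fun w => lne (fiber_norm f (theta f w) (RPF f phi w (fun=> 1))))).
Context (r : R) (mu : R.-pker Omega ~> X) (lambda C : Omega -> R).
Context (hmu : fiber_Gibbs f phi r%:E mu lambda C).

Local Notation Fn := (absfine (fun w => fiber_norm f w (fun x => (phi (w, x))%:E))).
Local Notation ell := (absfine (fun w => lne (fiber_norm f (theta f w) (RPF f phi w (fun=> 1))))).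

Let lambda_gt0 w : 0 < lambda w := Gibbs_lambda_gt0 hmu w.
Let C_gt0 w : 0 < C w := Gibbs_C_gt0 hmu w.

Definition mixes_at (N : nat -> nat -> G -> nat) w : Prop :=
  forall a b g, essential_letters f a -> essential_letters f b ->
  forall n, (N a b g <= n)%N -> letters f w a -> letters f (theta_iter f n w) b ->
  exists u, [/\ words f n w u, cylinder f w u `<=` cylinder f w [:: a],
     cylinder f (theta_iter f n w) [:: b] `<=` iter n shift @` cylinder f w u &
     psi_word psi u = g].

(** Letters and group elements are countably many, so a single null set serves
    for all of them. *)
Lemma ae_mixes : exists N, {ae P, forall w, mixes_at N w}.
Proof.
have /choice[N hN] (abg : nat * nat * G) : exists N : nat,
    essential_letters f abg.1.1 -> essential_letters f abg.1.2 ->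
    {ae P, forall w, forall n, (N <= n)%N ->
    letters f w abg.1.1 -> letters f (theta_iter f n w) abg.1.2 ->
    exists u, [/\ words f n w u, cylinder f w u `<=` cylinder f w [:: abg.1.1],
     cylinder f (theta_iter f n w) [:: abg.1.2] `<=` iter n shift @` cylinder f w u &
     psi_word psi u = abg.2]}.
  case: abg => [[a b] g] /=.
  have [ea|na] := pselect (essential_letters f a); last by exists 0%N.
  have [eb|nb] := pselect (essential_letters f b); last by exists 0%N.
  by have [N hN] := hmix g ea eb; exists N.
exists (fun a b g => N (a, b, g)).
have cnt : countable [set: nat * nat * G].
  rewrite -!setXTT; apply: countableX => //; exact: countableX.
have : {ae P, forall w, forall abg : nat * nat * G,
    essential_letters f abg.1.1 -> essential_letters f abg.1.2 -> forall n, (N abg <= n)%N ->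
    letters f w abg.1.1 -> letters f (theta_iter f n w) abg.1.2 ->
    exists u, [/\ words f n w u, cylinder f w u `<=` cylinder f w [:: abg.1.1],
     cylinder f (theta_iter f n w) [:: abg.1.2] `<=` iter n shift @` cylinder f w u &
     psi_word psi u = abg.2]}.
  apply: ae_forall_countable => // abg.
  have [ea|na] := pselect (essential_letters f abg.1.1); last by apply: aeW.
  have [eb|nb] := pselect (essential_letters f abg.1.2); last by apply: aeW.
  by apply: filterS (hN abg ea eb) => w h _ _.
by apply: filterS => w h a b g; exact: (h (a, b, g)).
Qed.

Lemma mix_orbit N w :
  (forall t, mixes_at N (theta_iter f t w)) ->
  (forall t a, Omega_ f a (theta_iter f t w) -> essential_letters f a) ->
  forall (Mb : nat) (K : seq G), exists N1 : nat,
  forall t c k x, k \in K -> (c < Mb)%N -> (x 0%N < Mb)%N ->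
  (exists2 z, fib (transition f w) t z & z 0%N = c) -> fib (transition f w) (t + N1) x ->
  exists z, [/\ fib (transition f w) t z, z 0%N = c, iter N1 shift z = x & psi_iter psi N1 z = k].
Proof.
move=> hm he Mb K.
exists (\max_(c < Mb) \max_(b < Mb) \max_(k <- K) N c b k) => t c k x kK cM bM.
set N1 := \max_(c < Mb) _.
have NN1 : (N c (x 0%N) k <= N1)%N.
  apply: leq_trans (leq_bigmax (Ordinal cM)).
  apply: leq_trans (leq_bigmax (Ordinal bM)) => /=.
  by rewrite (big_rem k)//= leq_maxl.
rewrite !fib_transition => -[z0 fz0 z0c] fx.
have lc : letters f (theta_iter f t w) c by have [] := fz0 0%N; rewrite z0c.
rewrite -theta_iterD in fx.
have lb : letters f (theta_iter f N1 (theta_iter f t w)) (x 0%N) by have [] := fx 0%N.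
have ec : essential_letters f c by apply: (he t); apply/Omega_fiber; exists z0.
have eb : essential_letters f (x 0%N).
  by apply: (he (t + N1)%N); apply/Omega_fiber; exists x; rewrite // -theta_iterD.
have [u [[su _] ca cb pu]] := hm t c (x 0%N) k ec eb N1 NN1 lc lb.
have [|z [fz uz] zx] := cb x; first by split=> // -[|].
exists z; split=> //; first by have [_ /(_ 0%N isT)] := ca z (conj fz uz).
rewrite -pu /psi_word su; apply: psi_iter_eq => // i ilt.
by apply: uz; rewrite su.
Qed.

Lemma holder_data : exists kap : Omega -> R, [/\ forall w, 0 <= kap w,
  P.-integrable setT (EFin \o kap) &
  {ae P, forall w, forall n x y, (0 < n)%N -> fiber f w x -> fiber f w y ->
    (forall i, (i < n)%N -> x i = y i) ->
    phi (w, x) - phi (w, y) <= kap w * 2^-1 ^+ n}].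
Proof.
have [kap [mk k1 ki kae]] := hphi; exists (fun w => (kap w)%:R); split=> //.
  apply/integrableP; split.
    apply/measurable_EFinP; apply: (measurableT_comp (f := fun n : nat => n%:R : R)) => //.
  by under eq_integral do rewrite /= ger0_norm//.
apply: filterS kae => w h n x y n0 fx fy xy.
have := h n n0; rewrite -lee_fin; apply: le_trans.
apply: (@le_trans _ _ `|phi (w, x) - phi (w, y)|%:E); first by rewrite lee_fin ler_norm.
by apply: ereal_sup_ubound; exists (x, y).
Qed.

(** The vector [Y] dominates the iterates at all points of the fiber
    simultaneously. The factor [expR (drift kap 0 n)] pays for the later
    passage from suprema over cylinders to values at single points. *)
Definition decay_at w : Prop := exists (M : nat -> nat) (kap : nat -> R),
  [/\ forall t y, fib (transition f w) t y -> (y 0%N < M t)%N,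
     forall t, 0 <= kap t,
     forall t n x y, (0 < n)%N -> fib (transition f w) t x -> fib (transition f w) t y ->
       (forall i, (i < n)%N -> x i = y i) ->
       potential f phi w t x - potential f phi w t y <= kap t * 2^-1 ^+ n &
     exists c K : R, 0 < c /\ forall u : G -> R, l2 u -> (forall g, 0 <= u g) ->
       forall n, (0 < n)%N -> exists Y : G -> R, [/\ l2 Y,
         norm2 Y <= expR (K + (r - c) * n%:R) * norm2 u &
         forall x, fib (transition f w) n x -> forall g,
           expR (drift kap 0 n) *
             transfer (transition f w) (potential f phi w) M psi u n x g <= Y g]].

Lemma small_inverse (e : R) : 0 < e -> exists k : nat, k.+1%:R^-1 <= e.
Proof.
move=> e0; exists (Num.truncn e^-1); rewrite invf_ple ?posrE//.
exact/ltW/truncnS_gt.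
Qed.

Lemma ln_Lambda n w : ln (Lambda f lambda n w) = orbit_sum (theta f) (fun w => ln (lambda w)) n w.
Proof.
elim: n => [|n IH]; first by rewrite /Lambda /orbit_sum !big_ord0 ln1.
rewrite /Lambda /orbit_sum !big_ord_recr /= lnM ?posrE//; last exact: Lambda_gt0.
by congr (_ + _).
Qed.

(** Pointwise decay relative to [mass] comes from [exponential_decay], and
    [mass] grows at most with the rate [r] by [mass_le_Lambda] and the ergodic
    theorem. To dominate a whole fiber, it suffices up to distortion to sum
    over one point [xb b] for each first letter [b]; the number of letters and
    the distortion are subexponential. *)
Lemma orbit_decay : @has_gap R G -> {ae P, forall w, decay_at w}.
Proof.
move=> gap; have mp := theta_mp f; have erg := @theta_ergodic _ _ _ _ f.
have [N aemix] := ae_mixes; have [kap [kap0 ikap aehol]] := holder_data.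
have iF := integrable_absfine hint; have iE := integrable_absfine hlog.
have ilam := integrable_ln_lambda hmu hint hlog.
have iC : P.-integrable setT (EFin \o (fun w => ln (C w))) := Gibbs_C_integrable hmu.
have icost := integrable_add (integrable_add ikap iF) iE.
have icount := integrable_add (integrable_add iC ilam) iF.
have lamr : (\int[P]_w (ln (lambda w))%:E <= r%:E)%E by rewrite (Gibbs_lambda_integral hmu).
have H1 := ae_orbit mp (ae_and (ae_gibbs_at hmu) (ae_phi_le hint)).
have H2 := ae_orbit mp (ae_and (ae_step_mass hlog) (ae_and aehol (ae_and (ae_essential f) aemix))).
have H3 := ae_and (average_bound mp erg icost) (ae_rare_tail hmu hint).
have H4 := ae_and (birkhoff_upper_all mp erg ilam lamr)
  (ae_and (sublinear mp erg icount) (sublinear mp erg ikap)).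
apply: filterS2 (ae_and H1 H2) (ae_and H3 H4) => w.
move=> [h1 h2] [[avg rare] [lamg [cntg kapg]]].
have hg t : gibbs_at f phi mu lambda C (theta_iter f t w) by case: (h1 t).
have hF t x : fiber f (theta_iter f t w) x -> `|phi (theta_iter f t w, x)| <= Fn (theta_iter f t w).
  by case: (h1 t) => _; apply.
have /choice[M hM] t : exists M, forall x, fiber f (theta_iter f t w) x -> (x 0%N < M)%N.
  exact: (letters_bounded lambda_gt0 C_gt0 (hg t) (hF t)).
pose E := transition f w; pose pot := potential f phi w.
pose kp t := kap (theta_iter f t w).
have letter_lt t y : fib E t y -> (y 0%N < M t)%N by rewrite fib_transition; exact: hM.
have kp0 t : 0 <= kp t by exact: kap0.
have hol t n x y : (0 < n)%N -> fib E t x -> fib E t y ->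
    (forall i, (i < n)%N -> x i = y i) -> pot t x - pot t y <= kp t * 2^-1 ^+ n.
  by rewrite !fib_transition; case: (h2 t) => _ [hh _]; exact: hh.
have step t x : fib E t.+1 x ->
    \sum_(a <- iota 0 (M t) | `[< fib E t (scons a x) >]) expR (pot t (scons a x))
    <= expR (ell (theta_iter f t w)).
  move=> fx; rewrite -big_filter; case: (h2 t) => st _; apply: st.
  - by rewrite filter_uniq// iota_uniq.
  - by move=> a; rewrite mem_filter => /andP[/asboolP]; rewrite fib_transition.
  - by rewrite fib_transition in fx.
have mixo := @mix_orbit N w (fun t => (h2 t).2.2.2) (fun t a => (h2 t).2.2.1 a).
have avg' : exists A c : R, [/\ 0 <= A, 0 <= c & forall n,
    \sum_(j < n) (kp j + Fn (theta_iter f j w) + ell (theta_iter f j w)) <= A * n%:R + c].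
  by have [A [c [A0 c0 h]]] := avg; exists A, c.
have rare' (eps : R) : 0 < eps -> exists (Mb : nat) (c : R), forall n,
    \sum_(j < n) ((large E Mb j)%:R : R) <= eps * n%:R + c.
  move=> /small_inverse[k hk]; have [Mb [c hc]] := rare k; exists Mb, c => n.
  apply: (@le_trans _ _ (k.+1%:R^-1 * n%:R + c)); last by rewrite lerD2r ler_wpM2r.
  apply: le_trans (hc n); apply: ler_sum => j _; rewrite indicE ler_nat.
  rewrite /large; case: asboolP => [[y]|//]; rewrite fib_transition => fy My; rewrite mem_set//.
  by exists (y 0%N) => //; exact: (fiber_charged hmu (hg j) (hF j) fy).
have pbound t y : fib E t y -> `|pot t y| <= Fn (theta_iter f t w).
  by rewrite fib_transition; exact: hF.
have [c0 [c1 [c0p decay]]] := exponential_decay hpsi letter_lt kp0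
  (fun t => normr_ge0 _) (fun t => normr_ge0 _) hol pbound step mixo avg' rare' gap.
have [k hk] : exists k : nat, k.+1%:R^-1 <= c0 / 8 by apply: small_inverse; rewrite divr_gt0.
set e := k.+1%:R^-1 in hk; have e0 : 0 <= e by rewrite invr_ge0.
have [c2 hc2] := lamg k; have [c3 hc3] := cntg k; have [c4 hc4] := kapg k.
pose c4' := Num.max c4 0.
have hdrift n : drift kp 0 n <= e * n%:R + c4'.
  apply: drift_sublinear => //; last by rewrite le_max lexx orbT.
  by move=> m; apply: le_trans (hc4 m) _; rewrite lerD2l le_max lexx.
exists M, kp; split=> //.
exists (c0 / 2), (c3 + 2 * c4' + c1 + ln (C w) + c2); split; first by rewrite divr_gt0.
move=> u u2 u0 n n0.
pose Q b x := fib E n x /\ x 0%N = b.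
have /choice[xb hxb] b : exists x : X, (exists x', Q b x') -> Q b x.
  by have [[x hx]|none] := pselect (exists x', Q b x'); [exists x|exists (fun=> 0%N)].
pose s := [seq b <- iota 0 (M n) | `[< exists x, Q b x >]].
have sQ b : b \in s -> Q b (xb b).
  by rewrite mem_filter => /andP[/asboolP hb _]; exact: hxb.
pose V := transfer E pot M psi u n.
pose D := drift kp 0 n.
have D0 : 0 <= D by exact: drift_ge0.
have V0 x g : 0 <= V x g by exact: transfer_ge0.
have V2 x : l2 (V x) by have [] := transfer_l2 psi E pot M u2 n x.
exists (fun g => \sum_(b <- s) expR (2 * D) * V (xb b) g).
have normV b : b \in s -> norm2 (V (xb b)) <=
    expR (c1 - c0 * n%:R + (ln (C w) + ((r + e) * n%:R + c2))) * norm2 u.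
  move=> /sQ[fx _]; apply: le_trans (decay u u2 u0 n _ fx) _.
  rewrite [X in _ <= X * _]expRD -mulrA ler_wpM2l ?expR_ge0// ler_wpM2r ?norm2_ge0//.
  rewrite fib_transition in fx.
  apply: le_trans (mass_le_Lambda lambda_gt0 C_gt0 (hg 0%N) fx letter_lt n0) _.
  rewrite expRD lnK ?posrE// ler_wpM2l ?(ltW (C_gt0 _))//.
  rewrite -[leLHS]lnK ?posrE ?Lambda_gt0// ler_expR ln_Lambda.
  exact: hc2.
have [Y2 Yn] : l2 (fun g => \sum_(b <- s) expR (2 * D) * V (xb b) g) /\
    norm2 (fun g => \sum_(b <- s) expR (2 * D) * V (xb b) g) <=
    \sum_(b <- s) expR (2 * D) * norm2 (V (xb b)).
  by apply: norm2_sum => b; split; [exact: l2Z|rewrite norm2Z ?expR_ge0].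
split=> //.
- apply: (le_trans Yn).
  apply: (@le_trans _ _ (\sum_(b <- s) expR (2 * D) *
      (expR (c1 - c0 * n%:R + (ln (C w) + ((r + e) * n%:R + c2))) * norm2 u))).
    by rewrite big_seq [leRHS]big_seq; apply: ler_sum => b /normV h; rewrite ler_wpM2l ?expR_ge0.
  rewrite big_const_seq count_predT iter_addr_0 -[_ *+ _]mulr_natl !mulrA.
  rewrite ler_wpM2r ?norm2_ge0// -mulrA -expRD.
  have sz : (size s)%:R <= expR (e * n%:R + c3).
    have us : uniq s by rewrite filter_uniq// iota_uniq.
    have := letters_count lambda_gt0 C_gt0 (hg n) (hF n) us.
    move=> /(_ _)/wrap[].
      by move=> b /sQ[fx xb0]; rewrite fib_transition in fx; exists (xb b).
    move=> h; apply: (le_trans h).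
    rewrite -[C _]lnK ?posrE// -[lambda _]lnK ?posrE// -!expRD ler_expR.
    exact: hc3.
  apply: le_trans (ler_wpM2r (expR_ge0 _) sz) _.
  rewrite -expRD ler_expR.
  have := hdrift n; rewrite -/D => hD.
  have n1 : 0 <= n%:R :> R by [].
  have := ler_wpM2r n1 hk; lra.
- move=> x fx g; have fx' : fiber f (theta_iter f n w) x by rewrite -fib_transition.
  have bs : x 0%N \in s.
    by rewrite mem_filter mem_iota /= hM// andbT; apply/asboolP; exists x.
  have [fb xb0] := sQ _ bs.
  apply: (@le_trans _ _ (expR (2 * D) * V (xb (x 0%N)) g)); last first.
    rewrite (big_rem (x 0%N))//= lerDl sumr_ge0// => b _.
    by rewrite mulr_ge0 ?expR_ge0.
  have agree i : (i < 1)%N -> x i = xb (x 0%N) i by case: i.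
  have h : V x g <= expR (drift kp 0 n * 2^-1 ^+ 1) * V (xb (x 0%N)) g.
    exact: transfer_distortion.
  rewrite expr1 in h; apply: le_trans (ler_wpM2l (expR_ge0 _) h) _.
  rewrite mulrA -expRD ler_wpM2r// ler_expR -/D; lra.
Qed.

End orbits.

(** * Operator norms *)

Lemma family_sum_seq {R : realType} (T : choiceType) (S : set T) (l : seq T) (h : T -> R) :
  uniq l -> S = [set` l] -> family_sum S h = (\sum_(t <- l) h t)%:E.
Proof.
move=> ul ->; rewrite /family_sum !esum_fset//.
rewrite -!fsbig_seq//.
rewrite (eq_bigr (fun t => (Num.max (h t) 0)%:E)); last first.
  by move=> t _; rewrite funeposE /= EFin_max.
rewrite [X in (_ - X)%E](eq_bigr (fun t => (Num.max (- h t) 0)%:E)); last first.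
  by move=> t _; rewrite funenegE /= EFin_max.
rewrite !sumEFin -EFinB -sumrB; congr EFin; apply: eq_bigr => t _.
by case: (leP (h t) 0) => ht; case: (leP (- h t) 0) => hNt; lra.
Qed.

Lemma limn_esup_le {R : realType} (u : (\bar R)^nat) (b : \bar R) N :
  (forall n, (N <= n)%N -> (u n <= b)%E) -> (limn_esup u <= b)%E.
Proof.
move=> h; apply: (@le_trans _ _ (ereal_sup (u @` [set n | (N <= n)%N]))).
  by apply: ereal_inf_lbound; exists [set n | (N <= n)%N] => //; exists N.
by apply: ge_ereal_sup => _ [n /= Nn <-]; exact: h.
Qed.

Lemma sum_sub_seq {R : realType} (T : eqType) (s l : seq T) (F : T -> R) :
  uniq s -> {subset s <= l} -> (forall t, 0 <= F t) ->
  \sum_(t <- s) F t <= \sum_(t <- l) F t.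
Proof.
move=> us sl F0; elim: s l us sl => [|a s IH] l; first by rewrite big_nil sumr_ge0.
move=> /= /andP[nas us] sl; have al : a \in l by apply: sl; rewrite mem_head.
rewrite big_cons (big_rem a al) /= lerD2l; apply: IH => // t ts.
by apply: rem_mem; [apply: contraNneq nas => <-|apply: sl; rewrite inE ts orbT].
Qed.

Lemma eventually_small {R : realType} (K c : R) : 0 < c ->
  exists2 N, (0 < N)%N & forall n, (N <= n)%N -> K <= c * n%:R.
Proof.
move=> c0; exists (Num.truncn (K / c)).+1 => // n Nn.
rewrite mulrC -ler_pdivrMr//; apply: (@le_trans _ _ (Num.truncn (K / c)).+1%:R).
  exact/ltW/truncnS_gt.
by rewrite ler_nat.
Qed.

Section conclusion.
Context {d : measure_display} {Omega : measurableType d} {R : realType}.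
Context {P : probability Omega R} (f : random_shift P).
Context (G : groupType) (psi : X -> G) (phi : Omega * X -> R).
Context (hG : countable [set: G]) (hpsi : depends_on_first_letter psi).
Context (r : R) (mu : R.-pker Omega ~> X) (lambda C : Omega -> R).
Context (lambda_gt0 : forall w, 0 < lambda w) (C_gt0 : forall w, 0 < C w).

Lemma ext_RPF_le w M (v : X -> G -> R) (W : X -> G -> R) x g :
  (forall a, fiber f w (scons a x) -> (a < M)%N) ->
  (forall a, fiber f w (scons a x) -> forall g, `|v (scons a x) g| <= W (scons a x) g) ->
  `|ext_RPF f psi phi w v x g| <=
  \sum_(a <- iota 0 M | `[< fiber f w (scons a x) >])
    expR (phi (w, scons a x)) * W (scons a x) (g * (psi (scons a x))^-1)%g.
Proof.
move=> hM hv; rewrite /ext_RPF.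
set s := [seq a <- iota 0 M | `[< fiber f w (scons a x) >]].
have us : uniq [seq scons a x | a <- s].
  rewrite map_inj_uniq ?filter_uniq ?iota_uniq// => a b /(congr1 (fun y : X => y 0%N)).
  by [].
rewrite (family_sum_seq _ us); last first.
  apply/seteqP; split=> [y [fy yx]|y] /=.
    have yE : scons (y 0%N) x = y by rewrite -yx scons_shift.
    apply/mapP; exists (y 0%N) => //.
    by rewrite mem_filter mem_iota /= hM yE// andbT; apply/asboolP; rewrite ?yE.
  move=> /mapP[a]; rewrite mem_filter => /andP[/asboolP fa _] ->.
  by split=> //; rewrite shift_scons.
rewrite big_map /= -[leRHS]big_filter -/s; apply: le_trans (ler_norm_sum _ _ _) _.
rewrite big_seq [leRHS]big_seq; apply: ler_sum => a.
rewrite mem_filter => /andP[/asboolP fa _].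
by rewrite normrM ger0_norm ?expR_ge0// ler_wpM2l ?expR_ge0// hv.
Qed.

Section point.
Context (w : Omega) (hg : forall t, gibbs_at f phi mu lambda C (theta_iter f t w)).
Context (F : nat -> R).
Context (hF : forall t x, fiber f (theta_iter f t w) x -> `|phi (theta_iter f t w, x)| <= F t).
Context (M : nat -> nat).
Context (hM : forall t y, fib (transition f w) t y -> (y 0%N < M t)%N).

Local Notation V := (transfer (transition f w) (potential f phi w) M psi).

(** The vectors of the space H are bounded almost everywhere only; the
    exceptional null sets are carried along the iteration by [image_null]. *)
Lemma ext_RPF_iter_le (v : X -> G -> R) (U : G -> R) n :
  {ae mu w, forall x, forall g, `|v x g| <= U g} ->
  {ae mu (theta_iter f n w), forall x, fiber f (theta_iter f n w) x ->
    forall g, `|ext_RPF_iter f psi phi n w v x g| <= V U n x g}.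
Proof.
move=> h0; elim: n => [|n IH]; first by apply: filterS h0 => x h _ g; exact: h.
have [B [mB B0 sub]] := IH.
have scons_preimage a A : measurable A -> measurable (scons a @^-1` A : set X).
  by move=> mA; rewrite -[X in measurable X]setTI; exact: measurable_scons _ measurableT _ mA.
pose N a := [set x | fiber f (theta_iter f n w) (scons a x) /\ B (scons a x)].
have mN a : measurable (N a).
  by apply: (@scons_preimage a (fiber f (theta_iter f n w) `&` B)); apply: measurableI => //; exact: measurable_fiber.
exists (\bigcup_a N a); split.
- exact: bigcupT_measurable.
- apply: measure_negligible; first exact: bigcupT_measurable.
  apply: negligible_bigcup => a; apply/negligibleP; first exact: mN.
  exact: (image_null lambda_gt0 C_gt0 (hg n) (hF (t := n)) a (hg n.+1) mB B0).
move=> x /= nx; apply: contrapT => nN; apply: nx => fx g.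
have fE a : fib (transition f w) n (scons a x) = fiber f (theta_iter f n w) (scons a x).
  by rewrite fib_transition.
apply: (le_trans (@ext_RPF_le _ (M n) _ (V U n) x g _ _)).
- by move=> a fa; have := hM (y := scons a x); apply; rewrite fE.
- move=> a fa g'; apply: contrapT => h; apply: nN; exists a => //; split=> //.
  by apply: sub => /= h'; apply: h; apply: h'.
rewrite le_eqVlt; apply/orP; left; apply/eqP.
by apply: eq_bigl => a; rewrite fE.
Qed.

Lemma mu_total t : (0 < mu (theta_iter f t w) setT)%E.
Proof. by rewrite prob_kernel. Qed.

Lemma ae_on_fiber t : {ae mu (theta_iter f t w), forall x, fiber f (theta_iter f t w) x}.
Proof.
have mF := measurable_fiber f (theta_iter f t w).
exists (~` fiber f (theta_iter f t w)); split=> //; first exact: measurableC.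
rewrite -(mu_carried (hg t)); last exact: measurableC.
by rewrite setICr measure0.
Qed.

Lemma ess_bound_ge0 t (v : X -> G -> R) g :
  (0 <= ess_sup (mu (theta_iter f t w)) (fun x => `|v x g|%:E))%E.
Proof.
apply: ess_sup_gee; first exact: mu_total.
by apply: aeW => x; rewrite lee_fin.
Qed.

(** The vector [U] consists of the essential suprema in the definition of the
    norm; as [G] is countable, it dominates [v] outside a single null set. *)
Lemma H_unit_ball (v : X -> G -> R) : (H_norm mu w v <= 1)%E ->
  exists U : G -> R, [/\ l2 U, norm2 U <= 1, forall g, 0 <= U g &
    {ae mu w, forall x, forall g, `|v x g| <= U g}].
Proof.
set e := fun g : G => ess_sup (mu w) (fun x => `|v x g|%:E).
have e0 g : (0 <= e g)%E by exact: (ess_bound_ge0 0).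
move=> h1; have h : (\esum_(g in [set: G]) (e g ^+ 2) <= 1)%E.
  by rewrite -lee_sqrt ?lee_fin//= sqrtr1.
have e1 g : (e g <= 1)%E.
  rewrite -lee_sqr// -EFin_expe expr1n; apply: le_trans h.
  by apply: esum_ge; exists [set g]; [split=> //; exact: finite_set1|rewrite fsbig_set1].
have eE g : e g = (fine (e g))%:E.
  by rewrite fineK// ge0_fin_numE// (le_lt_trans (e1 g))// ltry.
have [U2 U1] : l2 (fun g => fine (e g)) /\ norm2 (fun g => fine (e g)) <= 1.
  apply: normsq_le => //; rewrite expr1n; apply: le_trans h.
  by apply: le_esum => g _; rewrite EFin_expe -eE.
exists (fun g => fine (e g)); split=> //; first by move=> g; rewrite fine_ge0.
apply: (ae_forall_countable (P := mu w) (Q := fun g x => `|v x g| <= fine (e g)) hG) => g.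
apply: filterS (ess_sup_ge (mu w) (fun x => `|v x g|%:E)) => x hx.
by rewrite -lee_fin -eE.
Qed.

Lemma H_norm_bound (v : X -> G -> R) n (K : R) :
  (forall u : G -> R, l2 u -> (forall g, 0 <= u g) -> exists Y : G -> R, [/\ l2 Y,
     norm2 Y <= K * norm2 u & forall x, fib (transition f w) n x -> forall g, V u n x g <= Y g]) ->
  0 <= K -> (H_norm mu w v <= 1)%E ->
  (H_norm mu (theta_iter f n w) (ext_RPF_iter f psi phi n w v) <= K%:E)%E.
Proof.
move=> hV K0 /H_unit_ball[U [U2 U1 U0 hv]].
have [Y [Y2 YK hY]] := hV U U2 U0.
apply: (@le_trans _ _ (norm2 Y)%:E); last first.
  by rewrite lee_fin (le_trans YK)// ler_piMr.
rewrite -norm2_sqrt_esum// lee_sqrt ?esum_ge0// => [|g _]; last by rewrite lee_fin sqr_ge0.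
apply: le_esum => g _; set e := ess_sup _ _.
have e0 : (0 <= e)%E by exact: ess_bound_ge0.
have eY : (e <= (Y g)%:E)%E.
  apply/ess_supP; apply: filterS2 (ae_on_fiber n) (ext_RPF_iter_le n hv) => x fx hx.
  rewrite lee_fin; apply: le_trans (hx fx g) _; apply: hY.
  by rewrite fib_transition.
by rewrite EFin_expe lee_sqr// (le_trans e0 eY).
Qed.

End point.

(** The two cases are those of a supremum of norms over an empty or nonempty
    set. *)
Lemma le_root (x : \bar R) (K s : R) n : (0 < n)%N -> x = -oo%E \/ (0 <= x)%E ->
  (x <= (expR (K + s * n%:R))%:E)%E -> (poweR x n%:R^-1 <= (expR (K / n%:R + s))%:E)%E.
Proof.
move=> n0 x0 hx; have n1 : (0 : R) < n%:R by rewrite ltr0n.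
have E1 : expR (K / n%:R + s) = powR (expR (K + s * n%:R)) n%:R^-1.
  by rewrite -expRM mulrDl mulfK// gt_eqF.
rewrite E1; case: x0 => [->|x0].
  by rewrite /poweR invr_eq0 gt_eqF// lee_fin powR_ge0.
rewrite -poweR_EFin; apply: gt0_ler_poweR => //.
- by rewrite in_itv /= x0 leey.
- by rewrite in_itv /= lee_fin expR_ge0 leey.
Qed.

Lemma lne_le (x : \bar R) (s : R) : (x <= (expR s)%:E)%E -> (lne x <= s%:E)%E.
Proof.
case: x => [x| |]; [|by []|by move=> _; exact: leNye].
rewrite lee_fin => h; have [x0|x0] := leP x 0; first by rewrite le0_lneNy ?lee_fin ?leNye.
by rewrite lne_EFin// lee_fin -[leRHS]expRK ler_ln ?posrE ?expR_gt0.
Qed.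

End conclusion.

(** * Closed words with trivial group value *)

Lemma esum_le_seq {R : realType} (T : choiceType) (A : set T) (h : T -> \bar R) b :
  (forall s : seq T, uniq s -> (forall t, t \in s -> A t) -> (\sum_(t <- s) h t <= b)%E) ->
  (\esum_(t in A) h t <= b)%E.
Proof.
move=> hs; apply: ge_ereal_sup => _ [B [finB BA] <-]; rewrite fsbig_finite//=.
apply: hs; first exact: finmap.fset_uniq.
by move=> t; rewrite in_fset_set// inE => /BA.
Qed.

Section words.
Context {d : measure_display} {Omega : measurableType d} {R : realType}.
Context {P : probability Omega R} (f : random_shift P).
Context (G : groupType) (psi : X -> G) (phi : Omega * X -> R).
Context (hpsi : depends_on_first_letter psi).

Lemma fib_word w a b n u x : (0 < n)%N -> words_between f n a b w u ->
  fib (transition f w) n x -> x 0%N = b -> fib (transition f w) 0 (splice n (nth 0%N u) x).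
Proof.
move=> n0 [[un [ul ua]] [uh [_ lb]]] fx xb i; rewrite add0n /splice.
case: (ltngtP i.+1 n) => [im|im|im].
- by split; [apply: ul|apply: ua]; rewrite un// ltnW.
- by rewrite subSn//; have := fx (i - n)%N; rewrite subnKC.
rewrite -im subnn xb; split; first by apply: ul; rewrite un -im.
move: un uh (lb 0%N isT); rewrite -im /=; case: (u) => [//|c s] [sz] _ /=.
by rewrite -sz nth_last.
Qed.

Context (w : Omega) (M : nat -> nat) (kap : nat -> R).
Context (hM : forall t y, fib (transition f w) t y -> (y 0%N < M t)%N).
Context (holder : forall t n x y, (0 < n)%N -> fib (transition f w) t x ->
  fib (transition f w) t y -> (forall i, (i < n)%N -> x i = y i) ->
  potential f phi w t x - potential f phi w t y <= kap t * 2^-1 ^+ n).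

Local Notation V := (transfer (transition f w) (potential f phi w) M psi).

(** Appending [x] embeds the words into the histories of [x] with trivial
    group value, whose total weight is the value at the identity of the
    transfer operator on the indicator of the identity. *)
Lemma closed_words_le a n x : (0 < n)%N -> fib (transition f w) n x -> x 0%N = a ->
  (partition_sum f phi w (words_between f n a a w `&` [set u | psi_word psi u = 1%g]) <=
   (expR (drift kap 0 n) * V (fun g => (g == 1%g)%:R) n x 1%g)%:E)%E.
Proof.
move=> n0 fx xa; set W := _ `&` _.
pose y u : X := splice n (nth 0%N u) x.
pose D := drift kap 0 n.
pose F (z : X) : R := expR D * (expR (bsum (potential f phi w) 0 n z) *
   (1 * (psi_iter psi n z)^-1 == 1)%g%:R).
have F0 z : 0 <= F z by rewrite !mulr_ge0 ?expR_ge0.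
have yE u i : (i < n)%N -> y u i = nth 0%N u i by rewrite /y /splice => ->.
have fy u : W u -> fib (transition f w) 0 (y u).
  by move=> [hu _]; exact: fib_word hu fx xa.
have wF u : W u -> (expeR (ereal_sup [set (birkhoff_sum f phi (size u) (w, z))%:E
    | z in cylinder f w u]) <= (F (y u))%:E)%E.
  move=> Wu; have [[[un _] _] pu] := Wu.
  rewrite /F mul1g (_ : psi_iter psi n (y u) = 1%g); last first.
    by rewrite -pu /psi_word un; apply: psi_iter_eq => // i; exact: yE.
  rewrite invg1 eqxx mulr1 -expRD -[X in (_ <= X)%E]/(expeR (D + bsum _ 0 n (y u))%:E) lee_expeR.
  apply: ge_ereal_sup => _ [z [fz zu] <-]; rewrite lee_fin un.
  rewrite (birkhoff_bsum f phi 0 n w z) -lerBlDr.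
  apply: (bsum_distortion0 (E := transition f w) (pot := potential f phi w) (kap := kap)) => //.
    exact: fy.
  by move=> i ilt; rewrite yE// zu// un.
rewrite /partition_sum; apply: esum_le_seq => s us sW; rewrite big_seq.
apply: (@le_trans _ _ ((\sum_(u <- s) F (y u))%:E)).
  by rewrite -sumEFin [leRHS]big_seq; apply: lee_sum => u /sW; exact: wF.
rewrite lee_fin -[n in V _ n]add0n transfer_branches mulr_sumr.
rewrite -(big_map y xpredT F); apply: sum_sub_seq => //.
- rewrite map_inj_in_uniq// => u v /sW[[[un _] _] _] /sW[[[vn _] _] _] uv.
  by apply: (@eq_from_nth _ 0%N); rewrite ?un ?vn// => i ilt; rewrite -!yE// uv.
- move=> _ /mapP[u /sW Wu ->].
  apply/(mem_branches hM); first by rewrite add0n.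
  by split; [exact: fy|rewrite /y iter_shift_splice0].
Qed.

End words.

Section return_times.
Context {d : measure_display} {Omega : measurableType d} {R : realType}.
Context {P : probability Omega R} (f : random_shift P) (a : nat) (w : Omega).
Context (hr : forall j, exists2 n, (j < n)%N & Omega_ f a (theta_iter f n w)).

Lemma nat_minP (A : set nat) n : A n -> A (nat_min A).
Proof.
move=> An; rewrite /nat_min; case: xgetP => [m _ []//|].
have ex : exists m, `[< A m >] by exists n; apply/asboolP.
move=> /(_ (ex_minn ex)); case: ex_minnP => m /asboolP Am mmin; case; split=> // k Ak.
by apply: mmin; apply/asboolP.
Qed.

Lemma return_timeS k : (return_time f a w k < return_time f a w k.+1)%N /\
  Omega_ f a (theta_iter f (return_time f a w k.+1) w).
Proof.
have [n kn hn] := hr (return_time f a w k).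
by apply: (nat_minP (A := [set n | (_ < n)%N /\ Omega_ f a (theta_iter f n w)])) (conj kn hn).
Qed.

Lemma return_time_ge k : (k <= return_time f a w k)%N.
Proof. by elim: k => [//|k IH]; have [h _] := return_timeS k; exact: leq_ltn_trans IH h. Qed.

End return_times.

(** * Spectral radius and pressure of the extension *)

Section conclusion.
Context {d : measure_display} {Omega : measurableType d} {R : realType}.
Context {P : probability Omega R} (f : random_shift P).
Context (G : groupType) (psi : X -> G) (phi : Omega * X -> R).
Context (hG : countable [set: G]) (hpsi : depends_on_first_letter psi).
Context (hmix : ext_topologically_mixing f psi).
Context (hphi : locally_fiber_Holder f phi).
Context (hint : P.-integrable setT
      (fun w => fiber_norm f w (fun x => (phi (w, x))%:E))).
Context (hlog : P.-integrable setT
      (fun w => lne (fiber_norm f (theta f w) (RPF f phi w (fun=> 1))))).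
Context (r : R) (mu : R.-pker Omega ~> X) (lambda C : Omega -> R).
Context (hmu : fiber_Gibbs f phi r%:E mu lambda C).
Context (gap : @has_gap R G).

Lemma spectral_radius_lt : {ae P, forall w, (lne (spr f psi mu phi w) < r%:E)%E}.
Proof.
apply: filterS2 (orbit_decay hG hpsi hmix hphi hint hlog hmu gap)
  (ae_orbit (theta_mp f) (ae_and (ae_gibbs_at hmu) (ae_phi_le hint))) => w.
move=> [M [kap [hM kap0 _ [c [K [c0 hd]]]]]] hw.
have c20 : 0 < c / 2 by rewrite divr_gt0.
have [N N0 hN] := eventually_small K c20.
apply: (@le_lt_trans _ _ (r - c / 2)%:E); last by rewrite lte_fin ltrBlDr ltrDl.
apply: lne_le; apply: (@limn_esup_le _ _ _ N) => n Nn.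
have n0 : (0 < n)%N by exact: leq_trans Nn.
have n1 : (0 : R) < n%:R by rewrite ltr0n.
apply: (@le_trans _ _ (expR (K / n%:R + (r - c)))%:E); last first.
  rewrite lee_fin ler_expR; have : K / n%:R <= c / 2 by rewrite ler_pdivrMr// hN.
  lra.
apply: le_root => //; rewrite /ext_RPF_norm.
  have [->|/set0P[v hv]] := eqVneq [set v : X -> G -> R | H_space f mu w v /\ (H_norm mu w v <= 1)%E] set0.
    by left; rewrite image_set0 ereal_sup0.
  right; apply: (@le_trans _ _ (H_norm mu (theta_iter f n w) (ext_RPF_iter f psi phi n w v))).
    exact: sqrte_ge0.
  by apply: ereal_sup_ubound; exists v.
apply: ge_ereal_sup => _ [v [_ v1] <-].
have [lam0 C0] := (Gibbs_lambda_gt0 hmu, Gibbs_C_gt0 hmu).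
apply: (H_norm_bound hG lam0 C0 (fun t => (hw t).1)
  (F := fun t => absfine (fun w => fiber_norm f w (fun x => (phi (w, x))%:E)) (theta_iter f t w))
  (fun t x fx => (hw t).2 x fx) hM) => // u u2 u0.
have [Y [Y2 Yn hY]] := hd u u2 u0 n n0; exists Y; split=> // x fx g.
apply: le_trans (hY x fx g); rewrite ler_peMl ?transfer_ge0//.
by rewrite -expR0 ler_expR drift_ge0.
Qed.

(** The decay for the indicator of the identity bounds the partition functions
    of closed words. It is applied at a typical base point and to a first
    letter of its fiber, which is essential almost surely. *)
Lemma ext_pressure_lt q : is_ext_pressure f psi phi q -> (q < r%:E)%E.
Proof.
move=> hq; pose good a w := essential_letters f a ->
  (forall j, exists2 n, (j < n)%N & Omega_ f a (theta_iter f n w)) /\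
  (Omega_ f a w ->
    (fun j => ((return_time f a w j)%:R^-1)%:E * lne (partition_sum f phi w
      (words_between f (return_time f a w j) a a w `&` [set u | psi_word psi u = 1%g])))%E
      @ \oo --> q).
have hgood : {ae P, forall w, forall a, good a w}.
  apply/ae_foralln => a; have [ea|na] := pselect (essential_letters f a); last first.
    by apply: aeW => w /na.
  by apply: filterS2 (ae_return hmu hint ea) (hq a ea) => w h1 h2 _; split.
have P1 : (0 < P setT)%E by rewrite probability_setT.
have PF := ae_properfilter_algebraOfSetsType P1.
have [w [[hd hw] [[x fx] ess]]] := filter_ex (ae_and
  (ae_and (orbit_decay hG hpsi hmix hphi hint hlog hmu gap) hgood)
  (ae_and (ae_fiber_neq0 f) (ae_essential f))).
pose a := x 0%N; have aw : Omega_ f a w by apply/Omega_fiber; exists x.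
have [ret cvg] := hw a (ess a aw).
have {}cvg := cvg aw.
have [M [kap [hM kap0 hol [c [K [c0 dec]]]]]] := hd.
have c20 : 0 < c / 2 by rewrite divr_gt0.
have [N N0 hN] := eventually_small K c20.
apply: (@le_lt_trans _ _ (r - c / 2)%:E); last by rewrite lte_fin ltrBlDr ltrDl.
rewrite -(cvg_lim _ cvg)//; apply: lime_le; first by apply/cvg_ex; exists q.
exists N => // -[|k] Nk; first by move: N0; rewrite ltnNge Nk.
have [_ hk] := return_timeS ret k.
have := leq_trans Nk (return_time_ge ret k.+1).
move: hk; set n := return_time f a w k.+1 => /Omega_fiber[y fy ya] Nn.
have n0 : (0 < n)%N by exact: leq_trans Nn.
have n1 : (0 : R) < n%:R by rewrite ltr0n.
have fy' : fib (transition f w) n y by rewrite fib_transition.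
have [delta2 delta1] := norm2_delta (R := R) (1%g : G).
have [Y [Y2 Yn hY]] := dec _ delta2 (fun g => ler0n R _) n n0.
have bound : (lne (partition_sum f phi w (words_between f n a a w `&`
    [set u | psi_word psi u = 1%g])) <= (K + (r - c) * n%:R)%:E)%E.
  have h := closed_words_le hpsi hM hol n0 fy' ya.
  apply: lne_le. apply: (le_trans h).
  rewrite lee_fin.
  apply: le_trans (hY y fy' 1%g) _.
  apply: le_trans (ler_norm _) _.
  apply: le_trans (norm2_ge_pt _ Y2) _.
  by apply: (le_trans Yn); rewrite ler_piMr ?expR_ge0.
apply: (@le_trans _ _ ((n%:R^-1)%:E * (K + (r - c) * n%:R)%:E)%E).
  by apply: lee_wpmul2l => //; rewrite lee_fin invr_ge0 ltW.
rewrite -EFinM lee_fin ler_pdivrMl//; have := hN n Nn; lra.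
Qed.

End conclusion.

Theorem theorem1p8 (R : realType) (d : measure_display)
    (Omega : measurableType d) (P : probability Omega R)
    (f : random_shift P) (G : groupType) (psi : seq_space -> G)
    (phi : Omega * seq_space -> R)
    (hG : countable [set: G])
    (hpsi : depends_on_first_letter psi)
    (hBIP : relative_BIP f)
    (hmix : ext_topologically_mixing f psi)
    (hphi : locally_fiber_Holder f phi)
    (hint : P.-integrable setT
      (fun w => fiber_norm f w (fun x => (phi (w, x))%:E)))
    (hlog : P.-integrable setT
      (fun w => lne (fiber_norm f (theta f w) (RPF f phi w (fun=> 1)))))
    (p : \bar R) (hp : is_pressure f phi p)
    (mu : R.-pker Omega ~> seq_space) (lambda C : Omega -> R)
    (hmu : fiber_Gibbs f phi p mu lambda C) :
  (~ amenable R G -> {ae P, forall w, (lne (spr f psi mu phi w) < p)%E}) /\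
  (forall q : \bar R, is_ext_pressure f psi phi q -> p = q -> amenable R G).
Proof.
have [r pr] := pressure_real hmu hint hlog; subst p; split=> [nam|q hq rq].
  exact: (spectral_radius_lt hG hpsi hmix hphi hint hlog hmu (nonamenable_gap hG nam)).
apply: contrapT => nam.
have := ext_pressure_lt hG hpsi hmix hphi hint hlog hmu (nonamenable_gap hG nam) hq.
by rewrite rq ltxx.
Qed.
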